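(* There exists $\beta_0 \in (0,\infty)$ such that for all $\beta \in (\beta_0,\infty)$, for $\mathsf{P}_{\mu_{cr}}$-almost every infinite Lorentzian triangulation $T \in \mathbb{LT}_\infty$, there exist at least two Gibbs measures for the Ising model on $T$ at inverse temperature $\beta$.
   Context: **Lorentzian triangulations.** Let ${\sf C}=S^1\times[0,\infty)$ and ${\sf C}_N=S^1\times[0,N]$. A Lorentzian triangulation $T$ of ${\sf C}$ (resp. ${\sf C}_N$) is a connected graph $G$ (loops and multiple edges allowed, finitely or countably many vertices) embedded in the cylinder, all of whose faces are triangles (a face is a connected component of the complement of $G$; it is a triangle if its boundary meets precisely three edges), such that the graph and its triangles cover the cylinder, each triangle lies in some strip $S^1\times[j,j+1]$ and has all its vertices and exactly one of its edges on the boundary $(S^1\times\{j\})\cup(S^1\times\{j+1\})$ of the strip, and the number of edges on each circle $S^1\times\{j\}$ is positive and finite. Throughout there is exactly one edge on $S^1\times\{0\}$. The triangulation is rooted: it carries a root triangle with ordered vertices $(x,y,z)$, where the root vertex $x$ and the directed root edge $(x,y)$ lie on $S^1\times\{0\}$ (so here the root edge is a loop and $x=y$). Triangulations are considered up to homeomorphisms respecting the root vertex and the directed root edge. $\mathbb{LT}_\infty$ and $\mathbb{LT}_N$ denote the sets of such rooted Lorentzian triangulations of ${\sf C}$ and ${\sf C}_N$ respectively (the number of edges on the top circle of ${\sf C}_N$ is not fixed). **The measure $\mathsf{P}_{\mu_{cr}}$.** Let $F(T)$ be the number of triangles of $T\in\mathbb{LT}_N$ and $\mathsf{P}_{N,\mu}(T)=e^{-\mu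 F(T)}/\sum_{T'\in\mathbb{LT}_N}e^{-\mu F(T')}$. Put $\mu_{cr}=\ln 2$. $\mathsf{P}_{\mu_{cr}}$ is the probability measure on $\mathbb{LT}_\infty$ that is the weak limit of $\mathsf{P}_{N,\mu_{cr}}$ as $N\to\infty$ (for each fixed $M$, the law of the restriction of the triangulation to ${\sf C}_M$ converges); this limit is known to exist. **Ising model.** For $T\in\mathbb{LT}_\infty$ let $T_N$ be its restriction to ${\sf C}_N$, $V(T_N)$ its vertex set, and $\partial T_N$ the set of vertices of $T$ on $S^1\times\{N+1\}$. Spins take values in $\{-1,1\}$. For a boundary configuration $\partial\sigma\in\{-1,1\}^{\partial T_N}$ and $\sigma\in\{-1,1\}^{V(T_N)}$ let $$H_N(\sigma|\partial\sigma)=-\sum_{\langle v,v'\rangle:\,v,v'\in V(T_N)}\sigma_v\sigma_{v'}-\sum_{\langle v,v'\rangle:\,v\in V(T_N),\,v'\in\partial T_N}\sigma_v\,\partial\sigma_{v'},$$ with sums over edges of $T$, and let $P^T_{N,\partial\sigma}(\sigma)$ be proportional to $\exp\{-\beta H_N(\sigma|\partial\sigma)\}$. A Gibbs measure for the Ising model on $T$ at inverse temperature $\beta$ is a probability measure on $\{-1,1\}^{V(T)}$ (product $\sigma$-algebra) that is a weak limit, along some subsequence of $N\to\infty$, of measures $P^T_{N,\partial\sigma}$ for some sequence of boundary conditions $\partial\sigma$. *)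

(* Defs.v *)
From HB Require Import structures.
From mathcomp Require Import all_boot all_order all_algebra.
From mathcomp Require Import generic_quotient.
From mathcomp Require Import all_classical all_reals all_analysis.

Set Implicit Arguments.
Unset Strict Implicit.
Unset Printing Implicit Defensive.

Import Order.TTheory GRing.Theory Num.Theory.
Import numFieldNormedType.Exports.

Local Open Scope classical_set_scope.
Local Open Scope ring_scope.

(** Lorentzian triangulations, as cell structures.

    A circle carrying n edges is oriented in the direction of the root edge;
    its vertices and its edges are both labelled by 'I_n, edge i being directed
    from vertex i to vertex [ordS i].

    In a strip between a bottom circle with m edges and a top circle with n
    edges, each triangle has exactly one edge on the two circles and each edge
    of the circles bounds exactly one triangle of the strip.  Triangles are
    therefore named after that edge: [inl i] has its base on edge i of the
    bottom circle and its apex on the top circle, [inr k] has its base on edge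
    k of the top circle and its apex on the bottom circle.  Each triangle has
    two further sides, which cross the strip.  [right t] is the triangle on the
    other side of the right-hand crossing side of t, and [bot t], [top t] are
    the end points of that crossing side.  So the crossing edges of the strip
    are in bijection with its triangles, parallel edges being kept distinct. *)
Record strip (m n : nat) := Strip {
  right : 'I_m + 'I_n -> 'I_m + 'I_n;
  bot : 'I_m + 'I_n -> 'I_m;
  top : 'I_m + 'I_n -> 'I_n;
  (* the triangles close up into one annulus *)
  right_cycle : forall t t', fconnect right t t';
  (* The left-hand crossing side of [right t] is the right-hand one of [t]. *)
  right_incidence : forall t,
    match right t with
    | inl i => [/\ bot t = i, bot (inl i) = ordS i & top (inl i) = top t]
    | inr k => [/\ top t = k, top (inr k) = ordS k & bot (inr k) = bot t]
    end }.

(** Heights of cylinders: [Some N] for S^1 x [0, N], [None] for S^1 x [0, oo).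
    [has_strip h j] says that S^1 x [j, j+1] is part of the cylinder. *)
Definition has_strip (h : option nat) (j : nat) : bool :=
  if h is Some N then (j < N)%N else true.

Definition has_circle (h : option nat) (j : nat) : bool :=
  if h is Some N then (j <= N)%N else true.

(** Since circle 0 has a single edge, which is the root edge, and all circles
    are oriented along it, the root triangle [inl ord0] of strip 0 is no
    additional data.  The value of [len] on circles above the cylinder is
    irrelevant: it is forgotten by [iso] below. *)
Record labelled (h : option nat) := Labelled {
  len : nat -> nat;
  len0 : len 0 = 1%N;
  len_gt0 : forall j, (0 < len j)%N;
  strips : forall j, has_strip h j -> strip (len j) (len j.+1) }.

Definition sum_map (A A' B B' : Type) (f : A -> A') (g : B -> B')
    (t : A + B) : A' + B' :=
  match t with inl a => inl (f a) | inr b => inr (g b) end.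

(** Root-preserving homeomorphisms: bijections between the cells of the
    cylinder compatible with all incidences and with the orientation. *)
Definition iso (h : option nat) (T T' : labelled h) : Prop :=
  exists phi : forall j, 'I_(len T j) -> 'I_(len T' j),
    [/\ forall j, has_circle h j -> bijective (phi j),
        forall j, has_circle h j -> forall i, phi j (ordS i) = ordS (phi j i)
      & forall j (hj : has_strip h j) (t : 'I_(len T j) + 'I_(len T j.+1)),
          let t' := sum_map (phi j) (phi j.+1) t in
          [/\ right (strips T' hj) t' =
                sum_map (phi j) (phi j.+1) (right (strips T hj) t),
              bot (strips T' hj) t' = phi j (bot (strips T hj) t)
            & top (strips T' hj) t' = phi j.+1 (top (strips T hj) t)]].

Lemma iso_refl h : reflexive (fun T T' : labelled h => `[< iso T T' >]).
Proof.
move=> T; apply/asboolP; exists (fun=> id); split=> [j _|//|j hj t].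
  by exists id.
have idE s : sum_map (id : 'I_(len T j) -> _) (id : 'I_(len T j.+1) -> _) s = s.
  by case: s.
by rewrite /= !idE.
Qed.

Lemma has_strip_circle h j : has_strip h j -> has_circle h j /\ has_circle h j.+1.
Proof. by case: h => //= N jN; split=> //; exact: ltnW. Qed.

Lemma iso_sym_imp h (T T' : labelled h) : iso T T' -> iso T' T.
Proof.
move=> [phi [bphi phiS phiR]].
have inv j : exists g : 'I_(len T' j) -> 'I_(len T j),
    has_circle h j -> cancel (phi j) g /\ cancel g (phi j).
  have [hj|_] := boolP (has_circle h j).
    by have [g gK Kg] := bphi j hj; exists g.
  by exists (fun=> Ordinal (len_gt0 T j)).
pose psi j := projT1 (cid (inv j)).
have psiP j : has_circle h j -> cancel (phi j) (psi j) /\ cancel (psi j) (phi j).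
  exact: (projT2 (cid (inv j))).
exists psi; split.
- by move=> j /psiP[? ?]; exists (phi j).
- move=> j hj i; have [K1 K2] := psiP j hj.
  by apply: (can_inj K1); rewrite phiS // !K2.
- move=> j hj t /=.
  have [/psiP[K1 K2] /psiP[L1 L2]] := has_strip_circle hj.
  have sK (s : 'I_(len T j) + 'I_(len T j.+1)) :
      sum_map (psi j) (psi j.+1) (sum_map (phi j) (phi j.+1) s) = s.
    by case: s => s /=; rewrite ?K1 ?L1.
  have Ks (s : 'I_(len T' j) + 'I_(len T' j.+1)) :
      sum_map (phi j) (phi j.+1) (sum_map (psi j) (psi j.+1) s) = s.
    by case: s => s /=; rewrite ?K2 ?L2.
  have [] := phiR j hj (sum_map (psi j) (psi j.+1) t).
  by rewrite Ks => -> -> ->; rewrite sK K1 L1.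
Qed.

Lemma iso_sym h : symmetric (fun T T' : labelled h => `[< iso T T' >]).
Proof. by move=> T T'; apply/asboolP/asboolP; exact: iso_sym_imp. Qed.

Lemma iso_trans h : transitive (fun T T' : labelled h => `[< iso T T' >]).
Proof.
move=> U T V /asboolP[f [f1 f2 f3]] /asboolP[g [g1 g2 g3]]; apply/asboolP.
exists (fun j => g j \o f j); split.
- by move=> j hj; apply: bij_comp; [exact: g1|exact: f1].
- by move=> j hj i /=; rewrite f2 // g2.
- move=> j hj t /=.
  have E s : sum_map (g j \o f j) (g j.+1 \o f j.+1) s =
      sum_map (g j) (g j.+1) (sum_map (f j) (f j.+1) s) by case: s.
  have [a b c] := f3 j hj t; have [] := g3 j hj (sum_map (f j) (f j.+1) t).
  by rewrite !E a b c => -> -> ->.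
Qed.

HB.instance Definition _ h := gen_eqMixin (labelled h).
HB.instance Definition _ h := gen_choiceMixin (labelled h).

Definition iso_rel h := EquivRel (fun T T' : labelled h => `[< iso T T' >])
  (@iso_refl h) (@iso_sym h) (@iso_trans h).

(** [LT None] is LT_oo and [LT (Some N)] is LT_N. *)
Definition LT (h : option nat) : Type := {eq_quot (iso_rel h)}%qT.
HB.instance Definition _ h := Choice.on (LT h).
HB.instance Definition _ h := Quotient.on (LT h).

Section one_edge.

Let swap (t : 'I_1 + 'I_1) : 'I_1 + 'I_1 :=
  match t with inl i => inr i | inr k => inl k end.

Let swap_cycle t t' : fconnect swap t t'.
Proof.
by case: t t' => t [] t'; rewrite (ord1 t) (ord1 t'); first
  [exact: connect0 | exact: (@fconnect1 _ swap)].
Qed.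

Let swap_incidence t : match swap t with
  | inl i => [/\ ord0 = i, ord0 = ordS i & ord0 = ord0 :> 'I_1]
  | inr k => [/\ ord0 = k, ord0 = ordS k & ord0 = ord0 :> 'I_1]
  end.
Proof. by case: t => t; split; rewrite // [LHS]ord1 [RHS]ord1. Qed.

Definition one_edge_strip : strip 1 1 :=
  @Strip 1 1 swap (fun=> ord0) (fun=> ord0) swap_cycle swap_incidence.

Definition one_edge h : labelled h :=
  @Labelled h (fun=> 1%N) erefl (fun=> isT) (fun=> fun=> one_edge_strip).

End one_edge.

HB.instance Definition _ h := isPointed.Build (LT h) (\pi_(LT h) (one_edge h))%qT.

(** Restriction to S^1 x [0, M], for cylinders of height at least M. *)
Definition restrict_labelled h M
    (hM : forall j, has_strip (Some M) j -> has_strip h j)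
    (T : labelled h) : labelled (Some M) :=
  @Labelled (Some M) (len T) (len0 T) (len_gt0 T)
    (fun j hj => strips T (hM j hj)).

Definition restrict_infinite M (T : LT None) : LT (Some M) :=
  (\pi_(LT (Some M)) (@restrict_labelled None M (fun _ _ => isT) (repr T)))%qT.

Definition restrict_finite M k (T : LT (Some (M + k)%N)) : LT (Some M) :=
  (\pi_(LT (Some M)) (@restrict_labelled (Some (M + k)%N) M
     (fun j hj => ltn_addr k hj) (repr T)))%qT.

Definition triangles N (T : LT (Some N)) : nat :=
  (\sum_(j < N) #|{: 'I_(len (repr T) j) + 'I_(len (repr T) j.+1)}|)%N.

Section measures.
Variable R : realType.

Definition mu_cr : R := ln 2.

Definition weight (mu : R) N (T : LT (Some N)) : R :=
  expR (- mu * (triangles T)%:R).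

(** The probability of an event under P_{N,mu}; meaningful when the partition
    function is finite, which is the case for mu = mu_cr. *)
Definition finite_law (mu : R) N (A : set (LT (Some N))) : R :=
  fine (\esum_(T in A) (weight mu T)%:E) /
  fine (\esum_(T in [set: LT (Some N)]) (weight mu T)%:E).

End measures.

Definition LT_cylinders : set (set (LT None)) :=
  [set B | exists M (t : LT (Some M)), B = [set T | restrict_infinite M T = t]].

Definition LT_infinite := g_sigma_algebraType LT_cylinders.

(** P is the weak limit of P_{N,mu_cr}: for each M the law of the restriction
    to S^1 x [0, M] converges weakly.  As LT_M is discrete, every subset A of
    LT_M is a continuity set.  The height of the finite cylinder is N = M + k,
    with k tending to infinity. *)
Definition is_critical_limit (R : realType) (P : probability LT_infinite R) :=
  forall M (A : set (LT (Some M))),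
    (fun k => finite_law (mu_cr R) (@restrict_finite M k @^-1` A)) @ \oo -->
      fine (P (restrict_infinite M @^-1` A)).

Section Ising.
Variables (R : realType) (T : labelled None).

Definition strip_of (j : nat) : strip (len T j) (len T j.+1) :=
  @strips None T j isT.

Definition vertex : Type := {j : nat & 'I_(len T j)}.
HB.instance Definition _ := Choice.on vertex.

Definition vertex_upto (N : nat) : Type := {j : 'I_N.+1 & 'I_(len T j)}.
HB.instance Definition _ N := Finite.on (vertex_upto N).

Definition boundary (N : nat) : Type := 'I_(len T N.+1).

(** Spins are coded by booleans, [true] standing for 1 and [false] for -1. *)
Definition spin (b : bool) : R := if b then 1 else -1.

Definition spin_at N (sigma : {ffun vertex_upto N -> bool})
    j (hj : (j < N.+1)%N) (i : 'I_(len T j)) : R :=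
  spin (sigma (existT (fun j : 'I_N.+1 => 'I_(len T j)) (Ordinal hj) i)).

(** The edges of T between vertices of T_N are the edges of the circles
    0, ..., N and the crossing edges of the strips 0, ..., N - 1; those between
    T_N and its boundary are the crossing edges of strip N. *)
Definition hamiltonian N (bc : boundary N -> bool)
    (sigma : {ffun vertex_upto N -> bool}) : R :=
  - (\sum_(j < N.+1) \sum_(i < len T j)
       spin_at sigma (ltn_ord j) i * spin_at sigma (ltn_ord j) (ordS i)
   + \sum_(j < N) \sum_(t : 'I_(len T j) + 'I_(len T j.+1))
       spin_at sigma (leqW (ltn_ord j)) (bot (strip_of j) t) *
       spin_at sigma (ltn_ord j : (j.+1 < N.+1)%N) (top (strip_of j) t))
  - \sum_(t : 'I_(len T N) + 'I_(len T N.+1))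
       spin_at sigma (ltnSn N) (bot (strip_of N) t) *
       spin (bc (top (strip_of N) t)).

Definition boltzmann (beta : R) N (bc : boundary N -> bool)
    (sigma : {ffun vertex_upto N -> bool}) : R :=
  expR (- beta * hamiltonian bc sigma).

Definition finite_gibbs (beta : R) N (bc : boundary N -> bool)
    (sigma : {ffun vertex_upto N -> bool}) : R :=
  boltzmann beta bc sigma /
  \sum_(tau : {ffun vertex_upto N -> bool}) boltzmann beta bc tau.

Definition spins_cylinders : set (set (vertex -> bool)) :=
  [set B | exists v b, B = [set omega : vertex -> bool | omega v = b]].

Definition spins := g_sigma_algebraType spins_cylinders.

(** Configurations on T_N are viewed as configurations on T by a fixed spin
    outside T_N; the choice is irrelevant for weak limits as N -> oo. *)
Definition extend N (sigma : {ffun vertex_upto N -> bool}) : vertex -> bool :=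
  fun v => match @idP (tag v < N.+1)%N with
  | ReflectT hj =>
      sigma (existT (fun j : 'I_N.+1 => 'I_(len T j)) (Ordinal hj) (tagged v))
  | ReflectF _ => true
  end.

Definition is_gibbs (beta : R) (nu : probability spins R) : Prop :=
  exists (u : nat -> nat) (bc : forall N, boundary N -> bool),
    {homo u : k l / (k < l)%N} /\
    forall f : {ptws vertex -> bool} -> R, continuous f ->
      (fun k => \sum_(sigma : {ffun vertex_upto (u k) -> bool})
         finite_gibbs beta (bc (u k)) sigma * f (extend sigma)) @ \oo -->
      (\int[nu]_omega f omega).

(** Measures are total functions on [set spins], so distinctness has to be
    witnessed by a measurable set. *)
Definition two_gibbs (beta : R) : Prop :=
  exists nu1 nu2 : probability spins R,
    [/\ is_gibbs beta nu1, is_gibbs beta nu2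
      & exists2 A : set spins, measurable A & nu1 A <> nu2 A].

End Ising.

(* Main.v *)
(** Cutting each strip along its crossing edges identifies a Lorentzian
    triangulation with the genealogical tree in which the top edges seen from a
    bottom vertex are its children.  At mu_cr = ln 2 the weights are those of
    the critical Galton--Watson process with geometric offspring law, so the
    generating functions are iterates of x |-> 1 / (2 - x) and everything is
    explicit; P is the law of the tree conditioned to survive.  Put
    g = log_2 h.  On circle h - g the vertices fall into g + 1 residue classes,
    and a given class dies out before circle h + g + 1 with probability
    O(g^4 / h^2); by Borel--Cantelli, almost surely at all large heights h
    every class has a descendant there.  This yields g + 1 disjoint upward
    paths across the annulus around height h.

    A contour surrounding the root and crossing the path of base vertices at
    height h must cross all these paths unless it leaves the annulus, so it has
    more than g edges.  There are at most 36^n contours of n edges through a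
    given edge, whence the Peierls sum over contours outside S^1 x [0, M] is at
    most 1/4 once 36 exp(-2 beta) <= 1/4.  Infinite couplings inside
    S^1 x [0, M] exclude the other contours, and by Griffiths' inequalities
    removing them costs a factor that does not depend on N.  So the
    magnetization of the root with plus boundary conditions is bounded below,
    and by compactness and spin flip the plus and minus boundary conditions
    have distinct weak limits. *)

Require Import Defs.
From HB Require Import structures.
From mathcomp Require Import all_boot all_order all_algebra.
From mathcomp Require Import generic_quotient.
From mathcomp Require Import all_classical all_reals all_analysis.
From mathcomp Require Import measurable_realfun.
From mathcomp Require Import zify ring lra.

Set Implicit Arguments.
Unset Strict Implicit.
Unset Printing Implicit Defensive.

Import Order.TTheory GRing.Theory Num.Theory.
Import numFieldNormedType.Exports.

(** * Strips and offspring sequences *)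

(** The threshold for [beta] must not depend on T, whereas the height M above which all annuli are
    good does. No uniform Peierls bound controls the short contours near the root; wiring the core
    below M moves the dependence on T from [beta] into the lower bound for the magnetization. Vertex
    degrees are unbounded, so contours are counted through triangles. An edge shares a triangle with
    at most 6 edges, itself included, and a connected set of n edges is covered by a walk of 2 (n -
    1) steps; this gives 36^n, and 36 exp(-2 beta) <= 1/4 means exp(beta) >= 12. Residue classes are
    fixed by the size of a circle before anything is known about its descendants, so the extinction
    of a class has a product formula. Lineages from different classes stay disjoint because a vertex
    has only one parent. Planarity enters through algebra: the indicator of a component of
    disagreement edges is a closed one-form modulo two, and it is exact because it vanishes on
    circle 0. *)

Lemma val_iter_ordS n p (x : 'I_n) : iter p (@ordS n) x = (x + p) %% n :> nat.
Proof.
elim: p => [|p IH]; first by rewrite addn0 modn_small.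
by rewrite iterS /= IH -addn1 modnDml addn1 addnS.
Qed.

Lemma iter_ordS_surj n (x y : 'I_n) : exists2 p, p < n & y = iter p (@ordS n) x.
Proof.
have n0 : 0 < n by case: n x {y} => [[]|].
exists ((y + (n - x)) %% n); first by rewrite ltn_mod.
apply: val_inj => /=; rewrite val_iter_ordS modnDmr addnCA subnKC ?modnDr ?modn_small //.
exact: ltnW.
Qed.

Lemma iter_ordS_inj n (x : 'I_n) p q : p < n -> q < n ->
  iter p (@ordS n) x = iter q (@ordS n) x -> p = q.
Proof.
move=> pn qn /(congr1 (@nat_of_ord n)); rewrite !val_iter_ordS => /eqP.
by rewrite eqn_modDl !modn_small // => /eqP.
Qed.

Section StripTheory.
Variables (m n : nat) (s : strip m n).
Implicit Types (i : 'I_m) (k : 'I_n) (t : 'I_m + 'I_n).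
Let R := right s.

Definition is_inl t := if t is inl _ then true else false.

Lemma right_iter t t' : exists p, t' = iter p R t.
Proof. by have /iter_findex <- := right_cycle s t t'; eexists. Qed.

Lemma right_surj t : exists t', R t' = t.
Proof.
have [p ->] := right_iter (R t) t.
by exists (iter p R t); rewrite -iterS iterSr.
Qed.

Lemma right_inj : injective R.
Proof.
pose g t := projT1 (cid (right_surj t)).
have gK : cancel g R by move=> t; exact: projT2 (cid (right_surj t)).
have [h gh hg] := injF_bij (can_inj gK).
by move=> x y /(congr1 g); rewrite -(hg x) -(hg y) !gK => ->.
Qed.

Lemma bot_inl i : bot s (inl i) = ordS i.
Proof.
by have [t e] := right_surj (inl i); have := right_incidence s t; rewrite -/R e => -[].
Qed.

Lemma top_inr k : top s (inr k) = ordS k.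
Proof.
by have [t e] := right_surj (inr k); have := right_incidence s t; rewrite -/R e => -[].
Qed.

Definition children i := #|[pred k | bot s (inr k) == i]|.

Lemma run_step i q :
    (forall p, p < q -> ~~ is_inl (iter p.+1 R (inl i))) ->
  [/\ bot s (iter q R (inl i)) = ordS i,
      top s (iter q R (inl i)) = iter q (@ordS n) (top s (inl i))
    & 0 < q -> iter q R (inl i) = inr (iter q.-1 (@ordS n) (top s (inl i)))].
Proof.
elim: q => [|q IH] H; first by rewrite bot_inl.
have [|b t e] := IH; first by move=> p pq; apply: H; exact: ltnW.
have := right_incidence s (iter q R (inl i)); have := H q (ltnSn _).
rewrite iterS -/R; case E : (R _) => [//|k] _ [tk k1 k2].
by split=> //= [||_]; rewrite ?k2 ?k1 -?tk ?t.
Qed.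

Lemma run_length i : exists2 r, is_inl (iter r.+1 R (inl i))
  & forall p, p < r -> ~~ is_inl (iter p.+1 R (inl i)).
Proof.
have ex : exists r, is_inl (iter r.+1 R (inl i)).
  by have [p e] := right_iter (R (inl i)) (inl i); exists p; rewrite iterSr -e.
case: (ex_minnP ex) => r r1 r2; exists r => // p pr.
by apply/negP => /r2; rewrite leqNgt pr.
Qed.

Lemma run_inr k : exists i q, [/\ inr k = iter q.+1 R (inl i)
  & forall p, p <= q -> ~~ is_inl (iter p.+1 R (inl i))].
Proof.
have i0 : 'I_m by case: (bot s (inr k)) => i h; exists i.
have [p0] := right_iter (inl i0) (inr k).
elim/ltn_ind: p0 i0 => p0 IH i0 e.
have [r r1 r2] := run_length i0.
have [rp|pr] := ltnP r p0.
  case E : (iter r.+1 R (inl i0)) r1 => [i1|] // _.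
  apply: (IH (p0 - r.+1)%N _ i1); first by rewrite ltn_subrL /=; case: (p0) rp.
  by rewrite -E -iterD subnK.
case: p0 e pr {IH} => [//|q] e qr; exists i0, q; split=> // p pq.
by apply: r2; exact: leq_ltn_trans pq _.
Qed.

(** [bot] is constant along a run of top triangles and every top triangle lies in such a run. Hence
    the triangles between [inl i] and [inl (ordS i)] are exactly those with apex [ordS i], on
    consecutive top edges. *)
Lemma blockP i (r := children (ordS i)) (x := top s (inl i)) :
  [/\ forall q, q < r -> iter q.+1 R (inl i) = inr (iter q (@ordS n) x),
      iter r.+1 R (inl i) = inl (ordS i),
      top s (inl (ordS i)) = iter r (@ordS n) x,
      forall q, q < r -> bot s (inr (iter q (@ordS n) x)) = ordS i
    & forall k, bot s (inr k) = ordS i -> exists2 q, q < r & k = iter q (@ordS n) x].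
Proof.
have [r' r1 r2] := run_length i.
have run q : q <= r' -> [/\ bot s (iter q R (inl i)) = ordS i,
      top s (iter q R (inl i)) = iter q (@ordS n) x
    & 0 < q -> iter q R (inl i) = inr (iter q.-1 (@ordS n) x)].
  by move=> qr; apply: run_step => p pq; apply: r2; exact: leq_trans pq qr.
have chP k : bot s (inr k) = ordS i -> exists2 q, q < r' & k = iter q (@ordS n) x.
  have [i' [q [e nq]]] := run_inr k.
  have [b _ e'] := @run_step i' q.+1 nq; rewrite e b => /ordS_inj ii'; subst i'.
  have qr : q < r'.
    by rewrite ltnNge; apply/negP => rq; move: (nq _ rq); rewrite r1.
  by exists q => //; have [_ _ /(_ isT)] := run _ qr; rewrite -e => -[].
(* A repeated top edge would, by injectivity of [right], bring the walk back to [inl i] before the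
   run ends. So the length of the run is the number of children. *)
have inj p q : p < r' -> q < r' ->
    iter p (@ordS n) x = iter q (@ordS n) x -> p = q.
  wlog pq : p q / p <= q.
    by move=> W; case/orP: (leq_total p q) => H ? ? ?; [|symmetry]; exact: W.
  move=> pr qr e; have [_ _ /(_ isT) e1] := run _ pr; have [_ _ /(_ isT) e2] := run _ qr.
  have : iter p.+1 R (inl i) = iter p.+1 R (iter (q - p) R (inl i)).
    by rewrite -iterD addSn subnKC // e1 e2 /= e.
  have injR l : injective (iter l R).
    by elim: l => [|l IHl] u v //= /right_inj/IHl.
  move=> /injR ee; apply/eqP; rewrite eqn_leq pq leqNgt.
  apply/negP => lt; have lt' : (q - p).-1 < r' by lia.
  by have := r2 _ lt'; rewrite prednK ?subn_gt0 // -ee.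
have rE : r = r'.
  rewrite /r /children -(size_iota 0 r') -(size_map (fun q => iter q (@ordS n) x)).
  have U : uniq [seq iter q (@ordS n) x | q <- iota 0 r'].
    rewrite map_inj_in_uniq ?iota_uniq // => p q; rewrite !mem_iota /= add0n.
    by move=> pr qr; exact: inj.
  rewrite -(card_uniqP U); apply: eq_card => k; rewrite !inE.
  apply/eqP/mapP => [/chP[q qr ->]|[q]]; first by exists q; rewrite // mem_iota.
  rewrite mem_iota add0n /= => qr ->.
  by have [b _ /(_ isT) <-] := run _ qr.
rewrite rE; have [b t _] := run r' (leqnn _).
have [e1 e2] : iter r'.+1 R (inl i) = inl (ordS i) /\
     top s (inl (ordS i)) = iter r' (@ordS n) x.
  have := right_incidence s (iter r' R (inl i)); rewrite -/R -iterS.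
  by case: (iter r'.+1 R (inl i)) r1 => // j _ [<- _]; rewrite b t.
split=> // q qr; have [b' t' /(_ isT) e] := run _ qr; first by [].
by rewrite -b' e.
Qed.

Definition offspring (x : 'I_m) : seq nat :=
  [seq children (iter p (@ordS m) x) | p <- iota 0 m].

(** The leftmost crossing edge at x is the right-hand side of the triangle based on the edge before
    x. Its top end point makes sense for a childless x too. *)
Definition next_base (x : 'I_m) : 'I_n := top s (inl (ord_pred x)).

Lemma size_offspring x : size (offspring x) = m.
Proof. by rewrite size_map size_iota. Qed.

Lemma nth_offspring x p : p < m -> nth 0 (offspring x) p = children (iter p (@ordS m) x).
Proof. by move=> pm; rewrite (nth_map 0) ?size_iota // nth_iota. Qed.

Lemma reindex_iter_ordS (x : 'I_m) (F : 'I_m -> nat) :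
  \sum_i F i = \sum_(0 <= p < m) F (iter p (@ordS m) x).
Proof.
rewrite big_mkord (reindex (fun p : 'I_m => iter p (@ordS m) x)) //=.
apply: onW_bij; apply: injF_bij => p q /iter_ordS_inj e; apply: val_inj.
exact: e.
Qed.

Lemma sumn_offspring x : sumn (offspring x) = n.
Proof.
have -> : sumn (offspring x) = \sum_i children i.
  by rewrite sumnE big_map (reindex_iter_ordS x) /index_iota subn0.
rewrite -[RHS]card_ord -sum1_card (partition_big (fun k => bot s (inr k)) predT) //=.
by apply: eq_bigr => i _; rewrite sum1_card.
Qed.

Lemma next_base_ordS (x : 'I_m) p : p <= m ->
  next_base (iter p (@ordS m) x) = iter (sumn (take p (offspring x))) (@ordS n) (next_base x).
Proof.
elim: p => [|p IH] pm; first by rewrite take0.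
rewrite (take_nth 0) ?size_offspring // sumn_rcons addnC iterD -IH 1?ltnW //.
rewrite nth_offspring // iterS /next_base ordSK.
by have [_ _] := blockP (ord_pred (iter p (@ordS m) x)); rewrite ord_predK.
Qed.

(** Read from [next_base x], the top edges list the children of x, then those of [ordS x], and so
    on; the parent of an edge is the block of [offspring x] into which it falls. *)
Lemma bot_inr_iter (x : 'I_m) p : p < n ->
  bot s (inr (iter p (@ordS n) (next_base x))) =
  iter (reshape_index (offspring x) p) (@ordS m) x.
Proof.
move=> pn.
have pn' : p < sumn (offspring x) by rewrite sumn_offspring.
set c := offspring x; set r := reshape_index c p; set q := reshape_offset c p.
have rm : r < m by rewrite -(size_offspring x); exact: reshape_indexP.
have qr : q < children (iter r (@ordS m) x).
  by rewrite -nth_offspring //; exact: reshape_offsetP.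
have <- : flatten_index c r q = p by exact: reshape_indexK.
rewrite /flatten_index addnC iterD -next_base_ordS; last exact: ltnW.
have [_ _ _ /(_ q) b _] := blockP (ord_pred (iter r (@ordS m) x)).
by rewrite ord_predK in b; exact: b.
Qed.

End StripTheory.

Section StripIso.
Variables (m n m' n' : nat) (s : strip m n) (s' : strip m' n').
Variables (f : 'I_m -> 'I_m') (g : 'I_n -> 'I_n').
Hypothesis fS : forall i, f (ordS i) = ordS (f i).
Hypothesis gS : forall k, g (ordS k) = ordS (g k).

Let f_iter p i : f (iter p (@ordS m) i) = iter p (@ordS m') (f i).
Proof. by elim: p => //= p <-. Qed.

Let g_iter p k : g (iter p (@ordS n) k) = iter p (@ordS n') (g k).
Proof. by elim: p => //= p <-. Qed.

(** Rigidity behind the codes: the leftmost edge at one vertex and the offspring numbers read from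
    there determine the strip. *)
Lemma strip_isoP (x : 'I_m) : g (next_base s x) = next_base s' (f x) ->
    offspring s x = offspring s' (f x) -> forall t,
  [/\ right s' (sum_map f g t) = sum_map f g (right s t),
      bot s' (sum_map f g t) = f (bot s t)
    & top s' (sum_map f g t) = g (top s t)].
Proof.
move=> gx off.
have mm : m = m' by rewrite -(size_offspring s x) off size_offspring.
have nn : n = n' by rewrite -(sumn_offspring s x) off sumn_offspring.
have ch i : children s i = children s' (f i).
  have [p pm ->] := iter_ordS_surj x i.
  by rewrite f_iter -!nth_offspring -?mm // off.
have fP i : f (ord_pred i) = ord_pred (f i).
  by apply: (@ordS_inj m'); rewrite -fS !ord_predK.
have topl i : g (top s (inl i)) = top s' (inl (f i)).
  have [p pm e] := iter_ordS_surj x (ordS i).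
  have := next_base_ordS s x (ltnW pm); rewrite -e /next_base ordSK => ->.
  have pm' : p <= m' by rewrite -mm ltnW.
  have := next_base_ordS s' (f x) pm'.
  rewrite -f_iter -e fS /next_base ordSK => ->.
  by rewrite g_iter -off; congr (iter _ _ _); exact: gx.
(* Each triangle is reached from a bottom triangle by the same number of right moves in both strips,
   so all incidences can be read off [blockP]. *)
have run t : exists i q, [/\ q <= children s (ordS i), t = iter q (right s) (inl i)
    & sum_map f g t = iter q (right s') (inl (f i))].
  case: t => [i|k]; first by exists i, 0.
  set i := ord_pred (bot s (inr k)).
  have e : bot s (inr k) = ordS i by rewrite ord_predK.
  clearbody i.
  have [b1 _ _ _ /(_ _ e)[q qr kq]] := blockP s i.
  have [b1' _ _ _ _] := blockP s' (f i).
  exists i, q.+1; rewrite b1 // -kq; split=> //.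
  by rewrite b1' -?fS -?ch //= kq g_iter topl.
split.
- have [i [q [qr -> ->]]] := run t; rewrite -!iterS.
  have [b1 b2 _ _ _] := blockP s i; have [b1' b2' _ _ _] := blockP s' (f i).
  rewrite -fS -ch in b1' b2'.
  move: qr; rewrite leq_eqVlt => /orP[/eqP->|qr]; first by rewrite b2 b2'.
  by rewrite b1 // b1' //= g_iter topl.
- case: t => [i|k] /=; first by rewrite !bot_inl fS.
  have [p pn ->] := iter_ordS_surj (next_base s x) k.
  by rewrite bot_inr_iter // g_iter gx bot_inr_iter -?nn // f_iter off.
- by case: t => [i|k] /=; rewrite ?topl // !top_inr gS.
Qed.

Lemma offspring_iso (x : 'I_m) : bijective f -> bijective g -> (forall t,
    [/\ right s' (sum_map f g t) = sum_map f g (right s t),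
      bot s' (sum_map f g t) = f (bot s t)
    & top s' (sum_map f g t) = g (top s t)]) ->
  g (next_base s x) = next_base s' (f x) /\ offspring s x = offspring s' (f x).
Proof.
move=> bf bg H.
have fP i : f (ord_pred i) = ord_pred (f i).
  by apply: (@ordS_inj m'); rewrite -fS !ord_predK.
split; first by have [_ _] := H (inl (ord_pred x)); rewrite /= fP.
have mm : m = m' by rewrite -[m]card_ord -[m']card_ord; exact: bij_eq_card bf.
rewrite /offspring -[in iota 0 m']mm; apply: eq_map => p; rewrite -f_iter.
rewrite /children -(fintype.card_image (bij_inj bg)); apply: eq_card => k'.
have [g' gK g'K] := bg; rewrite -(g'K k') fintype.mem_image ?inE; last exact: bij_inj.
by have [_ /= -> _] := H (inr (g' k')); rewrite (bij_eq bf).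
Qed.

End StripIso.

(** * Codes as complete isomorphism invariants *)

Section Codes.
Variable h : option nat.
Implicit Types T : labelled h.

(* The vertex of circle j on the upward path from the root that always takes the
   leftmost crossing edge. *)
Fixpoint base T j : 'I_(len T j) :=
  match j with
  | 0 => Ordinal (len_gt0 T 0)
  | i.+1 => match @idP (has_strip h i) with
            | ReflectT hi => next_base (strips T hi) (base T i)
            | ReflectF _ => Ordinal (len_gt0 T i.+1)
            end
  end.

Definition code_at T j : seq nat :=
  match @idP (has_strip h j) with
  | ReflectT hj => offspring (strips T hj) (base T j)
  | ReflectF _ => [::]
  end.

Lemma baseS T j (hj : has_strip h j) : base T j.+1 = next_base (strips T hj) (base T j).
Proof. by rewrite /=; case: {-}_ / idP => // hj'; rewrite (bool_irrelevance hj' hj). Qed.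

Lemma code_atE T j (hj : has_strip h j) :
  code_at T j = offspring (strips T hj) (base T j).
Proof. by rewrite /code_at; case: {-}_ / idP => // hj'; rewrite (bool_irrelevance hj' hj). Qed.

Lemma size_code_at T j : has_strip h j -> size (code_at T j) = len T j.
Proof. by move=> hj; rewrite code_atE size_offspring. Qed.

Lemma sumn_code_at T j : has_strip h j -> sumn (code_at T j) = len T j.+1.
Proof. by move=> hj; rewrite code_atE sumn_offspring. Qed.

Lemma has_circleS j : has_circle h j.+1 = has_strip h j.
Proof. by case: h. Qed.

(** Circle 0 has a single vertex, so an isomorphism fixes the root; [next_base] depends on
    incidences alone, so base vertices are preserved at all heights. *)
Lemma iso_code T T' : iso T T' ->
  forall j, has_strip h j -> code_at T j = code_at T' j.
Proof.
move=> [phi [phi1 phi2 phi3]].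
have bP j : has_circle h j -> phi j (base T j) = base T' j.
  elim: j => [|j IH] hj.
    by apply: val_inj => /=; case: (phi 0 _) => a /=; rewrite {1}len0; case: a.
  have [c1 c2] := has_strip_circle hj.
  rewrite (baseS T hj) (baseS T' hj) -(IH c1).
  exact: (offspring_iso (phi2 _ c1) _ (phi1 _ c1) (phi1 _ c2) (phi3 _ hj)).1.
move=> j hj; have [c1 c2] := has_strip_circle hj.
rewrite !(code_atE _ hj) -(bP j c1).
exact: (offspring_iso (phi2 _ c1) _ (phi1 _ c1) (phi1 _ c2) (phi3 _ hj)).2.
Qed.

(** The isomorphism is the rotation of each circle that sends base vertex to base vertex. *)
Lemma code_iso T T' : (forall j, has_strip h j -> code_at T j = code_at T' j) -> iso T T'.
Proof.
move=> H.
have lE j : has_circle h j -> len T j = len T' j.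
  case: j => [|j]; first by rewrite !len0.
  by rewrite has_circleS => hj; rewrite -!sumn_code_at // H.
pose d j (i : 'I_(len T j)) := projT1 (cid2 (iter_ordS_surj (base T j) i)).
pose phi j i := iter (d j i) (@ordS (len T' j)) (base T' j).
have dP j i : d j i < len T j /\ i = iter (d j i) (@ordS _) (base T j).
  by rewrite /d; case: cid2.
have phiE j p : has_circle h j ->
    phi j (iter p (@ordS _) (base T j)) = iter p (@ordS _) (base T' j).
  move=> hj; apply: val_inj => /=; rewrite !val_iter_ordS.
  have [d1 /(congr1 (@nat_of_ord _))] := dP j (iter p (@ordS _) (base T j)).
  rewrite !val_iter_ordS => /eqP; rewrite eqn_modDl => /eqP e.
  by rewrite -modnDmr -[RHS]modnDmr; congr ((_ + _) %% _); rewrite -(lE _ hj).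
have phiS j : has_circle h j -> forall i, phi j (ordS i) = ordS (phi j i).
  move=> hj i; have [_ ->] := dP j i.
  by rewrite -iterS !phiE.
exists phi; split=> //.
  move=> j hj; apply: inj_card_bij; last by rewrite !card_ord lE.
  move=> i i'; have [i1 ->] := dP j i; have [i2 ->] := dP j i'.
  by rewrite !phiE // => /iter_ordS_inj -> //; rewrite -lE.
move=> j hj t /=; have [c1 c2] := has_strip_circle hj.
have e : base T' j = phi j (base T j) by rewrite -[base T j]/(iter 0 (@ordS _) _) phiE.
apply: (strip_isoP (phiS _ c1) (phiS _ c2) (x := base T j)).
  by rewrite -e -!baseS -[base T j.+1]/(iter 0 (@ordS _) _) phiE.
by rewrite -e -!code_atE H.
Qed.

End Codes.

(** * Strips with a prescribed offspring sequence *)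

Section MakeStrip.
Variables (m n : nat) (c : seq nat).
Hypotheses (n0 : 0 < n) (cm : size c = m) (cn : sumn c = n).
Implicit Types (i : 'I_m) (k : 'I_n).

Lemma parent_proof k : reshape_index c k < m.
Proof. by rewrite -cm reshape_indexP // cn. Qed.

Definition parent k : 'I_m := Ordinal (parent_proof k).

Lemma start_proof i : sumn (take i c) %% n < n.
Proof. by rewrite ltn_mod. Qed.

(* The first child of bottom vertex i, or the place where it would be inserted. *)
Definition start i : 'I_n := Ordinal (start_proof i).

(** The test [k.+1 < n] forbids wrapping around: if one vertex has all n children, [ordS k] is again
    a child of it after the last one, although its run is over. *)
Definition mk_right (t : 'I_m + 'I_n) : 'I_m + 'I_n :=
  match t with
  | inl i => if nth 0 c (ordS i) == 0 then inl (ordS i) else inr (start (ordS i))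
  | inr k => if (k.+1 < n) && (parent (ordS k) == parent k)
             then inr (ordS k) else inl (parent k)
  end.

Definition mk_bot (t : 'I_m + 'I_n) : 'I_m :=
  match t with inl i => ordS i | inr k => parent k end.

Definition mk_top (t : 'I_m + 'I_n) : 'I_n :=
  match t with inl i => start (ordS i) | inr k => ordS k end.

Lemma sumn_take_le p : sumn (take p c) <= n.
Proof. by rewrite -cn -{2}(cat_take_drop p c) sumn_cat leq_addr. Qed.

Lemma sumn_take_S p : sumn (take p.+1 c) = sumn (take p c) + nth 0 c p.
Proof.
have [ic|ci] := ltnP p (size c); first by rewrite (take_nth 0) // sumn_rcons.
by rewrite nth_default // !take_oversize // ?addn0 // ltnW.
Qed.

Lemma val_start i : nth 0 c i != 0 -> start i = sumn (take i c) :> nat.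
Proof.
move=> ci; rewrite /= modn_small //.
by have := sumn_take_le i.+1; rewrite sumn_take_S; lia.
Qed.

Lemma parent_start i : nth 0 c i != 0 -> parent (start i) = i.
Proof.
move=> ci; apply: val_inj; change (reshape_index c (start i) = i :> nat); rewrite val_start //.
by have := @flatten_indexKl c i 0; rewrite /flatten_index addn0 => -> //; lia.
Qed.

Lemma val_start_ordS i : start (ordS i) = sumn (take i.+1 c) %% n :> nat.
Proof.
rewrite /=; have := ltn_ord i; rewrite leq_eqVlt => /orP[/eqP e|lt].
  by rewrite [in LHS]e modnn take0 mod0n take_oversize ?cn ?modnn // e cm.
by rewrite [i.+1 %% m]modn_small.
Qed.

Lemma start0 i : nth 0 c i = 0 -> start (ordS i) = start i.
Proof.
by move=> ci; apply/val_inj/(etrans (val_start_ordS i)); rewrite sumn_take_S ci addn0.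
Qed.

Lemma parentP k : sumn (take (parent k) c) <= k < sumn (take (parent k).+1 c).
Proof.
have kn : k < sumn c by rewrite cn.
have e : k = sumn (take (parent k) c) + reshape_offset c k :> nat.
  by rewrite -[LHS](reshape_indexK c k).
by rewrite sumn_take_S e leq_addr ltn_add2l reshape_offsetP.
Qed.

Lemma parent_uniq k i : sumn (take i c) <= k < sumn (take i.+1 c) -> parent k = i.
Proof.
case/andP=> h1; rewrite sumn_take_S => h2; apply: val_inj => /=.
by rewrite -[X in reshape_index c X](subnKC h1) -/(flatten_index c i _) flatten_indexKl ?ltn_subLR.
Qed.

Lemma last_child k : ~~ ((k.+1 < n) && (parent (ordS k) == parent k)) ->
  k.+1 = sumn (take (parent k).+1 c).
Proof.
have /andP[h1 h2] := parentP k => H; apply/eqP; rewrite eqn_leq h2 leqNgt.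
apply: contra H => h3; have kn : k.+1 < n by exact: leq_trans h3 (sumn_take_le _).
rewrite kn; apply/eqP/parent_uniq; rewrite /= modn_small // h3 andbT.
exact: leqW.
Qed.

Lemma mk_incidence t : match mk_right t with
  | inl i => [/\ mk_bot t = i, mk_bot (inl i) = ordS i & mk_top (inl i) = mk_top t]
  | inr k => [/\ mk_top t = k, mk_top (inr k) = ordS k & mk_bot (inr k) = mk_bot t]
  end.
Proof.
case: t => [i|k]; rewrite /mk_right.
  case: eqP => [/start0 e|/eqP ci]; first by rewrite /mk_bot /mk_top e.
  by rewrite /mk_bot parent_start.
case: ifPn => /= [/andP[_ /eqP e]|/last_child e]; first by rewrite e.
by split=> //; apply/val_inj/(etrans (val_start_ordS _)); rewrite /= e.
Qed.

Lemma connect_inr_inl k : fconnect mk_right (inr k) (inl (parent k)).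
Proof.
have [l] := ubnP (n - k); elim: l k => // l IH k kl.
have [/andP[k1 /eqP e]|H] := boolP ((k.+1 < n) && (parent (ordS k) == parent k)).
  apply: (@connect_trans _ _ (inr (ordS k))); first by apply: connect1; rewrite /= k1 e eqxx.
  by rewrite -e; apply: IH; rewrite /= modn_small //; lia.
by apply: connect1; rewrite /= (negPf H).
Qed.

Lemma connect_inlS i : fconnect mk_right (inl i) (inl (ordS i)).
Proof.
have [ci|ci] := eqVneq (nth 0 c (ordS i)) 0.
  by apply: connect1; rewrite /= ci.
apply: (@connect_trans _ _ (inr (start (ordS i)))).
  by apply: connect1; rewrite /= (negPf ci).
by rewrite -{2}(parent_start ci); exact: connect_inr_inl.
Qed.

Lemma connect_inl i i' : fconnect mk_right (inl i) (inl i').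
Proof.
have [p _ ->] := iter_ordS_surj i i'.
elim: p => [|p IH]; first exact: connect0.
by apply: connect_trans IH _; rewrite iterS; exact: connect_inlS.
Qed.

Lemma connect_inl_inr k : fconnect mk_right (inl (ord_pred (parent k))) (inr k).
Proof.
set i := parent k; have /andP[h1 h2] := parentP k.
have ci : nth 0 c i != 0 by move: h1 h2; rewrite sumn_take_S -/i; lia.
apply: (@connect_trans _ _ (inr (start i))).
  by apply: connect1; apply/eqP; rewrite /mk_right ord_predK (negPf ci).
have [st stE stv] : exists2 st, start i = st :> nat & st = sumn (take i c).
  by exists (start i); rewrite // val_start.
have H p (k' : 'I_n) : k' = st + p :> nat -> k' < sumn (take i.+1 c) ->
    fconnect mk_right (inr (start i)) (inr k').
  elim: p k' => [|p IH] k' e lt.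
    rewrite (_ : k' = start i) ?connect0 //; apply: val_inj.
    by rewrite [LHS]e addn0 -stE.
  have k'n := ltn_ord k'.
  have kn : st + p < n by lia.
  have oS : ordS (Ordinal kn) = k' by apply: val_inj => /=; rewrite modn_small; lia.
  apply: (@connect_trans _ _ (inr (Ordinal kn))).
    apply: IH => //; change (st + p < sumn (take i.+1 c)); lia.
  apply: connect1; apply/eqP; rewrite /mk_right oS ifT //.
  apply/andP; split; first by change ((st + p).+1 < n); rewrite -addnS -e.
  have -> : parent (Ordinal kn) = i.
    apply: parent_uniq; change (sumn (take i c) <= st + p < sumn (take i.+1 c)).
    by rewrite stv leq_addr -stv; apply: leq_trans lt; rewrite e addnS.
  apply/eqP/parent_uniq; rewrite lt andbT e stv; exact: leq_addr.
by apply: (H (k - st)) => //; rewrite subnKC // stv.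
Qed.

(** All bottom triangles are reachable from each other; a top triangle leads to the bottom triangle
    of its parent and is reached from the one before it. *)
Lemma mk_cycle t t' : fconnect mk_right t t'.
Proof.
apply: (@connect_trans _ _ (inl (if t is inr k then parent k else
    if t is inl i then i else parent (Ordinal n0)))).
  by case: t => [i|k]; [exact: connect0|exact: connect_inr_inl].
case: t' => [i|k]; first exact: connect_inl.
exact: connect_trans (connect_inl _ _) (connect_inl_inr k).
Qed.

Definition mk_strip : strip m n := Strip mk_cycle mk_incidence.

Lemma children_mk_strip i : children mk_strip i = nth 0 c i.
Proof.
rewrite /children -[RHS](addKn (sumn (take i c))) -sumn_take_S.
set a := sumn (take i c); set b := sumn (take i.+1 c).
rewrite -(size_iota a (b - a)).
have -> : #|[pred k | bot mk_strip (inr k) == i]| =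
    size (map (@nat_of_ord n) (enum [pred k | bot mk_strip (inr k) == i])).
  by rewrite size_map -cardE.
apply/eqP; rewrite -uniq_size_uniq ?iota_uniq //.
  by rewrite map_inj_uniq ?enum_uniq //; exact: val_inj.
move=> p; rewrite mem_iota; apply/idP/mapP => [|[k]].
  move=> h; have pn : p < n by apply: leq_trans (sumn_take_le i.+1); rewrite -/b; lia.
  exists (Ordinal pn) => //; rewrite mem_enum inE; apply/eqP/parent_uniq => /=.
  by rewrite -/a -/b; lia.
rewrite mem_enum inE /= => /eqP e ->; have := parentP k; rewrite e -/a -/b.
by case/andP=> ka kb; rewrite ka subnKC // (leq_trans ka) // ltnW.
Qed.

Lemma offspring_mk_strip (x : 'I_m) : x = 0 :> nat -> offspring mk_strip x = c.
Proof.
move=> x0; apply: (@eq_from_nth _ 0); rewrite size_offspring ?cm // => p pm.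
rewrite nth_offspring // children_mk_strip val_iter_ordS x0 add0n.
by rewrite modn_small.
Qed.

Lemma next_base_mk_strip (x : 'I_m) : x = 0 :> nat -> next_base mk_strip x = 0 :> nat.
Proof.
move=> x0; change (start (ordS (ord_pred x)) = 0 :> nat).
by rewrite ord_predK /= x0 take0 mod0n.
Qed.

End MakeStrip.

(** * Triangulations coded by chains of offspring sequences *)

Definition code N (T : labelled (Some N)) : seq (seq nat) := mkseq (code_at T) N.

Fixpoint chain m (cs : seq (seq nat)) : bool :=
  if cs is c :: cs' then (size c == m) && chain (sumn c) cs' else true.

Definition final m (cs : seq (seq nat)) : nat := foldl (fun _ c => sumn c) m cs.

Lemma final_cat m cs1 cs2 : final m (cs1 ++ cs2) = final (final m cs1) cs2.
Proof. exact: foldl_cat. Qed.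

Lemma chain_cat m cs1 cs2 :
  chain m (cs1 ++ cs2) = chain m cs1 && chain (final m cs1) cs2.
Proof. by elim: cs1 m => //= c cs1 IH m; rewrite IH andbA. Qed.

Lemma chain_final0 cs : chain 0 cs -> final 0 cs = 0.
Proof. by elim: cs => //= c cs IH /andP[/eqP/size0nil->]; exact: IH. Qed.

Lemma chain_final_gt0 m cs : chain m cs -> 0 < final m cs -> 0 < m.
Proof. by case: m => // /chain_final0 ->. Qed.

Lemma codeE h (T : labelled h) N : (forall j, j < N -> has_strip h j) ->
  chain 1 (mkseq (code_at T) N) /\ final 1 (mkseq (code_at T) N) = len T N.
Proof.
elim: N => [|N IH] H; first by rewrite /= len0.
have [|c1 c2] := IH; first by move=> j jN; apply: H; exact: ltnW.
by rewrite mkseqS -cats1 chain_cat final_cat c1 c2 /= size_code_at ?sumn_code_at ?eqxx ?H.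
Qed.

(** Genealogical trees cut at generation N that are not extinct there. A chain that reaches 0 stays
    at 0, so the earlier generations are nonempty as well. *)
Definition codes N : set (seq (seq nat)) :=
  [set cs | [/\ size cs = N, chain 1 cs & 0 < final 1 cs]].

Lemma code_codes N (T : labelled (Some N)) : codes N (code T).
Proof.
have [c1 c2] := @codeE _ T N (fun j => id).
by split; rewrite ?size_mkseq // c2 len_gt0.
Qed.

Section Realize.
Variables (N : nat) (cs : seq (seq nat)).
Hypothesis csP : codes N cs.

Definition rlen j := final 1 (take j cs).

Lemma rlen_gt0 j : 0 < rlen j.
Proof.
have [_ ch fi] := csP; move: ch fi.
rewrite -{1 2}(cat_take_drop j cs) chain_cat final_cat => /andP[_ h].
exact: chain_final_gt0.
Qed.

Lemma rlen0 : rlen 0 = 1. Proof. by rewrite /rlen take0. Qed.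

Lemma rsize j : j < N -> size (nth [::] cs j) = rlen j.
Proof.
have [sz ch _] := csP; rewrite -sz => jN; move: ch.
by rewrite -{1}(cat_take_drop j cs) (drop_nth [::]) // chain_cat /= => /and3P[_ /eqP].
Qed.

Lemma rsumn j : j < N -> sumn (nth [::] cs j) = rlen j.+1.
Proof.
have [sz _ _] := csP; rewrite -sz => jN.
by rewrite /rlen (take_nth [::]) // -cats1 final_cat.
Qed.

Definition realize : labelled (Some N) :=
  @Labelled (Some N) rlen rlen0 rlen_gt0
    (fun j hj => mk_strip (rlen_gt0 j.+1) (rsize hj) (rsumn hj)).

Lemma base_realize j : j <= N -> base realize j = 0 :> nat.
Proof.
elim: j => [|j IH] jN //; rewrite (@baseS (Some N) _ j jN).
by apply: next_base_mk_strip; apply: IH; exact: ltnW.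
Qed.

Lemma code_realize : code realize = cs.
Proof.
have [sz _ _] := csP; apply: (@eq_from_nth _ [::]); rewrite size_mkseq ?sz // => j jN.
by rewrite nth_mkseq // (@code_atE (Some N) _ j jN) offspring_mk_strip // base_realize // ltnW.
Qed.

End Realize.

Definition LTcode N (T : LT (Some N)) : seq (seq nat) := code (repr T).

Lemma iso_pi h (T : labelled h) : iso (repr (\pi_(LT h) T)%qT) T.
Proof. by apply/asboolP; have /eqmodP := reprK (\pi_(LT h) T)%qT. Qed.

Lemma LTcode_pi N (T : labelled (Some N)) : LTcode (\pi_(LT (Some N)) T)%qT = code T.
Proof.
apply/eq_in_map => j; rewrite mem_iota /= add0n => jN.
exact: iso_code (iso_pi T) _ jN.
Qed.

Lemma LTcode_bij N : set_bij [set: LT (Some N)] (codes N) (@LTcode N).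
Proof.
split=> [T _|T T' _ _ e|cs h]; first exact: code_codes.
  rewrite -(reprK T) -(reprK T'); apply/eqmodP/asboolP/code_iso => j jN.
  by have := congr1 (nth [::] ^~ j) e; rewrite !nth_mkseq.
by exists (\pi_(LT (Some N)) (realize h))%qT; rewrite // LTcode_pi code_realize.
Qed.

Lemma base_restrict h M (hM : forall j, has_strip (Some M) j -> has_strip h j)
  (T : labelled h) j : j <= M -> base (restrict_labelled hM T) j = base T j.
Proof.
elim: j => [|j IH] jM; first exact: val_inj.
by rewrite (@baseS (Some M) _ j jM) (baseS T (hM j jM)) IH // ltnW.
Qed.

Lemma code_restrict h M (hM : forall j, has_strip (Some M) j -> has_strip h j)
  (T : labelled h) : code (restrict_labelled hM T) = mkseq (code_at T) M.
Proof.
apply/eq_in_map => j; rewrite mem_iota /= add0n => jM.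
by rewrite (@code_atE (Some M) _ j jM) (code_atE T (hM j jM)) base_restrict // ltnW.
Qed.

Lemma LTcode_restrict_infinite M (T : LT None) :
  LTcode (restrict_infinite M T) = mkseq (code_at (repr T)) M.
Proof. by rewrite /restrict_infinite LTcode_pi code_restrict. Qed.

Lemma LTcode_restrict_finite M k (T : LT (Some (M + k))) :
  LTcode (restrict_finite T) = take M (LTcode T).
Proof.
rewrite /restrict_finite LTcode_pi code_restrict /LTcode /code /mkseq -map_take.
by rewrite take_iota (minn_idPl _) ?leq_addr.
Qed.

Lemma triangles_code N (T : LT (Some N)) :
  triangles T = \sum_(c <- LTcode T) (size c + sumn c).
Proof.
rewrite /LTcode /code /mkseq big_map -[in iota 0 N](subn0 N) -/(index_iota 0 N) big_mkord.
apply: eq_bigr => j _; rewrite card_sum !card_ord.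
by rewrite size_code_at ?sumn_code_at //; exact: ltn_ord.
Qed.

(** * Generating functions of the critical Galton--Watson process *)

Local Open Scope classical_set_scope.
Local Open Scope ring_scope.
Local Open Scope ereal_scope.

(** One inequality for every constant suffices: the converse is the same inequality for the inverse
    of c. *)
Lemma esumZl (R : realType) (T : choiceType) (I : set T) (c : R) (a : T -> \bar R) :
    (0 <= c)%R -> (forall i, 0 <= a i) ->
  \esum_(i in I) (c%:E * a i) = c%:E * \esum_(i in I) a i.
Proof.
have le (c' : R) (b : T -> \bar R) : (0 <= c')%R -> (forall i, 0 <= b i) ->
    \esum_(i in I) (c'%:E * b i) <= c'%:E * \esum_(i in I) b i.
  move=> c0 b0; rewrite ge_ereal_sup => //= _ [X [finX XI]] <-.
  rewrite -ge0_mule_fsumr //.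
  apply: lee_wpmul2l; first by rewrite lee_fin.
  by apply: ereal_sup_ubound; exists X.
move=> c0 a0; apply/eqP; rewrite eq_le le //=.
have [->|cn0] := eqVneq c 0%R.
  by rewrite mul0e esum_ge0 // => i Ii; rewrite mul0e.
have cp : (0 < c)%R by rewrite lt_neqAle eq_sym cn0.
have := @le (c^-1)%R (fun i => c%:E * a i).
rewrite invr_ge0 => /(_ c0) H.
have {H} := H (fun i => mule_ge0 (c0 : 0 <= c%:E) (a0 i)).
under eq_esum do rewrite muleA -EFinM mulVf // mul1e.
by move=> H; rewrite -lee_pdivlMl.
Qed.

Section Geometric.
Variable R : realType.
Implicit Types x : R.

Lemma esum_geometric x : (0 <= x <= 1)%R ->
  \esum_(k in [set: nat]) ((1/2) ^+ k.+1 * x ^+ k)%:E = ((2 - x)^-1)%:E :> \bar R.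
Proof.
move=> /andP[x0 x1].
rewrite -nneseries_esumT; last by move=> k; rewrite lee_fin mulr_ge0 ?exprn_ge0 //; lra.
apply: cvg_lim => //.
have -> : (fun n => \sum_(0 <= k < n) ((1/2) ^+ k.+1 * x ^+ k)%:E) =
    EFin \o series (geometric (1/2) (x/2) : nat -> R).
  apply/funext => n /=; rewrite sumEFin; congr EFin; apply: eq_bigr => k _.
  by rewrite /= exprS !exprMn expr1n; ring.
apply: cvg_EFin; first exact: nearW.
have -> : ((2 - x)^-1 = (1/2) * (1 - x/2)^-1)%R by field; lra.
by apply: cvg_geometric_series; rewrite ger0_norm; lra.
Qed.

End Geometric.

Local Close Scope ereal_scope.
Local Close Scope ring_scope.
Local Close Scope classical_set_scope.
Local Open Scope classical_set_scope.
Local Open Scope ring_scope.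

Definition chains N m : set (seq (seq nat)) := [set cs | size cs = N /\ chain m cs].

Section Forests.
Variable R : realType.

(** A vertex with k children contributes (1/2)^(k+1), so this is the probability that the
    Galton--Watson process with geometric offspring follows [cs]. *)
Definition code_weight (cs : seq (seq nat)) : R := (1/2) ^+ (\sum_(c <- cs) (size c + sumn c))%N.

Lemma code_weight_ge0 cs : 0 <= code_weight cs.
Proof. by rewrite exprn_ge0 //; lra. Qed.

Lemma code_weight_cat cs1 cs2 : code_weight (cs1 ++ cs2) = code_weight cs1 * code_weight cs2.
Proof. by rewrite /code_weight big_cat exprD. Qed.

Lemma code_weight_cons c cs : code_weight (c :: cs) = code_weight [:: c] * code_weight cs.
Proof. exact: (code_weight_cat [:: c]). Qed.

Local Open Scope ereal_scope.

(** Markov property: after [cs1], the later generations see only the population size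
    [final m cs1]. *)
Lemma esum_chains_cat N1 N2 m (f : seq (seq nat) -> \bar R) : (forall cs, 0 <= f cs) ->
  \esum_(cs in chains (N1 + N2) m) f cs =
  \esum_(cs1 in chains N1 m) \esum_(cs2 in chains N2 (final m cs1)) f (cs1 ++ cs2).
Proof.
move=> f0; rewrite esum_esum //.
rewrite (@reindex_esum _ _ _ (chains N1 m `*`` (fun cs1 => chains N2 (final m cs1))) _
  (fun k => k.1 ++ k.2)) //; split.
- move=> [cs1 cs2] [[/= <- c1] [<- c2]]; split; first by rewrite size_cat.
  by rewrite chain_cat c1.
- move=> [cs1 cs2] [cs1' cs2'] /= /set_mem[[/= s1 _] _] /set_mem[[/= s2 _] _] /eqP.
  by rewrite eqseq_cat ?s1 // => /andP[/eqP-> /eqP->].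
- move=> cs [sz]; rewrite -{1}(cat_take_drop N1 cs) chain_cat => /andP[c1 c2].
  exists (take N1 cs, drop N1 cs); last by rewrite /= cat_take_drop.
  split; split=> //=; first by rewrite size_takel // sz leq_addr.
  by rewrite size_drop sz addKn.
Qed.

Lemma esum_chains_cons N m (f : seq (seq nat) -> \bar R) : (forall cs, 0 <= f cs) ->
  \esum_(cs in chains N.+1 m) f cs =
  \esum_(c in [set c | size c = m]) \esum_(cs in chains N (sumn c)) f (c :: cs).
Proof.
move=> f0; rewrite -[N.+1]/(1 + N)%N esum_chains_cat //.
rewrite [LHS](@reindex_esum _ _ _ [set c | size c = m] _ (fun c => [:: c])) //; split.
- by move=> c /= <-; split; rewrite //= eqxx.
- by move=> c c' _ _ [].
- move=> [|c [|? ?]] [//= _ /andP[/eqP cm _]]; by exists c.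
Qed.

Lemma esum_offspring (xs : seq R) : all (fun x => 0 <= x <= 1)%R xs ->
  \esum_(c in [set c | size c = size xs])
    (code_weight [:: c] * \prod_(p <- zip xs c) p.1 ^+ p.2)%:E = (\prod_(x <- xs) (2 - x)^-1)%:E.
Proof.
elim: xs => [_|x xs IH /andP[x01 xs01]].
  rewrite (_ : [set c | _] = [set [::]]); last first.
    by apply/seteqP; split=> c /= => [/size0nil|->].
  by rewrite esum_set1 /code_weight ?big_seq1 ?big_nil ?mulr1 // lee_fin ler01.
have /andP[x0 _] := x01.
pose g (c : seq nat) : R := (code_weight [:: c] * \prod_(p <- zip xs c) p.1 ^+ p.2)%R.
have g0 c : (0 <= g c)%R.
  rewrite mulr_ge0 ?code_weight_ge0 //.
  elim: (xs) c xs01 => [|y ys IHy] [|k c] /=; rewrite ?big_nil ?ler01 // big_cons.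
  by case/andP=> /andP[y0 _] /IHy ?; rewrite mulr_ge0 ?exprn_ge0.
pose h (k : nat) : R := ((1/2) ^+ k.+1 * x ^+ k)%R.
have h0 k : (0 <= h k)%R by rewrite mulr_ge0 // exprn_ge0 //; lra.
transitivity (\esum_(k in [set: nat]) \esum_(c in [set c | size c = size xs])
    ((h k)%:E * (g c)%:E)).
  rewrite esum_esum; last by move=> k c _ _; rewrite -EFinM lee_fin mulr_ge0.
  rewrite (@reindex_esum _ _ _ ([set: nat] `*`` (fun _ => [set c | size c = size xs])) _
    (fun k => k.1 :: k.2)) //; last first.
    split.
    - by move=> [k c] [_ /= ->].
    - by move=> [k c] [k' c'] _ _ /= [-> ->].
    - by move=> [|k c] //= [sc]; exists (k, c).
  apply: eq_esum => -[k c] /= _; rewrite -EFinM; congr EFin.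
  rewrite big_cons /= /g /h /code_weight !big_seq1 /=.
  by rewrite addSn addnCA !(exprS, exprD) /=; ring.
under eq_esum do rewrite esumZl //.
rewrite IH // big_cons mulrC EFinM -esum_geometric // -esumZl; last 2 first.
- rewrite big_seq prodr_ge0 // => y /(allP xs01)/andP[_ y1]; rewrite invr_ge0; lra.
- by move=> k; rewrite lee_fin h0.
by apply: eq_esum => k _; rewrite muleC.
Qed.

Lemma prod_flatten_nseq (T : Type) (val : T -> R) (b : seq T) (c : seq nat) :
  (\prod_(v <- flatten [seq nseq p.2 p.1 | p <- zip b c]) val v =
   \prod_(p <- zip (map val b) c) p.1 ^+ p.2)%R.
Proof.
elim: b c => [|v b IH] [|k c]; rewrite /= ?big_nil // big_cat big_cons IH /=.
by rewrite big_nseq iter_mulr_1.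
Qed.

End Forests.

Section Descendants.
Variable T : Type.
Implicit Types b : seq T.

(** Vertices pass their labels on to their children, so [desc b cs] lists the last generation by the
    labels of its ancestors in b. *)
Definition step b (c : seq nat) : seq T := flatten [seq nseq p.2 p.1 | p <- zip b c].
Definition desc b (cs : seq (seq nat)) : seq T := foldl step b cs.

Lemma size_step b c : size c = size b -> size (step b c) = sumn c.
Proof.
move=> cb; rewrite /step size_flatten /shape -map_comp; congr sumn.
elim: b c cb => [|v b IH] [|k c] //= [cb].
by rewrite size_nseq IH.
Qed.

Lemma size_desc b cs : chain (size b) cs -> size (desc b cs) = final (size b) cs.
Proof.
elim: cs b => [//|c cs IH] b /= /andP[/eqP cb ch].
by rewrite IH size_step.
Qed.

End Descendants.

Section GenFun.
Variable R : realType.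

Fixpoint phi (N : nat) (x : R) : R := if N is N'.+1 then (2 - phi N' x)^-1 else x.

Lemma phi01 N x : 0 <= x <= 1 -> 0 <= phi N x <= 1.
Proof.
move=> x01; elim: N => [//|N /= /andP[p0 p1]].
by rewrite invr_ge0 invf_le1; lra.
Qed.

Local Open Scope ereal_scope.

(* The offspring law is geometric, so a vertex whose descendants at height N
   are weighted by [val] contributes the N-th iterate of x |-> 1 / (2 - x). *)
Lemma esum_desc (T : Type) (val : T -> R) N (b : seq T) :
    (forall v, 0 <= val v <= 1)%R ->
  \esum_(cs in chains N (size b)) (code_weight R cs * \prod_(v <- desc b cs) val v)%:E =
  (\prod_(v <- b) phi N (val v))%:E.
Proof.
move=> val01.
have nn (cs : seq (seq nat)) b' : (0 <= code_weight R cs * \prod_(v <- desc b' cs) val v)%R.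
  by rewrite mulr_ge0 ?code_weight_ge0 // prodr_ge0 // => v _; case/andP: (val01 v).
elim: N b => [|N IH] b.
  rewrite (_ : chains 0 _ = [set [::]]); last first.
    by apply/seteqP; split=> c /= => [[/size0nil]|->].
  rewrite esum_set1; last by rewrite lee_fin.
  by rewrite /code_weight big_nil expr0 mul1r.
rewrite esum_chains_cons; last by move=> cs; rewrite lee_fin.
transitivity (\esum_(c in [set c | size c = size b])
   (code_weight R [:: c] * \prod_(p <- zip (map (phi N \o val) b) c) p.1 ^+ p.2)%:E).
  apply: eq_esum => c /= cb.
  under eq_esum do rewrite code_weight_cons -mulrA EFinM.
  rewrite esumZl ?code_weight_ge0 //; last by move=> cs; rewrite lee_fin.
  rewrite EFinM; congr (_ * _).
  have := IH (step b c); rewrite size_step // => ->.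
  by rewrite prod_flatten_nseq.
rewrite -(size_map (phi N \o val)) esum_offspring ?big_map //.
rewrite all_map (@eq_all _ _ predT) ?all_predT // => v /=.
exact/phi01/val01.
Qed.

End GenFun.

Section PhiTheory.
Variable R : realType.
Implicit Types x : R.

(** In the coordinate 1 / (1 - x) the map x |-> 1 / (2 - x) is the translation by 1. *)
Lemma phiE N x : x <= 1 -> phi N x = 1 - (1 - x) / (1 + N%:R * (1 - x)).
Proof.
move=> x1; elim: N => [|N IH]; first by rewrite /= mul0r addr0 divr1; ring.
have N0 : 0 <= N%:R :> R by [].
rewrite /= IH -(natr1 N); field.
by apply/andP; split; rewrite gt_eqF //; nra.
Qed.

Lemma phi1 N : phi N (1 : R) = 1.
Proof. by rewrite phiE // subrr mul0r subr0. Qed.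

Lemma phi_add M N x : phi (M + N) x = phi M (phi N x).
Proof. by elim: M => //= M ->. Qed.

(** The probability that a single vertex has no descendants N generations later. *)
Definition death N : R := phi N 0.

Lemma deathE N : death N = 1 - (N.+1%:R)^-1.
Proof. by rewrite /death phiE ?ler01 // subr0 mulr1 div1r nat1r. Qed.

Lemma death01 N : 0 <= death N <= 1.
Proof. by apply: phi01; rewrite lexx ler01. Qed.

(** [phi a] is convex with derivative (1 + a (1 - x))^-2; the bound is the mean value estimate with
    the derivative at the larger point. *)
Lemma phi_diff a x y : 0 <= y -> y <= x -> x <= 1 ->
  phi a x - phi a y <= (x - y) / (1 + a%:R * (1 - x)) ^+ 2.
Proof.
move=> y0 yx x1; rewrite !phiE //; last exact: le_trans x1.
have a0 : 0 <= a%:R :> R by [].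
have hx : 0 < 1 + a%:R * (1 - x) by nra.
have hy : 0 < 1 + a%:R * (1 - y) by nra.
have hxy : 1 + a%:R * (1 - x) <= 1 + a%:R * (1 - y) by nra.
have -> : 1 - (1 - x) / (1 + a%:R * (1 - x)) - (1 - (1 - y) / (1 + a%:R * (1 - y)))
    = (x - y) / ((1 + a%:R * (1 - x)) * (1 + a%:R * (1 - y))).
  by field; rewrite !gt_eqF.
apply: ler_wpM2l; first by rewrite subr_ge0.
by rewrite expr2 lef_pV2 ?posrE ?mulr_gt0 // ler_pM2l.
Qed.

End PhiTheory.

Section AliveDead.
Variable R : realType.

Lemma fin_esum_indic (T : choiceType) (A : set T) (w : T -> R) (p : T -> bool) :
  (forall t, 0 <= w t) ->
  (\esum_(t in A `&` [set t | p t]) (w t)%:E = \esum_(t in A) (w t * (p t)%:R)%:E)%E.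
Proof.
move=> w0; rewrite esum_mkcondr; apply: eq_esum => t _.
case: (boolP (p t)) => pt; first by rewrite mem_set // mulr1.
by rewrite memNset ?mulr0 //=; exact/negP.
Qed.

Lemma esum_chains_pow N m (x : R) : 0 <= x <= 1 ->
  (\esum_(cs in chains N m) (code_weight R cs * x ^+ final m cs)%:E = (phi N x ^+ m)%:E)%E.
Proof.
move=> x01; have := @esum_desc R unit (fun=> x) N (nseq m tt) (fun=> x01).
rewrite size_nseq big_nseq iter_mulr_1 => <-; apply: eq_esum => cs [_ ch].
by rewrite big_const_seq count_predT size_desc ?size_nseq // iter_mulr_1.
Qed.

Lemma esum_alive N m :
  (\esum_(cs in chains N m) (code_weight R cs * (0 < final m cs)%N%:R)%:E =
   (1 - death R N ^+ m)%:E)%E.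
Proof.
have e1 := @esum_chains_pow N m 1; have e0 := @esum_chains_pow N m 0.
rewrite phi1 expr1n ler01 lexx in e1; rewrite ler01 lexx in e0.
have E : (\esum_(cs in chains N m) (code_weight R cs * (0 < final m cs)%N%:R)%:E +
     (death R N ^+ m)%:E = 1)%E.
  rewrite -e0 // -e1 // -esumD; last 2 first.
  - by move=> cs _; rewrite lee_fin mulr_ge0 ?code_weight_ge0.
  - by move=> cs _; rewrite lee_fin mulr_ge0 ?code_weight_ge0 // exprn_ge0.
  apply: eq_esum => cs _; rewrite -EFinD expr1n expr0n -mulrDr.
  by case: (final m cs) => [|?] /=; rewrite ?addr0 ?add0r.
by rewrite EFinB -E addeK.
Qed.

End AliveDead.

(** * Extinction of a residue class of vertices *)

Definition residue_class (g r n : nat) : seq bool := [seq (p %% g.+1 == r)%N | p <- iota 0 n].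

(* The vertices of circle a whose position is r modulo g + 1 have no descendant
   on circle a + G. *)
Definition extinct_class a G g r (cs : seq (seq nat)) : bool :=
  ~~ has id (desc (residue_class g r (final 1 (take a cs))) (take G (drop a cs))).

Lemma count_residue_class g r n : (r <= g)%N -> (n <= count id (residue_class g r n) * g.+1 + g)%N.
Proof.
move=> rg; rewrite /residue_class count_map -size_filter.
set s := seq.filter _ _.
have : (n %/ g.+1 <= size s)%N.
  rewrite -(size_iota 0 (n %/ g.+1)) -(size_map (fun i => i * g.+1 + r)%N).
  apply: uniq_leq_size.
    rewrite map_inj_uniq ?iota_uniq // => i j /eqP.
    by rewrite eqn_add2r eqn_pmul2r // => /eqP.
  move=> p /mapP[i]; rewrite mem_iota add0n /= => ilt ->.
  rewrite mem_filter /= modnMDl modn_small // eqxx mem_iota add0n /=.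
  have : (i.+1 * g.+1 <= n)%N by rewrite (leq_trans _ (leq_trunc_div n g.+1)) // leq_mul2r ilt orbT.
  by rewrite mulSn; apply: leq_trans; rewrite addSn ltnS addnC leq_add2r.
move=> h; rewrite {1}(divn_eq n g.+1) leq_add ?leq_mul2r ?h ?orbT //.
by rewrite -ltnS ltn_mod.
Qed.

Section BadBound.
Variable R : realType.
Variables (G k : nat).
Local Notation d := (death R).

(** The marked vertices of b die out within G generations while the whole population survives k
    generations more. The second condition is there because a code of a finite cylinder must reach
    its top. *)
Let half_alive_sum (b : seq bool) : \bar R :=
  (\esum_(cs in chains (G + k) (size b))
     (code_weight R cs * ((~~ has id (desc b (take G cs))) && (0 < final (size b) cs)%N)%:R)%:E)%E.

Lemma prod_val (x : R) (b : seq bool) : 0 <= x <= 1 ->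
  \prod_(v <- b) (if v then 0 else x) = (~~ has id b)%:R * x ^+ size b.
Proof.
elim: b => [|[] b IH] x01; rewrite ?big_nil ?mulr1 // big_cons /= ?mul0r //.
by rewrite IH // exprS mulrCA.
Qed.

(** Two events with product weights are subtracted: marked vertices extinct at G, and in addition
    everything extinct at G + k. They correspond to x = 1 and x = [d k] in [sub]. *)
Lemma half_alive_sumE b : half_alive_sum b =
  (\prod_(v <- b) (if v then d G else 1) - \prod_(v <- b) (if v then d G else d (G + k)))%:E.
Proof.
have sub x : 0 <= x <= 1 -> (\esum_(cs in chains G (size b))
    (code_weight R cs * ((~~ has id (desc b cs))%:R * x ^+ final (size b) cs))%:E =
    (\prod_(v <- b) (if v then d G else phi G x))%:E)%E.
  move=> x01; pose val (v : bool) := if v then 0 else x.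
  have val01 v : 0 <= val v <= 1 by case: v => //; rewrite /val lexx ler01.
  transitivity (\prod_(v <- b) phi G (val v))%:E; last first.
    by congr EFin; apply: eq_bigr => -[].
  rewrite -esum_desc //; apply: eq_esum => cs [_ ch].
  by rewrite prod_val // size_desc.
have nn (cs : seq (seq nat)) (x : bool) y : 0 <= y -> 0 <= code_weight R cs * (x%:R * y).
  by move=> y0; rewrite !mulr_ge0 ?code_weight_ge0.
have VE : half_alive_sum b = (\esum_(cs in chains G (size b))
    (code_weight R cs * ((~~ has id (desc b cs))%:R * (1 - d k ^+ final (size b) cs)))%:E)%E.
  rewrite /half_alive_sum esum_chains_cat; last first.
    by move=> cs; rewrite lee_fin mulr_ge0 ?code_weight_ge0.
  apply: eq_esum => cs1 [s1 c1]; rewrite mulrA EFinM -esum_alive -esumZl; last 2 first.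
  - by rewrite mulr_ge0 ?code_weight_ge0.
  - by move=> cs; rewrite lee_fin mulr_ge0 ?code_weight_ge0.
  apply: eq_esum => cs2 [s2 c2].
  rewrite -EFinM code_weight_cat take_size_cat // final_cat -mulnb natrM.
  by congr EFin; ring.
have E : (half_alive_sum b + (\prod_(v <- b) (if v then d G else d (G + k)))%:E =
    (\prod_(v <- b) (if v then d G else 1))%:E)%E.
  have := sub 1; rewrite ler01 lexx phi1 => <- //.
  rewrite /d phi_add -sub; last exact: death01.
  rewrite VE -esumD; last 2 first.
  - move=> cs _; rewrite lee_fin nn // subr_ge0 exprn_ile1 //; by case/andP: (death01 R k).
  - move=> cs _; rewrite lee_fin nn // exprn_ge0 //; by case/andP: (death01 R k).
  by apply: eq_esum => cs _; rewrite -EFinD expr1n; congr EFin; rewrite /d; ring.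
by rewrite EFinB -E addeK.
Qed.

Lemma prod_if (x y : R) (b : seq bool) :
  \prod_(v <- b) (if v then x else y) = x ^+ count id b * y ^+ (size b - count id b).
Proof.
rewrite -(count_predC id b) addKn.
elim: b => [|[] b IH]; rewrite ?big_nil ?mulr1 // big_cons IH /= exprS; ring.
Qed.

Variable g : nat.
Hypothesis G0 : (0 < G)%N.
(** By Bernoulli, (1 - rho)^(g+1) >= d G. Trading a factor d G per class member for 1 - rho per
    vertex yields powers of the whole population size, which [phi a] can sum. *)
Let rho : R := (g.+1%:R * G.+1%:R)^-1.

Let rho_gt0 : 0 < rho. Proof. by rewrite invr_gt0 mulr_gt0. Qed.

Let bernoulli n (x : R) : 0 <= x <= 1 -> 1 - n%:R * x <= (1 - x) ^+ n.
Proof.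
move=> /andP[x0 x1]; elim: n => [|n IH]; first by rewrite mul0r subr0.
have n0 : 0 <= n%:R :> R by [].
rewrite exprS -natr1; apply: le_trans (ler_wpM2l _ IH); last lra.
by nra.
Qed.

Let rho_le : rho * g.+1%:R = 1 - d G.
Proof. by rewrite deathE subKr /rho invfM mulrAC mulVf ?mul1r ?pnatr_eq0. Qed.

Let rho_half : rho * g%:R <= 1 / 2.
Proof.
apply: (@le_trans _ _ (rho * g.+1%:R)); first by rewrite ler_pM2l // ler_nat.
rewrite rho_le deathE subKr div1r lef_pV2 ?posrE // ler_nat.
by rewrite ltnS.
Qed.

Let rho_le1 : rho <= 1.
Proof. by rewrite invf_le1 ?mulr_gt0 // -natrM ler1n muln_gt0. Qed.

(* A residue class has at least (n - g) / (g + 1) members; by Bernoulli its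
   extinction within G generations costs at most 2 (1 - rho)^n. *)
Lemma half_alive_sum_le r n : (r <= g)%N ->
  (half_alive_sum (residue_class g r n) <=
   (2 * ((1 - rho) ^+ n - ((1 - rho) * d (G + k)) ^+ n))%:E)%E.
Proof.
move=> rg; rewrite half_alive_sumE lee_fin !prod_if expr1n mulr1.
set t := count _ _; rewrite /residue_class size_map size_iota.
have /andP[d0 d1] := death01 R (G + k); have /andP[dG0 dG1] := death01 R G.
have tn : (t <= n)%N.
  by rewrite -[n](size_iota 0) -(size_map (fun p => p %% g.+1 == r)%N) count_size.
have e1 : d G ^+ t <= (1 - rho) ^+ (t * g.+1).
  rewrite mulnC exprM; apply: lerXn2r; rewrite ?nnegrE ?exprn_ge0 ?subr_ge0 //.
  have -> : d G = 1 - g.+1%:R * rho by rewrite mulrC rho_le subKr.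
  by apply: bernoulli; rewrite ltW.
have e2 : 1 / 2 <= (1 - rho) ^+ g.
  apply: le_trans (bernoulli _ _); last by rewrite ltW.
  by have := rho_half; lra.
have e3 : (1 - rho) ^+ (t * g.+1 + g) <= (1 - rho) ^+ n.
  apply: ler_wiXn2l; rewrite ?subr_ge0 //; first by have := rho_gt0; lra.
  exact: count_residue_class.
have e4 : d G ^+ t <= 2 * (1 - rho) ^+ n.
  have := exprn_ge0 (t * g.+1) (_ : 0 <= 1 - rho); rewrite subr_ge0 => /(_ rho_le1).
  by move: e3; rewrite exprD; nra.
have e5 : d (G + k) ^+ n <= d (G + k) ^+ (n - t) by apply: ler_wiXn2l; rewrite // leq_subr.
have e6 : 0 <= d (G + k) ^+ n <= 1 by rewrite exprn_ge0 // exprn_ile1.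
have e7 := exprn_ge0 t dG0.
rewrite exprMn; move: e4 e5 e6 e7.
set A := d G ^+ t; set B := (1 - rho) ^+ n; set C := _ ^+ n; set D := _ ^+ (n - t).
move=> e4 e5 /andP[C0 C1] A0.
have : A * (1 - D) <= A * (1 - C) by apply: ler_wpM2l => //; lra.
have : A * (1 - C) <= 2 * B * (1 - C) by apply: ler_wpM2r => //; lra.
lra.
Qed.

(** Summing [half_alive_sum_le] over the size of circle a gives a difference of values of [phi a] at
    1 - rho and (1 - rho) d (G + k). These points are at most (G + k + 1)^-1 apart, and [phi_diff]
    supplies the rest. *)
Lemma extinct_class_sum_le a r : (0 < a)%N -> (r <= g)%N ->
  (\esum_(cs in codes (a + (G + k)) `&` [set cs | extinct_class a G g r cs]) (code_weight R cs)%:E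
   <= (2 * (((G + k).+1)%:R^-1 / (a%:R * rho) ^+ 2))%:E)%E.
Proof.
move=> a0 rg.
have d01 := death01 R (G + k); have /andP[d0 d1] := d01.
have x01 : 0 <= 1 - rho <= 1 by rewrite subr_ge0 rho_le1 lerBlDr lerDl ltW.
have /andP[x0 x1] := x01.
have y01 : 0 <= (1 - rho) * d (G + k) <= 1 by rewrite mulr_ge0 //= mulr_ile1.
set y := (1 - rho) * d (G + k) in y01 *.
have yx : y <= 1 - rho by rewrite ler_piMr.
set S := (\esum_(cs in _) _)%E.
suff H : (S + (2 * phi a y)%:E <= (2 * phi a (1 - rho))%:E)%E.
  have := phi_diff a (proj1 (andP y01)) yx x1; rewrite subKr => pd.
  rewrite -(leeD2rE (x := (2 * phi a y)%:E)) //; apply: (le_trans H).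
  rewrite -EFinD lee_fin -lerBlDr -mulrBr ler_pM2l //; apply: (le_trans pd).
  have ar : 0 < a%:R * rho by rewrite mulr_gt0 // ltr0n.
  apply: ler_pM.
  - by rewrite subr_ge0.
  - by rewrite invr_ge0 sqr_ge0.
  - rewrite /y -{1}[1 - rho]mulr1 -mulrBr deathE subKr ler_piMl // invr_ge0 //.
  - by rewrite lef_pV2 ?posrE ?exprn_gt0 ?addr_gt0 // lerXn2r ?nnegrE; lra.
have SE : (S = \esum_(cs1 in chains a 1%N) ((code_weight R cs1)%:E *
    half_alive_sum (residue_class g r (final 1%N cs1))))%E.
  transitivity (\esum_(cs in chains (a + (G + k)) 1%N)
      (code_weight R cs * (extinct_class a G g r cs && (0 < final 1%N cs)%N)%:R)%:E)%E.
    rewrite -fin_esum_indic; last exact: code_weight_ge0.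
    congr esum; apply/seteqP; split=> [cs [[s c f] e]|cs [[s c] /andP[e f]]].
      by split=> //=; rewrite [_ && _]andbC f.
    by [].
  rewrite esum_chains_cat; last by move=> cs; rewrite lee_fin mulr_ge0 ?code_weight_ge0.
  apply: eq_esum => cs1 [s1 c1]; rewrite /half_alive_sum -esumZl ?code_weight_ge0 //; last first.
    by move=> cs; rewrite lee_fin mulr_ge0 ?code_weight_ge0.
  rewrite /residue_class size_map size_iota; apply: eq_esum => cs2 [s2 c2].
  rewrite -EFinM code_weight_cat mulrA /extinct_class take_size_cat // drop_size_cat //.
  by rewrite final_cat.
have powE x : 0 <= x <= 1 -> ((2 * phi a x)%:E =
    \esum_(cs1 in chains a 1%N) ((code_weight R cs1)%:E * (2 * x ^+ final 1%N cs1)%:E))%E.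
  move=> hx; rewrite -[phi a x]expr1 EFinM -esum_chains_pow // -esumZl //; last first.
    by move=> cs; rewrite lee_fin mulr_ge0 ?code_weight_ge0 // exprn_ge0 //; case/andP: hx.
  by apply: eq_esum => cs _; rewrite -!EFinM mulrCA.
rewrite SE !powE // -esumD; last 2 first.
- move=> cs _; rewrite mule_ge0 ?lee_fin ?code_weight_ge0 //.
  by apply: esum_ge0 => ? _; rewrite lee_fin mulr_ge0 ?code_weight_ge0.
- by move=> cs _; rewrite -EFinM lee_fin !mulr_ge0 ?code_weight_ge0 // exprn_ge0 //; case/andP: y01.
apply: le_esum => cs _; rewrite -muleDr // ?lee_wpmul2l ?lee_fin ?code_weight_ge0 //.
  have := half_alive_sum_le (final 1%N cs) rg; rewrite -/y => h.
  apply: (le_trans (leeD2r _ h)); rewrite -EFinD lee_fin; lra.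
by rewrite fin_num_adde_defl.
Qed.

End BadBound.

(** * The infinite-volume limit *)

Section Limit.
Variable R : realType.

Lemma weight_code N (T : LT (Some N)) : weight (mu_cr R) T = code_weight R (LTcode T).
Proof.
rewrite /weight /mu_cr expRM_natr expRN lnK ?posrE // triangles_code.
by rewrite /code_weight div1r.
Qed.

Lemma esum_weight N (p : seq (seq nat) -> bool) :
  (\esum_(T in [set T : LT (Some N) | p (LTcode T)]) (weight (mu_cr R) T)%:E =
   \esum_(cs in codes N `&` [set cs | p cs]) (code_weight R cs)%:E)%E.
Proof.
rewrite (@reindex_esum _ _ _ [set T : LT (Some N) | p (LTcode T)] _ (@LTcode N)).
  by apply: eq_esum => T _; rewrite weight_code.
have [h1 h2 h3] := LTcode_bij N; split.
- by move=> T /= pT; split=> //; exact: h1.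
- by move=> T T' _ _; apply: h2; rewrite inE.
- by move=> cs [/h3[T _ <-] pT]; exists T.
Qed.

(** The weights sum to the probability that one vertex survives for N generations. *)
Lemma partition_function N :
  (\esum_(T in [set: LT (Some N)]) (weight (mu_cr R) T)%:E = ((N.+1%:R)^-1)%:E)%E.
Proof.
transitivity (\esum_(T in [set T : LT (Some N) | predT (LTcode T)])
    (weight (mu_cr R) T)%:E)%E.
  by congr esum; apply/seteqP.
rewrite esum_weight.
transitivity (\esum_(cs in chains N 1%N)
    (code_weight R cs * (0 < final 1%N cs)%N%:R)%:E)%E; last first.
  by rewrite esum_alive deathE expr1 subKr.
rewrite -fin_esum_indic; last exact: code_weight_ge0.
by congr esum; apply/seteqP; split=> [cs [[s c f] _]|cs [[s c] f]].
Qed.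

Lemma countable_LT M : countable [set: LT (Some M)].
Proof.
apply/countable_injP; exists (fun T => pickle (LTcode T)) => T T' _ _.
move=> /(pcan_inj pickleK) e; have [_ h _] := LTcode_bij M.
by apply: h; rewrite ?inE.
Qed.

Lemma measurable_restrict M (A : set (LT (Some M))) :
  measurable ([set T : LT_infinite | A (restrict_infinite M T)] : set LT_infinite).
Proof.
rewrite (_ : [set T | _] = \bigcup_(t : LT (Some M))
    (if t \in A then [set T : LT_infinite | restrict_infinite M T = t] else set0)).
  apply: countable_bigcupT_measurable; first exact: countable_LT.
  move=> t; case: ifP => _; last exact: measurable0.
  by apply: sub_gen_smallest; exists M, t.
apply/seteqP; split=> T /=.
  by move=> h; exists (restrict_infinite M T) => //; rewrite mem_set.
by move=> [t _]; case: ifPn => // /set_mem At /= ->.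
Qed.

Definition dies a G g r (T : LT None) : bool :=
  extinct_class a G g r (LTcode (restrict_infinite (a + G) T)).

Lemma measurable_dies a G g r : measurable ([set T | dies a G g r T] : set LT_infinite).
Proof. exact: (@measurable_restrict (a + G) [set t | extinct_class a G g r (LTcode t)]). Qed.

Lemma extinct_class_take a G g r cs :
  extinct_class a G g r (take (a + G) cs) = extinct_class a G g r cs.
Proof.
rewrite /extinct_class take_takel ?leq_addr //.
by rewrite addnC -take_drop take_takel.
Qed.

(** Dividing by the partition function (a + G + k + 1)^-1 cancels the factor (G + k + 1)^-1 of
    [extinct_class_sum_le] up to 1 + a / (G + k + 1), which tends to 1. *)
Lemma dies_bound (P : probability LT_infinite R) a G g r : is_critical_limit P ->
    (0 < a)%N -> (0 < G)%N -> (r <= g)%N ->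
  (P [set T | dies a G g r T] <=
   (2 * ((g.+1%:R * G.+1%:R) ^+ 2 / a%:R ^+ 2))%:E)%E.
Proof.
move=> hP a0 G0 rg.
have := hP (a + G)%N [set t | extinct_class a G g r (LTcode t)].
rewrite -/(dies a G g r) => cv.
set C := 2 * _.
rewrite -(fineK (fin_num_measure P _ (measurable_dies a G g r))) lee_fin.
pose u k : R := C * (1 + a%:R * (k.+1)%:R^-1).
have ucv : u k @[k --> \oo] --> C * (1 + a%:R * 0).
  apply: cvgM; first exact: cvg_cst.
  apply: cvgD; first exact: cvg_cst.
  by apply: cvgM; [exact: cvg_cst|exact: cvg_harmonic].
rewrite mulr0 addr0 mulr1 in ucv.
apply: (ler_cvg_to cv ucv); apply: nearW => k.
rewrite /finite_law partition_function /= invrK.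
have -> : @restrict_finite (a + G)%N k @^-1` [set t | extinct_class a G g r (LTcode t)] =
    [set T : LT (Some (a + G + k)%N) | extinct_class a G g r (LTcode T)].
  by apply/seteqP; split=> T /=; rewrite LTcode_restrict_finite extinct_class_take.
rewrite esum_weight -addnA.
have := @extinct_class_sum_le R G k g G0 a r a0 rg.
set S := (\esum_(_ in _) _)%E => Sle.
have S0 : (0 <= S)%E by apply: esum_ge0 => cs _; rewrite lee_fin code_weight_ge0.
have Sf : S \is a fin_num by rewrite ge0_fin_numE // (le_lt_trans Sle) // ltry.
rewrite -(fineK Sf) lee_fin in Sle.
apply: (le_trans (ler_wpM2r _ Sle)) => //.
set c := (g.+1%:R * G.+1%:R : R) in C u ucv *.
have c0 : 0 < c by rewrite mulr_gt0.
have a0' : 0 < a%:R :> R by rewrite ltr0n.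
set s := (G + k).+1%:R : R.
have s0 : 0 < s by rewrite ltr0n.
have -> : (a + (G + k)).+1%:R = a%:R + s :> R by rewrite -natrD addnS.
have -> : 2 * (s^-1 / (a%:R * c^-1) ^+ 2) * (a%:R + s) = C * (1 + a%:R * s^-1).
  by rewrite /C; field; rewrite !gt_eqF.
apply: ler_wpM2l.
  by rewrite mulr_ge0 // divr_ge0 // exprn_ge0 // ltW.
by rewrite lerD2l ler_pM2l // lef_pV2 ?posrE // ler_nat ltnS leq_addl.
Qed.

End Limit.

(** * Almost surely, only finitely many bad heights *)

Section BorelCantelli.
Variable R : realType.

(* Logarithmic, so that the bad heights are summable while 4 ^- radius h, the
   Peierls weight of the contours through height h, is summable as well. *)
Definition radius h := trunc_log 2 h.

Definition bad_height (h : nat) (T : LT None) : bool :=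
  (0 < h)%N && has (fun r => dies (h - radius h) (2 * radius h).+1 (radius h) r T)
    (iota 0 (radius h).+1).

Lemma radius_half h : (0 < h)%N -> (2 * radius h <= h)%N.
Proof.
move=> h0; apply: leq_trans (trunc_logP (isT : 1 < 2)%N h0).
rewrite /radius; case: (trunc_log 2 h) => // n.
by rewrite expnS leq_mul2l /= ltn_expl.
Qed.

(** There are g + 1 classes, each costing 2 ((g + 1) (2 g + 2))^2 / (h - g)^2, and h - g >= h /
    2. *)
Definition bad_term (h : nat) : R := 32 * (radius h).+1%:R ^+ 5 / h%:R ^+ 2.

Lemma bad_heightE h : (0 < h)%N -> [set T : LT_infinite | bad_height h T] =
  \bigcup_(r < (radius h).+1)
    [set T : LT_infinite | dies (h - radius h) (2 * radius h).+1 (radius h) r T].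
Proof.
move=> h0; apply/seteqP; split=> T /=.
  move=> /andP[_ /hasP[r]]; rewrite mem_iota add0n => rg d.
  by exists r.
move=> [r rg d]; rewrite /bad_height h0; apply/hasP; exists r => //.
by rewrite mem_iota.
Qed.

Lemma bad_height_bound (P : probability LT_infinite R) h : is_critical_limit P -> (0 < h)%N ->
  (P [set T | bad_height h T] <= (bad_term h)%:E)%E.
Proof.
move=> hP h0; set g := radius h.
have gh := radius_half h0; rewrite -/g in gh.
have a0 : (0 < h - g)%N by lia.
set t : R := 2 * ((g.+1%:R * (2 * g).+2%:R) ^+ 2 / (h - g)%:R ^+ 2).
pose F r : set LT_infinite := [set T | dies (h - g) (2 * g).+1 g r T].
have -> : [set T | bad_height h T] = \big[setU/set0]_(r < g.+1) F r.
  by rewrite bad_heightE // (bigcup_mkord g.+1 F).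
apply: (@le_trans _ _ (\sum_(r < g.+1) t%:E)%E).
  have mF r : measurable (F r) by exact: measurable_dies.
  have := @content_subadditive _ _ _ P (\big[setU/set0]_(r < g.+1) F r) F g.+1.
  move=> /(_ (fun r _ => mF r)) H.
  apply: le_trans (H _ (@subset_refl _ _)) _.
    by apply: bigsetU_measurable => r _; exact: mF.
  apply: lee_sum => r _; apply: dies_bound => //.
  by rewrite -ltnS.
rewrite sumEFin lee_fin sumr_const card_ord /t /bad_term -/g.
have h0' : 0 < h%:R :> R by rewrite ltr0n.
have hg : h%:R / 2 <= (h - g)%:R :> R.
  rewrite ler_pdivrMr // -natrM ler_nat; lia.
have -> : (2 * g).+2%:R = 2 * g.+1%:R :> R by rewrite -natrM; congr (_%:R); lia.
rewrite -[_ *+ g.+1]mulr_natr.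
have -> : 32 * g.+1%:R ^+ 5 / h%:R ^+ 2 =
    2 * ((g.+1%:R * (2 * g.+1%:R)) ^+ 2 / (h%:R / 2) ^+ 2) * g.+1%:R :> R.
  by field; rewrite gt_eqF.
apply: ler_wpM2r => //; apply: ler_wpM2l => //; apply: ler_wpM2l; first exact: sqr_ge0.
rewrite lef_pV2 ?posrE ?exprn_gt0 ?divr_gt0 ?ltr0n //.
by apply: lerXn2r; rewrite ?nnegrE ?divr_ge0.
Qed.

(** [radius] equals K on the block from 2^K to 2^(K+1), which contributes at most 32 (K + 1)^5 /
    2^K. The subtracted term makes the induction close: with y = K + 12 it needs 2 (y + 1)^5 <= 3
    y^5, true from y = 12 on. *)
Lemma sum_dyadic K : \sum_(1 <= h < 2 ^ K) bad_term h <=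
  32 * (4 * 12 ^+ 5 - 4 * (K%:R + 12) ^+ 5 / 2 ^+ K).
Proof.
elim: K => [|K IH]; first by rewrite big_geq // add0r expr0 divr1 subrr mulr0.
rewrite (big_cat_nat (n := (2 ^ K)%N)) ?expn_gt0 ?leq_exp2l //=.
apply: le_trans (lerD IH (_ : _ <= 32 * (K%:R + 1) ^+ 5 / 2 ^+ K)) _.
  have -> : 32 * (K%:R + 1) ^+ 5 / 2 ^+ K =
      \sum_(2 ^ K <= h < 2 ^ K.+1) 32 * (K%:R + 1) ^+ 5 / (2 ^+ K) ^+ 2 :> R.
    rewrite big_const_nat iter_addr_0 -[_ *+ (_ - _)]mulr_natr.
    have -> : (2 ^ K.+1 - 2 ^ K)%N = (2 ^ K)%N by rewrite expnS; lia.
    by rewrite natrX; field; rewrite expf_neq0.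
  rewrite !big_nat; apply: ler_sum => h /andP[h1 h2].
  have gK : radius h = K by apply: trunc_log_eq => //; rewrite h1.
  rewrite /bad_term gK natr1; apply: ler_wpM2l; first by rewrite mulr_ge0 ?exprn_ge0.
  have h0 : (0 < h)%N by apply: leq_trans h1; rewrite expn_gt0.
  rewrite lef_pV2 ?posrE ?exprn_gt0 ?ltr0n //.
  by apply: lerXn2r; rewrite ?nnegrE // ?exprn_ge0 // -natrX ler_nat.
rewrite -(natr1 K) [2 ^+ K.+1]exprS.
have p0 : 0 < 2 ^+ K :> R by rewrite exprn_gt0.
set x := K%:R : R; have x0 : 0 <= x by [].
set q := 2 ^+ K in p0 *.
have -> : 32 * (4 * 12 ^+ 5 - 4 * (x + 1 + 12) ^+ 5 / (2 * q)) =
  32 * (4 * 12 ^+ 5 - 4 * (x + 12) ^+ 5 / q) + 32 * (x + 1) ^+ 5 / q +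
  32 * (4 * (x + 12) ^+ 5 - (x + 1) ^+ 5 - 2 * (x + 13) ^+ 5) / q.
  by field; rewrite gt_eqF.
rewrite lerDl divr_ge0 ?(ltW p0) // mulr_ge0 //.
have : (x + 1) ^+ 5 <= (x + 12) ^+ 5 by apply: lerXn2r; rewrite ?nnegrE; lra.
have -> : x + 13 = x + 12 + 1 by ring.
have : 12 <= x + 12 by lra.
move: (x + 12) ((x + 1) ^+ 5) => y z y12 zy.
have y0 : 0 <= y by lra.
have z0 : 0 <= y - 12 by lra.
have y1 := mulr_ge0 y0 z0.
have y2 := mulr_ge0 (exprn_ge0 2 y0) z0.
have y3 := mulr_ge0 (exprn_ge0 3 y0) z0.
have y4 := mulr_ge0 (exprn_ge0 4 y0) z0.
nra.
Qed.

Lemma ae_eventually_not_bad (P : probability LT_infinite R) : is_critical_limit P ->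
  {ae P, forall T : LT_infinite,
     exists M, forall h, (M <= h)%N -> ~~ bad_height h (T : LT None)}.
Proof.
move=> hP; pose F h : set LT_infinite := [set T | bad_height h T].
have F0 : F 0%N = set0 by apply/seteqP; split=> T //=; rewrite /F /bad_height.
have mF h : measurable (F h).
  case: h => [|h]; first by rewrite F0.
  by rewrite /F bad_heightE //; apply: bigcup_measurable => r _; exact: measurable_dies.
exists (lim_sup_set F); split.
- by apply: bigcapT_measurable => n; apply: bigcup_measurable => k _; exact: mF.
- apply: lim_sup_set_cvg0 => //.
  apply: (@le_lt_trans _ _ (32 * (4 * 12 ^+ 5))%:E); last exact: ltry.
  apply: lime_le; first by apply: is_cvg_nneseries => n _ _; exact: measure_ge0.
  apply: nearW => n.
  (* As n <= 2^n, the partial sum is enlarged to whole dyadic blocks. *)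
  apply: (@le_trans _ _ (\sum_(1 <= h < 2 ^ n) (bad_term h)%:E)%E); last first.
    rewrite sumEFin lee_fin; apply: le_trans (sum_dyadic n) _.
    by rewrite ler_pM2l // lerBlDr lerDl !mulr_ge0 ?invr_ge0 ?exprn_ge0 ?addr_ge0.
  case: n => [|n]; first by rewrite !big_geq.
  rewrite big_nat_recl //= F0 measure0 add0e.
  rewrite -(big_add1 _ _ 0 n.+1 predT (fun h => P (F h))).
  rewrite [leRHS](big_cat_nat (n := n.+1)) //=; last by rewrite ltnW // ltn_expl.
  rewrite -[leLHS]adde0; apply: leeD; last first.
    by apply: sume_ge0 => h _; rewrite lee_fin !mulr_ge0 ?exprn_ge0 ?invr_ge0 // exprn_ge0.
  rewrite big_nat [leRHS]big_nat; apply: lee_sum => h /andP[h0 _].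
  exact: bad_height_bound.
- move=> T /= nT n _; apply: contrapT => H; apply: nT; exists n => h nh.
  by apply/negP => bh; apply: H; exists h.
Qed.

End BorelCantelli.

(** * Closed one-forms modulo two *)

Local Close Scope ring_scope.
Local Close Scope classical_set_scope.

Lemma circle_primitive n (g : 'I_n -> bool) : \big[addb/false]_(i < n) g i = false ->
  exists f : 'I_n -> bool, forall i, f i (+) f (ordS i) = g i.
Proof.
move=> g0; exists (fun i => \big[addb/false]_(k < n | k < i) g k) => i.
have E : \big[addb/false]_(k < n | k < i.+1) g k =
    g i (+) \big[addb/false]_(k < n | k < i) g k.
  rewrite (bigD1 i) //=; congr (_ (+) _); apply: eq_bigl => k.
  by rewrite ltnS ltn_neqAle andbC.
have := ltn_ord i; rewrite leq_eqVlt => /orP[/eqP e|lt]; last first.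
  by rewrite /= (modn_small lt) E addbCA addbb addbF.
rewrite /= e modnn [X in _ (+) X]big1 ?addbF //.
have E1 : \big[addb/false]_(k < n | k < i.+1) g k = false.
  by rewrite -[RHS]g0; apply: eq_bigl => k; apply: (leq_trans (ltn_ord k)); rewrite e.
by move: E; rewrite E1; case: (g i) (\big[addb/false]_(_ < n | _) _) => [] [].
Qed.

Section Planar.
Variable T : labelled None.
Local Notation st := (strip_of T).

Definition edge : Type := {j : nat & ('I_(len T j) + ('I_(len T j) + 'I_(len T j.+1)))%type}.
HB.instance Definition _ := Choice.on edge.

Definition circle_edge j (i : 'I_(len T j)) : edge := existT _ j (inl i).
Definition crossing_edge j (t : 'I_(len T j) + 'I_(len T j.+1)) : edge := existT _ j (inr t).

Definition base_edge j (t : 'I_(len T j) + 'I_(len T j.+1)) : edge :=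
  match t with inl i => circle_edge i | inr k => circle_edge k end.

Definition left_nbr j := finv (right (st j)).

Lemma rightK j : cancel (right (st j)) (@left_nbr j).
Proof. exact/finv_f/right_inj. Qed.

Lemma leftK j : cancel (@left_nbr j) (right (st j)).
Proof. exact/f_finv/right_inj. Qed.

(* The three sides of the triangle t of strip j. *)
Definition tri j (t : 'I_(len T j) + 'I_(len T j.+1)) : seq edge :=
  [:: crossing_edge (left_nbr t); crossing_edge t; base_edge t].

Definition potential := forall j, 'I_(len T j) -> bool.

Definition cross (f : potential) (e : edge) : bool :=
  match e with
  | existT j (inl i) => f j i (+) f j (ordS i)
  | existT j (inr t) => f j (bot (st j) t) (+) f j.+1 (top (st j) t)
  end.

Definition closed_form (c : edge -> bool) :=
  forall j (t : 'I_(len T j) + 'I_(len T j.+1)),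
    c (crossing_edge (left_nbr t)) (+) c (crossing_edge t) (+) c (base_edge t) = false.

Lemma left_sides j (t : 'I_(len T j) + 'I_(len T j.+1)) :
  bot (st j) (left_nbr t) = (if t is inl i then i else bot (st j) t) /\
  top (st j) (left_nbr t) = (if t is inr k then k else top (st j) t).
Proof. by have := right_incidence (st j) (left_nbr t); rewrite leftK; case: t => ? []. Qed.

Lemma closed_cross f : closed_form (cross f).
Proof.
move=> j t; have [b t'] := left_sides t; rewrite /= b t'.
case: t {b t'} => [i|k] /=; rewrite ?bot_inl ?top_inr.
  by case: (f _ _) (f _ _) (f _ _) => [] [] [].
by case: (f _ _) (f _ _) (f _ _) => [] [] [].
Qed.

Section Exact.
Variable c : edge -> bool.
Hypotheses (c_closed : closed_form c) (c0 : forall i : 'I_(len T 0), c (circle_edge i) = false).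

Let holonomy j := \big[addb/false]_(i < len T j) c (circle_edge i).

Let holonomyS j : holonomy j = holonomy j.+1.
Proof.
have : \big[addb/false]_(t : 'I_(len T j) + 'I_(len T j.+1))
    (c (crossing_edge (left_nbr t)) (+) c (crossing_edge t) (+) c (base_edge t)) = false.
  by rewrite big1 // => t _; exact: c_closed.
rewrite !big_split /= -(reindex_inj (can_inj (@leftK j)) (P := predT)
  (F := fun t => c (crossing_edge t))) /=.
rewrite addbb addFb big_sumType /= -/(holonomy j) -/(holonomy j.+1).
by case: (holonomy j) (holonomy j.+1) => [] [].
Qed.

Let holonomy0 j : holonomy j = false.
Proof. by elim: j => [|j IH]; [rewrite /holonomy big1|rewrite -holonomyS]. Qed.

Let prim j := projT1 (cid (circle_primitive (holonomy0 j))).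
Let primP j (i : 'I_(len T j)) : prim i (+) prim (ordS i) = c (circle_edge i).
Proof. exact: (projT2 (cid (circle_primitive (holonomy0 j)))). Qed.

Let first j : 'I_(len T j) + 'I_(len T j.+1) := inl (Ordinal (len_gt0 T j)).

(* Adjusts the primitives on the circles so that they fit together. *)
Let shift := fix F j := if j is i.+1
  then F i (+) prim (bot (st i) (first i)) (+) prim (top (st i) (first i))
    (+) c (crossing_edge (first i))
  else false.

(** Summing c over the triangles of a strip counts each crossing edge twice, so the parity around
    consecutive circles agrees and is that of circle 0, namely zero. Each circle then has a
    primitive, and closedness propagates the match from one crossing edge to the entire strip. *)
Lemma exact_form : exists f, forall e, cross f e = c e.
Proof.
exists (fun j i => shift j (+) prim i) => -[j [i|t]] /=.
  by rewrite -[RHS]primP; case: (shift j) (prim _) (prim _) => [] [] [].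
have [p ->] := right_iter (st j) (first j) t.
elim: p => [|p IH].
  rewrite /= -/(crossing_edge (first j)).
  by case: (shift j) (prim _) (prim _) (c _) => [] [] [] [].
move: IH; rewrite iterS; set t1 := iter p _ _.
have := c_closed (right (st j) t1).
rewrite rightK -/(crossing_edge t1) -/(crossing_edge (right (st j) t1)).
have := right_incidence (st j) t1; case: (right (st j) t1) => [i|k] [-> -> ->].
  rewrite -[base_edge _]/(circle_edge i) -primP.
  move: (prim (bot (st j) (first j))) (prim (top (st j) (first j))).
  move: (c (crossing_edge (first j))) (shift j) (prim i) (prim (ordS i)).
  move: (prim (top (st j) t1)) (c _) (c _).
  by do 9!case.
rewrite -[base_edge _]/(circle_edge k) -primP.
move: (prim (bot (st j) (first j))) (prim (top (st j) (first j))).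
move: (c (crossing_edge (first j))) (shift j) (prim k) (prim (ordS k)).
move: (prim (bot (st j) t1)) (c _) (c _).
by do 9!case.
Qed.

End Exact.
End Planar.

(** * Adjacency and lineages *)

Section Adjacency.
Variable T : labelled None.
Local Notation st := (strip_of T).
Implicit Types e : edge T.

Definition tri_above (e : edge T) : seq (edge T) :=
  match e with
  | existT j (inl i) => tri (inl i : 'I_(len T j) + 'I_(len T j.+1))
  | existT j (inr t) => tri (right (st j) t)
  end.

Definition tri_below (e : edge T) : seq (edge T) :=
  match e with
  | existT 0 (inl i) => [::]
  | existT j.+1 (inl k) => tri (inr k : 'I_(len T j) + 'I_(len T j.+1))
  | existT j (inr t) => tri t
  end.

Definition nbrs e := tri_above e ++ tri_below e.

(** At most two triangles with three sides each, e itself being counted. *)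
Lemma size_nbrs e : size (nbrs e) <= 6.
Proof. by case: e => -[|j] [i|t]. Qed.

Lemma nbrsP e e' : reflect (exists j (t : 'I_(len T j) + 'I_(len T j.+1)),
  e \in tri t /\ e' \in tri t) (e' \in nbrs e).
Proof.
apply: (iffP idP) => [|[j [t [et e't]]]].
  rewrite mem_cat => /orP[].
    case: e => j [i|t] h; first by exists j, (inl i); rewrite h !inE eqxx !orbT.
    by exists j, (right (st j) t); rewrite h /tri rightK mem_head.
  case: e => -[|j] [i|t] //= h.
  - by exists 0, t; rewrite h !inE eqxx orbT.
  - by exists j, (inr i); rewrite h !inE eqxx !orbT.
  - by exists j.+1, t; rewrite h !inE eqxx orbT.
move: et; rewrite !inE => /or3P[] /eqP->; rewrite mem_cat.
- by rewrite [tri_above _]/(tri (right (st j) (left_nbr t))) leftK e't.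
- by case: (j) (t) e't => [|i] u ->; rewrite orbT.
- by case: t e't => [i|k] ->; rewrite ?orbT.
Qed.

Lemma nbrs_sym e e' : (e' \in nbrs e) = (e \in nbrs e').
Proof. by apply/nbrsP/nbrsP => -[j [t [h1 h2]]]; exists j, t. Qed.

(** Doubled height: a crossing edge lies halfway between two circles, so a step within a triangle
    changes it by at most 1. *)
Definition height e : nat :=
  match e with existT j (inl _) => 2 * j | existT j (inr _) => (2 * j).+1 end.

Lemma height_nbrs e e' : e' \in nbrs e -> height e' <= (height e).+1.
Proof.
case/nbrsP=> j [t [et e't]].
have H e1 : e1 \in tri t -> (e1 \in [:: base_edge t]) || (height e1 == (2 * j).+1).
  by rewrite !inE => /or3P[] /eqP->; rewrite eqxx ?orbT.
have B : (2 * j <= height (base_edge t)) && (height (base_edge t) <= (2 * j).+2).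
  by case: (t) => i /=; lia.
move: (H _ et) (H _ e't) B; rewrite !inE => /orP[]/eqP-> /orP[]/eqP->; lia.
Qed.

Lemma height_path e s : path (fun e e' => e' \in nbrs e) e s ->
  (forall e', e' \in s -> height e' <= height e + size s /\ height e <= height e' + size s).
Proof.
elim: s e => //= e1 s IH e /andP[e1e /IH{}IH] e'.
have h1 := height_nbrs e1e; rewrite nbrs_sym in e1e; have h2 := height_nbrs e1e.
rewrite inE => /predU1P[->|/IH[]]; lia.
Qed.

End Adjacency.

Section Lineage.
Variable T : labelled None.
Local Notation st := (strip_of T).

Definition vtx j p : 'I_(len T j) := iter p (@ordS (len T j)) (base T j).
Definition parent_vertex j (k : 'I_(len T j.+1)) : 'I_(len T j) := bot (st j) (inr k).

Definition offspring_at j := offspring (st j) (base T j).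

Lemma code_atE_infinite j : code_at T j = offspring_at j.
Proof. exact: (@code_atE None T j isT). Qed.

Lemma parent_vtx j q : q < len T j.+1 ->
  parent_vertex (vtx j.+1 q) = vtx j (reshape_index (offspring_at j) q).
Proof. by move=> ql; rewrite /parent_vertex /vtx (@baseS None T j isT) bot_inr_iter. Qed.

Definition lineage a G (s : nat -> nat) :=
  forall j, a <= j < a + G -> parent_vertex (vtx j.+1 (s j.+1)) = vtx j (s j).

Lemma nth_flatten_nseq (b : seq bool) c q : size c = size b ->
  nth false (flatten [seq nseq p.2 p.1 | p <- zip b c]) q =
  if q < sumn c then nth false b (reshape_index c q) else false.
Proof.
elim: b c q => [|x b IH] [|k c] q //=; first by rewrite nth_nil.
case=> sz.
rewrite nth_cat size_nseq nth_nseq.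
rewrite /reshape_index /= subn_eq0; have [qk|kq] := ltnP q k.
  by rewrite (leq_trans qk) ?leq_addr.
rewrite IH // /reshape_index ltn_subLR //; case: ifP => // _.
by rewrite subSn.
Qed.

(** A true label at q was inherited from a marked ancestor; the lineage is traced downwards from
    q. *)
Lemma lineage_exists a G (b : seq bool) q : size b = len T a ->
    nth false (desc b (map (@code_at None T) (iota a G))) q ->
  exists s, [/\ lineage a G s, s (a + G) = q & nth false b (s a)].
Proof.
move=> sb; elim: G q => [|G IH] q.
  by move=> bq; exists (fun=> q); split=> //; rewrite /lineage => j; lia.
rewrite -addn1 iotaD map_cat /desc foldl_cat -/(desc _ _) /= code_atE_infinite.
have sz : size (desc b [seq code_at T i | i <- iota a G]) = len T (a + G).
  rewrite size_desc; last first.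
    have [] := @codeE None T (a + G) (fun _ _ => isT).
    rewrite /mkseq iotaD map_cat chain_cat => /andP[_ +] _.
    by have [_ ->] := @codeE None T a (fun _ _ => isT); rewrite sb.
  have [] := @codeE None T (a + G) (fun _ _ => isT).
  rewrite /mkseq iotaD map_cat final_cat => _.
  by have [_ ->] := @codeE None T a (fun _ _ => isT); rewrite sb.
rewrite nth_flatten_nseq; last by rewrite sz size_offspring.
rewrite sumn_offspring; case: ifP => // ql /IH[s [s1 s2 s3]].
exists (fun j => if j == (a + G).+1 then q else s j); split.
- move=> j /andP[aj]; rewrite addn1 addnS ltnS leq_eqVlt => /orP[/eqP->|jG].
    by rewrite eqxx (ltn_eqF (ltnSn _)) parent_vtx // s2.
  rewrite eqSS !ltn_eqF ?s1 ?aj //; exact: ltnW.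
- by rewrite addn1 addnS eqxx.
- by rewrite ltn_eqF // ltnS leq_addr.
Qed.

(** Parents are unique, so lineages that meet coincide below the meeting point. *)
Lemma lineage_uniq a G s s' j : lineage a G s -> lineage a G s' -> a <= j <= a + G ->
  vtx j (s j) = vtx j (s' j) -> vtx a (s a) = vtx a (s' a).
Proof.
move=> l l' /andP[]; elim: j => [|j IH]; first by rewrite leqn0 => /eqP->.
rewrite leq_eqVlt => /orP[/eqP->//|aj] jG e; apply: IH => //; first exact: ltnW.
have jj : a <= j < a + G by rewrite -ltnS aj.
by rewrite -(l j jj) -(l' j jj) e.
Qed.

End Lineage.

(* Around a robust height, each residue class of vertices modulo [radius h + 1]
   on circle [h - radius h] has a descendant on circle [h + radius h + 1]. *)
Definition robust_height (T : labelled None) h :=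
  forall r, r <= radius h -> exists s,
    [/\ lineage T (h - radius h) (2 * radius h).+1 s,
       s (h - radius h) < len T (h - radius h) & s (h - radius h) %% (radius h).+1 = r].

Lemma robust_height_of_good (T0 : LT None) h (T := repr T0) (g := radius h) (a := h - g) :
  0 < h -> ~~ bad_height h T0 -> robust_height T h.
Proof.
move=> h0; rewrite /bad_height /robust_height h0 andTb -/g -/a => /hasPn H r rg.
have /H : r \in iota 0 g.+1 by rewrite mem_iota.
rewrite /dies /extinct_class negbK LTcode_restrict_infinite -/T -/a.
rewrite /mkseq iotaD map_cat take_size_cat ?drop_size_cat ?size_map ?size_iota //.
rewrite take_oversize ?size_map ?size_iota //.
have [_ ->] := @codeE None T a (fun _ _ => isT).
set b := residue_class _ _ _; have sb : size b = len T a by rewrite size_map size_iota.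
move=> /hasP[x /(nthP false)[q _ <-]] /lineage_exists-/(_ sb)[s [s1 s2 s3]].
have sa : s a < len T a by rewrite -sb ltnNge; apply/negP => h1; rewrite nth_default in s3.
exists s; split=> //; move: s3; rewrite (nth_map 0) ?size_iota // nth_iota //.
by move=> /eqP.
Qed.

(** * Contours *)

Section Walks.
Variables (E : eqType) (r : rel E).
Hypothesis r_sym : symmetric r.

Lemma path_exit (W : {pred E}) x p : path r x p -> x \in W -> last x p \notin W ->
  exists u v, [/\ r u v, u \in W, v \notin W & v \in p].
Proof.
elim: p x => [|y p IH] x /=; first by move=> _ ->.
move=> /andP[xy py] xW lW; have [yW|yW] := boolP (y \in W).
  by have [u [v [h1 h2 h3 h4]]] := IH y py yW lW; exists u, v; rewrite inE h4 orbT.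
by exists x, y; rewrite mem_head.
Qed.

Lemma eq_mem_size_undup (s s' : seq E) : s =i s' -> size (undup s) = size (undup s').
Proof.
move=> e; apply/perm_size/uniq_perm; rewrite ?undup_uniq // => x.
by rewrite !mem_undup.
Qed.

(** Each new element v adjacent to some visited u is inserted as a detour u, v, u. It costs two
    steps, whence the exact length. *)
Lemma spanning_walk x (S : seq E) : uniq S -> x \in S ->
    {in S, forall y, exists p, [/\ path r x p, last x p = y & {subset p <= S}]} ->
  exists s, [/\ path r x s, x :: s =i S & size s = 2 * (size S).-1].
Proof.
move=> uS xS conn.
have H n : n < size S -> exists s, [/\ path r x s, {subset x :: s <= S},
    size (undup (x :: s)) = n.+1 & size s = 2 * n].
  elim: n => [|n IH] nS.
    by exists [::]; split=> // y; rewrite inE => /eqP->.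
  have [s [ps sS us ss]] := IH (ltnW nS).
  have [y yS ys] : exists2 y, y \in S & y \notin x :: s.
    apply/hasP/negbNE/negP; rewrite -all_predC => /allP H.
    have : size S <= size (undup (x :: s)).
      by apply: uniq_leq_size => // y /H; rewrite mem_undup /= negbK.
    by rewrite us leqNgt nS.
  have [p [px ly pS]] := conn y yS.
  have [||u [v [uv uW vW vp]]] := path_exit px (W := mem (x :: s)).
  - exact: mem_head.
  - by rewrite ly.
  move: ps sS us ss ys vW; case/splitPl: uW => s1 s2 l1; rewrite cat_path => /andP[p1 p2].
  move=> sS us ss ys vW; exists (s1 ++ v :: u :: s2).
  have mE : x :: s1 ++ v :: u :: s2 =i v :: x :: s1 ++ s2.
    move=> z; have uu : u \in x :: s1 by rewrite -l1 mem_last.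
    rewrite !(inE, mem_cat); move: uu; rewrite inE.
    by have [->|_] := eqVneq z u; [case: (_ == x); case: (_ \in s1); rewrite ?orbT|
      rewrite orFb; case: (z == x); case: (z == v); rewrite ?orbT].
  split.
  - by rewrite cat_path p1 /= l1 uv r_sym uv -l1.
  - by move=> z; rewrite mE inE => /predU1P[->|/sS //]; exact: pS.
  - rewrite (eq_mem_size_undup mE) /= ifN //; congr _.+1; first exact: us.
  - by rewrite size_cat /= !addnS -size_cat ss mulnS.
have S0 : 0 < size S by case: (S) xS.
have [|s [ps sS us ss]] := H (size S).-1; first by rewrite prednK.
exists s; split=> // y; rewrite prednK // in us.
have [||_ e] := @uniq_min_size _ (undup (x :: s)) S (undup_uniq _).
- by move=> z; rewrite mem_undup => /sS.
- by rewrite us.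
by rewrite -e mem_undup.
Qed.

Lemma odd_class (R : rel E) (s : seq E) : symmetric R -> transitive R -> {in s, reflexive R} ->
  odd (size s) -> exists2 x, x \in s & odd (count (R x) s).
Proof.
move=> Rs Rt; have [n] := ubnP (size s); elim: n s => // n IH [//|x s'] sn Rr os.
set s := x :: s' in sn Rr os *; have xs : x \in s by exact: mem_head.
have [od|e] := boolP (odd (count (R x) s)); first by exists x.
pose s2 := [seq y <- s | ~~ R x y].
have sz : size s = count (R x) s + size s2 by rewrite size_filter count_predC.
have h1 : size s2 < n.
  rewrite -ltnS (leq_trans _ sn) // ltnS sz -[size s2]add0n ltn_add2r -has_count.
  by apply/hasP; exists x => //; exact: Rr.
have h2 : {in s2, reflexive R} by move=> y; rewrite mem_filter => /andP[_ /Rr].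
have h3 : odd (size s2) by move: os; rewrite sz oddD (negPf e).
have [y] := IH s2 h1 h2 h3.
rewrite mem_filter => /andP[xy ys] o; exists y => //.
rewrite (_ : count (R y) s = count (R y) s2) // count_filter.
apply: eq_count => z /=; case Ryz : (R y z) => //=.
by rewrite Rs in Ryz; apply/esym/negP => xz; move/negP: xy; apply; exact: Rt xz Ryz.
Qed.

End Walks.

Section Contours.
Variable T : labelled None.
Local Notation st := (strip_of T).
Implicit Types (f phi : potential T) (e : edge T).

Definition adj : rel (edge T) := fun e e' => e' \in nbrs e.

Lemma adj_sym : symmetric adj.
Proof. by move=> e e'; exact: nbrs_sym. Qed.

Definition edges N : seq (edge T) :=
  [seq existT (fun j => ('I_(len T j) + ('I_(len T j) + 'I_(len T j.+1)))%type) j x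
     | j <- iota 0 N.+1, x <- enum {: 'I_(len T j) + ('I_(len T j) + 'I_(len T j.+1))}].

Lemma mem_edges N e : (e \in edges N) = (tag e <= N).
Proof.
apply/allpairsPdep/idP => [[j [x [jN _ ->]]]|eN].
  by move: jN; rewrite mem_iota ltnS.
by exists (tag e), (tagged e); split; [rewrite mem_iota ltnS|rewrite mem_enum|case: (e)].
Qed.

Lemma uniq_edges N : uniq (edges N).
Proof.
apply: allpairs_uniq_dep; first exact: iota_uniq.
  by move=> j _; exact: enum_uniq.
by move=> [j x] [j' x'] _ _ /= ->.
Qed.

(* The edge of strip h on the path of base vertices. *)
Definition spine h : edge T := crossing_edge (inl (ord_pred (base T h))).

Lemma cross_spine f h : cross f (spine h) = f h (base T h) (+) f h.+1 (base T h.+1).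
Proof.
rewrite /spine /= bot_inl ord_predK (_ : top _ _ = base T h.+1) //.
by rewrite (@baseS None T h isT).
Qed.

Lemma telescope_spine f n :
  f 0 (base T 0) (+) f n (base T n) = odd (count (cross f) (map spine (iota 0 n))).
Proof.
elim: n => [|n IH]; first by rewrite addbb.
rewrite -[in RHS]addn1 iotaD map_cat count_cat oddD -IH add0n.
have -> : count (cross f) (map spine (iota n 1)) = cross f (spine n) by rewrite /= addn0.
rewrite oddb cross_spine.
by case: (f _ _) (f _ _) (f _ _) => [] [] [].
Qed.

Section Component.
Variables (f : potential T) (e0 : edge T).

Definition joined e e' : bool := `[< exists p, [/\ path adj e p, last e p = e' &
  all (cross f) (e :: p)] >].

Lemma joined_refl e : cross f e -> joined e e.
Proof. by move=> ce; apply/asboolP; exists [::]; rewrite /= ce. Qed.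

Lemma joined_cross e e' : joined e e' -> cross f e && cross f e'.
Proof.
move=> /asboolP[p [_ <- /allP al]]; rewrite !al ?mem_head //; exact: mem_last.
Qed.

Lemma joined_trans : transitive joined.
Proof.
move=> e' e e'' /asboolP[p [p1 p2 p3]] /asboolP[q [q1 q2 q3]].
apply/asboolP; exists (p ++ q); rewrite cat_path p1 last_cat p2 q1 q2.
by split=> //; rewrite /= all_cat; move: p3 q3 => /= /andP[-> ->] /andP[_ ->].
Qed.

Lemma joined_step e e' : cross f e -> cross f e' -> adj e e' -> joined e e'.
Proof. by move=> ce ce' a; apply/asboolP; exists [:: e']; rewrite /= a ce ce'. Qed.

Lemma joined_sym : symmetric joined.
Proof.
have H e e' : joined e e' -> joined e' e.
  move=> /asboolP[p [p1 p2 p3]]; elim: p e p1 p2 p3 => [|x p IH] e /=.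
    by move=> _ <- /andP[ce _]; exact: joined_refl.
  move=> /andP[ex px] l /and3P[ce cx cp].
  have h : joined e' x by apply: IH => //=; rewrite cx.
  by apply: joined_trans h _; apply: joined_step; rewrite // adj_sym.
by move=> e e'; apply/idP/idP; exact: H.
Qed.

(** Disagreement edges of a common triangle are adjacent, so they all belong to the component or
    none of them does. On each triangle the indicator is therefore [cross f] or zero. *)
Lemma joined_closed : closed_form (joined e0).
Proof.
move=> j t.
have [/hasP[e et ec]|/hasPn no] := boolP (has (joined e0) (tri t)).
  have E e' : e' \in tri t -> joined e0 e' = cross f e'.
    move=> e't; apply/idP/idP => [/joined_cross/andP[]//|ce'].
    apply: (joined_trans ec); apply: joined_step => //.
      by case/andP: (joined_cross ec).
    by apply/nbrsP; exists j, t.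
  by rewrite !E ?closed_cross // !inE eqxx ?orbT.
by rewrite !(negPf (no _ _)) // !inE eqxx ?orbT.
Qed.

End Component.

(* s walks through the edges of the contour, starting at height h; phi is the
   indicator of the vertices that it separates from infinity. *)
Definition is_contour N h s phi := [/\ path adj (spine h) s,
  forall e, cross phi e = (e \in spine h :: s),
  forall j i, N < j -> phi j i = false,
  phi 0 (base T 0) = true
  & size s = 2 * (size (undup (spine h :: s))).-1].

Lemma const_circle phi j : (forall i : 'I_(len T j), ~~ cross phi (circle_edge i)) ->
  forall i i' : 'I_(len T j), phi j i = phi j i'.
Proof.
move=> H i i'; have [p _ ->] := iter_ordS_surj i i'.
elim: p => //= p ->; have := H (iter p (@ordS _) i); rewrite /=.
by case: (phi _ _) (phi _ _) => [] [].
Qed.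

Lemma const_between phi a b : a <= b ->
    (forall j (i : 'I_(len T j)), a <= j <= b -> ~~ cross phi (circle_edge i)) ->
    (forall j (t : 'I_(len T j) + 'I_(len T j.+1)), a <= j < b -> ~~ cross phi (crossing_edge t)) ->
  forall i i', phi a i = phi b i'.
Proof.
move=> ab Hc Hx i; elim: b ab Hc Hx => [|b IH].
  by rewrite leqn0 => /eqP a0; subst a => Hc _ i'; apply: const_circle => k; exact: Hc.
rewrite leq_eqVlt => /orP[/eqP ab|ab] Hc Hx i'.
  by subst a; apply: const_circle => k; apply: Hc; rewrite leqnn.
pose t : 'I_(len T b) + 'I_(len T b.+1) := inl (base T b).
transitivity (phi b (bot (st b) t)).
  apply: IH => // j k /andP[aj jb]; [apply: Hc|apply: Hx]; rewrite aj.
    exact: leqW.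
  exact: ltnW.
have := Hx b t; rewrite -ltnS ab ltnSn => /(_ isT) /=.
have -> : phi b.+1 (top (st b) t) = phi b.+1 i'.
  by apply: const_circle => k; apply: Hc; rewrite leqnn ltnW.
by case: (phi b _) (phi b.+1 _) => [] [].
Qed.

(** The path of base vertices has an odd number of disagreement edges, so some component contains an
    odd number of them. A primitive of this component separates the root from circle N + 1. *)
Lemma contour_exists N f : (forall j i, N < j -> f j i = true) ->
    f 0 (base T 0) = false ->
  exists h s phi, [/\ h <= N, is_contour N h s phi &
    {subset spine h :: s <= cross f}].
Proof.
move=> fN f0.
have fin e : cross f e -> e \in edges N.
  rewrite mem_edges leqNgt; apply: contraTN.
  by case: e => j [i|t] /= jN; rewrite !fN //; exact: ltnW.
set hs := [seq e <- map spine (iota 0 N.+1) | cross f e].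
have ohs : odd (size hs).
  by rewrite size_filter -telescope_spine f0 fN.
have [|e1 ehs ocl] := odd_class (joined_sym f) (@joined_trans f) _ ohs.
  by move=> e; rewrite mem_filter => /andP[/joined_refl].
move: ehs ocl; rewrite mem_filter => /andP[ce /mapP[h]].
rewrite mem_iota ltnS => /andP[_ hN] eh; rewrite {e1}eh in ce *.
rewrite count_filter (eq_count (a2 := joined f (spine h))); last first.
  by move=> e /=; case ech : (joined _ _ _) => //=; case/andP: (joined_cross ech).
move=> oc.
(* The edge of circle 0 is a loop, on which [cross f] vanishes. *)
have [i|phi0 Hphi0] := exact_form (@joined_closed f (spine h)).
  apply/negP => /joined_cross/andP[_].
  have : ordS i = i by apply: val_inj => /=; case: i => i /=; rewrite len0; case: i.
  by rewrite /= => ->; rewrite addbb.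
(* A primitive is determined up to a constant; this one is normalized to vanish above N. *)
pose top_val := phi0 N.+1 (base T N.+1).
pose phi : potential T := fun j i => phi0 j i (+) top_val.
have cphi e : cross phi e = joined f (spine h) e.
  by rewrite -Hphi0; case: e => j [i|t] /=; rewrite /phi addbACA addbb addbF.
have compN e : joined f (spine h) e -> tag e <= N.
  by move=> /joined_cross/andP[_ /fin]; rewrite mem_edges.
have phiN j i : N < j -> phi j i = false.
  move=> Nj; rewrite (_ : phi j i = phi N.+1 (base T N.+1)); last first.
    apply/esym/const_between => // j' k /andP[Nj' _]; rewrite cphi; apply/negP => /compN /=.
      by rewrite leqNgt Nj'.
    by rewrite leqNgt Nj'.
  by rewrite /phi /top_val addbb.
set S := [seq e <- edges N | joined f (spine h) e].
have memS e : (e \in S) = joined f (spine h) e.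
  rewrite mem_filter mem_edges; apply/andP/idP => [[]//|ec]; split=> //; exact: compN.
have [|||s [s1 s2 s3]] := @spanning_walk _ adj adj_sym (spine h) S.
- by rewrite filter_uniq // uniq_edges.
- by rewrite memS joined_refl.
- move=> e; rewrite memS => /asboolP[p [p1 p2 /allP p3]]; exists p; split=> // e' e'p.
  have e'p' : e' \in spine h :: p by rewrite inE e'p orbT.
  rewrite memS; move: p1 p3 {p2 e'p}; case/splitPl: e'p' => q1 q2 lq.
  rewrite cat_path => /andP[pq _] al; apply/asboolP; exists q1; split=> //.
  by apply/allP => x xq; apply: al; rewrite -cat_cons mem_cat xq.
exists h, s, phi; split=> //; last first.
  by move=> e; rewrite s2 memS => /joined_cross/andP[].
split=> //.
- by move=> e; rewrite s2 memS cphi.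
- have := telescope_spine phi N.+1; rewrite (phiN N.+1) // addbF => ->.
  by rewrite (eq_count cphi).
- by rewrite (eq_mem_size_undup s2) undup_id // filter_uniq // uniq_edges.
Qed.

End Contours.

Section LongContours.
Variable T : labelled None.
Local Notation st := (strip_of T).

Fixpoint walks n (e : edge T) : seq (seq (edge T)) :=
  if n is m.+1 then [seq x :: s | x <- nbrs e, s <- walks m x] else [:: [::]].

Lemma mem_walks n e s : path (@adj T) e s -> size s = n -> s \in walks n e.
Proof.
elim: n e s => [|n IH] e [|x s] //= /andP[ex px] [sn].
by apply/allpairsPdep; exists x, s; split=> //; exact: IH.
Qed.

Lemma size_walks n e : size (walks n e) <= 6 ^ n.
Proof.
elim: n e => [//|n IH] e /=.
rewrite size_allpairs_dep expnS.
apply: (@leq_trans (sumn [seq 6 ^ n | x <- nbrs e])).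
  by rewrite !sumnE !big_map; apply: leq_sum => x _; exact: IH.
by rewrite sumnE big_map big_const_seq count_predT iter_addn_0 mulnC leq_mul2r size_nbrs orbT.
Qed.

(* A short contour separates circle h - g from circle h + g + 1, so it crosses
   each of the g + 1 disjoint lineages between them. *)
Lemma contour_long N h s phi (g := radius h) : 0 < h ->
    robust_height T h -> is_contour N h s phi -> g < size (undup (spine T h :: s)).
Proof.
rewrite /robust_height -/g => h0 good [s1 s2 s3 s4 s5].
set S := undup _; rewrite ltnNge; apply/negP => Sg.
have S0 : 0 < size S.
  have : spine T h \in S by rewrite mem_undup mem_head.
  by case: (S).
have gh := radius_half h0; rewrite -/g in gh.
have g0 : 0 < g by exact: leq_trans S0 Sg.
(* The walk has at most 2 g - 2 steps and starts at height 2 h + 1, so the contour stays strictly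
   between circles h - g and h + g + 1. *)
have hts e : e \in spine T h :: s ->
    height e <= (2 * h).+1 + (2 * g - 2) /\ (2 * h).+1 <= height e + (2 * g - 2).
  rewrite inE => /predU1P[->|/(height_path s1)[]]; first by rewrite /= !leq_addr.
  rewrite s5 -/S; set k := size S in Sg S0 *; rewrite [height (spine _ _)]/=; lia.
have low j (i : 'I_(len T j)) : j <= h - g -> ~~ cross phi (circle_edge i).
  by move=> jh; rewrite s2; apply/negP => /hts [] /=; lia.
have lowx j (t : 'I_(len T j) + 'I_(len T j.+1)) : j < h - g -> ~~ cross phi (crossing_edge t).
  by move=> jh; rewrite s2; apply/negP => /hts [] /=; lia.
have high j (i : 'I_(len T j)) : h + g < j -> ~~ cross phi (circle_edge i).
  by move=> jh; rewrite s2; apply/negP => /hts [] /=; lia.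
have highx j (t : 'I_(len T j) + 'I_(len T j.+1)) : h + g < j -> ~~ cross phi (crossing_edge t).
  by move=> jh; rewrite s2; apply/negP => /hts [] /=; lia.
set a := h - g in low lowx good.
have phia i : phi a i = true.
  rewrite -s4; apply/esym/const_between => [//|j k /andP[_]|j t /andP[_]].
    exact: low.
  exact: lowx.
have agh : a + (2 * g).+1 = (h + g).+1 by rewrite /a; lia.
have phib i : phi (a + (2 * g).+1) i = false.
  rewrite -(s3 (N + (h + g).+1).+1 (base T _)); last by rewrite ltnS leq_addr.
  apply: const_between => [|j k /andP[jh _]|j t /andP[jh _]].
  - by rewrite agh ltnW // ltnS leq_addl.
  - by apply: high; rewrite agh in jh.
  - by apply: highx; rewrite agh in jh.
have ex (r : 'I_g.+1) : exists lj : (nat -> nat) * nat,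
   [/\ lineage T a (2 * g).+1 lj.1, lj.1 a < len T a, lj.1 a %% g.+1 = r,
    a <= lj.2 < a + (2 * g).+1 &
    phi lj.2 (vtx T lj.2 (lj.1 lj.2)) (+) phi lj.2.+1 (vtx T lj.2.+1 (lj.1 lj.2.+1))].
  have [l [l1 l2 l3]] := good r (ltn_ord r).
  suff [j [j1 j2]] : exists j, a <= j < a + (2 * g).+1 /\
      phi j (vtx T j (l j)) (+) phi j.+1 (vtx T j.+1 (l j.+1)) by exists (l, j).
  apply: contrapT => no.
  have H k : k <= (2 * g).+1 -> phi (a + k) (vtx T (a + k) (l (a + k))) = true.
    elim: k => [|k IH] kg; first by rewrite addn0 phia.
    apply/negP => /negP hk; apply: no; exists (a + k).
    by rewrite leq_addr ltn_add2l kg; split=> //; rewrite IH 1?ltnW // -addnS (negPf hk).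
  by have := H _ (leqnn _); rewrite phib.
have [lj ljP] := choice ex.
(* The edge from a vertex to its parent is the left-hand side of the triangle based on the circle
   edge that starts at this vertex. *)
pose eps r := crossing_edge (left_nbr (inr (vtx T (lj r).2.+1 ((lj r).1 (lj r).2.+1)))).
have epsS r : eps r \in S.
  have [l1 l2 l3 l4 l5] := ljP r.
  rewrite mem_undup -s2 /eps /cross /=.
  by have [-> ->] := left_sides (inr (vtx T (lj r).2.+1 ((lj r).1 (lj r).2.+1)));
    rewrite -/(parent_vertex _) l1.
(* A common edge has a common top vertex, where the two lineages meet; then they start at the same
   vertex and in the same residue class. *)
have eps_inj : injective eps.
  move=> r r' e; have [l1 l2 l3 l4 l5] := ljP r; have [m1 m2 m3 m4 m5] := ljP r'.
  have ej : (lj r).2 = (lj r').2 by exact: (congr1 (@tag _ _) e).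
  pose head (e : edge T) : nat := if e is existT j (inr t) then top (st j) t else 0.
  have := congr1 head e; rewrite /head /eps /=.
  rewrite !(left_sides _).2 -ej => /val_inj ev.
  have jb : a <= (lj r).2.+1 <= a + (2 * g).+1.
    by case/andP: l4 => aj ->; rewrite (leq_trans aj).
  have /(iter_ordS_inj l2 m2) el := lineage_uniq l1 m1 jb ev.
  by apply: val_inj; rewrite /= -l3 -m3 el.
have := uniq_leq_size (s1 := map eps (enum 'I_g.+1)) (s2 := S).
rewrite map_inj_uniq // enum_uniq size_map -cardE card_ord => /(_ isT) H.
have : g.+1 <= size S by apply: H => e /mapP[r _ ->].
by rewrite ltnNge Sg.
Qed.

End LongContours.

(** * Correlation inequalities for a wired core *)

Local Open Scope ring_scope.

Section GKS.
Variables (R : realType) (V : finType).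
Local Notation config := {ffun V -> bool}.
Implicit Types (s t : seq V) (sigma : config) (h : config -> R).

Definition monomial s sigma : R := \prod_(v <- s) spin R (sigma v).

Lemma monomial_cat s t sigma : monomial (s ++ t) sigma = monomial s sigma * monomial t sigma.
Proof. exact: big_cat. Qed.

Lemma sum_monomial_ge0 s : 0 <= \sum_sigma monomial s sigma.
Proof.
pose F v (b : bool) : R := spin R b ^+ count_mem v s.
have E sigma : monomial s sigma = \prod_v F v (sigma v).
  rewrite /monomial; elim: s @F => [|x s IH] /=; first by rewrite big_nil big1.
  rewrite big_cons IH (bigD1 x) // [RHS](bigD1 x) //= eqxx add1n exprS mulrA.
  congr (_ * _); apply: eq_bigr => v vx.
  by rewrite eq_sym (negPf vx) add0n.
under eq_bigr do rewrite E.
rewrite -(bigA_distr_bigA F) prodr_ge0 // => v _.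
rewrite /F big_bool /spin expr1n /=; move: (count _ _) => n.
by rewrite -signr_odd; case: (odd n); rewrite ?expr1 ?expr0 ?subrr // addr_ge0.
Qed.

(** Positivity against all monomials at once is the form of the first Griffiths inequality that is
    stable under multiplication by a + b [monomial t] with a, b >= 0. *)
Definition ferro h := forall s, 0 <= \sum_sigma monomial s sigma * h sigma.

Lemma ferro1 : ferro (fun=> 1).
Proof. by move=> s; under eq_bigr do rewrite mulr1; exact: sum_monomial_ge0. Qed.

Lemma ferroM h a b t : 0 <= a -> 0 <= b -> ferro h ->
  ferro (fun sigma => h sigma * (a + b * monomial t sigma)).
Proof.
move=> a0 b0 hh s.
rewrite (eq_bigr (fun sigma => a * (monomial s sigma * h sigma) +
    b * (monomial (s ++ t) sigma * h sigma))); last first.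
  by move=> sigma _; rewrite monomial_cat; ring.
by rewrite big_split /= -!mulr_sumr addr_ge0 // mulr_ge0.
Qed.

Variables (E : Type) (ends : E -> seq V) (I : pred E) (c d : R).
Hypotheses (d0 : 0 <= d) (dc : d <= c).

Let full sigma e : R := c + d * monomial (ends e) sigma.
Let wired sigma e : R := if I e then 1 + monomial (ends e) sigma else full sigma e.

Lemma ferro_prod h (L : seq E) (F : config -> E -> R) : ferro h ->
    (forall e, exists a b, [/\ 0 <= a, 0 <= b & forall sigma,
       F sigma e = a + b * monomial (ends e) sigma]) ->
  ferro (fun sigma => h sigma * \prod_(e <- L) F sigma e).
Proof.
move=> + FP; elim: L h => [|e L IH] h hh s.
  by under eq_bigr do rewrite big_nil mulr1; exact: hh.
have [a [b [a0 b0 Fe]]] := FP e.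
have := IH _ (ferroM (ends e) a0 b0 hh) s; under eq_bigr do rewrite -Fe -mulrA.
by under [X in _ -> is_true (_ <= X)]eq_bigr do rewrite big_cons.
Qed.

Lemma fullP e : exists a b, [/\ 0 <= a, 0 <= b & forall sigma,
  full sigma e = a + b * monomial (ends e) sigma].
Proof. by exists c, d; split=> //; exact: le_trans d0 dc. Qed.

Lemma wiredP e : exists a b, [/\ 0 <= a, 0 <= b & forall sigma,
  wired sigma e = a + b * monomial (ends e) sigma].
Proof.
rewrite /wired; case: (I e); last exact: fullP.
by exists 1, 1; split=> // sigma; rewrite mul1r.
Qed.

(** Edge by edge, c + d m = d (1 + m) + (c - d), and the remainder contributes a nonnegative sum. *)
Lemma wired_lower s h (L : seq E) : ferro h ->
  d ^+ count I L * \sum_sigma monomial s sigma * (h sigma * \prod_(e <- L) wired sigma e) <=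
  \sum_sigma monomial s sigma * (h sigma * \prod_(e <- L) full sigma e).
Proof.
elim: L h => [|e L IH] h hh.
  by rewrite expr0 mul1r; apply: ler_sum => sigma _; rewrite !big_nil.
have hf := ferroM (ends e) (le_trans d0 dc) d0 hh.
have p0 : 0 <= d ^+ count I L by rewrite exprn_ge0.
have := IH _ hf; set A := \sum_sigma _; set B := \sum_sigma _ => AB.
have -> : \sum_sigma monomial s sigma * (h sigma * \prod_(x <- e :: L) full sigma x) = B.
  by apply: eq_bigr => sigma _; rewrite big_cons -mulrA.
apply: (le_trans _ AB); rewrite [count I (e :: L)]/= exprD mulrC mulrA [leRHS]mulrC.
apply: ler_wpM2r => //; rewrite mulrC; case Ie : (I e) => /=; last first.
  rewrite expr0 mul1r le_eqVlt; apply/orP; left; apply/eqP/eq_bigr => sigma _.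
  by rewrite big_cons /wired Ie -mulrA.
rewrite expr1 mulr_sumr -subr_ge0 -sumrB.
rewrite (eq_bigr (fun sigma => (c - d) * (monomial s sigma * (h sigma *
    \prod_(x <- L) wired sigma x)))); last first.
  move=> sigma _; rewrite big_cons [wired sigma e]/wired Ie /full; ring.
by rewrite -mulr_sumr mulr_ge0 ?subr_ge0 // (ferro_prod _ hh) //; exact: wiredP.
Qed.

(** Edge by edge, c (1 + m) - (c + d m) = (c - d) m, whose sum is nonnegative although the term
    itself is signed. *)
Lemma wired_upper h (L : seq E) : ferro h ->
  \sum_sigma h sigma * \prod_(e <- L) full sigma e <=
  c ^+ count I L * \sum_sigma h sigma * \prod_(e <- L) wired sigma e.
Proof.
elim: L h => [|e L IH] h hh.
  by rewrite expr0 mul1r; apply: ler_sum => sigma _; rewrite !big_nil.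
have hf := ferroM (ends e) (le_trans d0 dc) d0 hh.
have p0 : 0 <= c ^+ count I L by rewrite exprn_ge0 // (le_trans d0).
have := IH _ hf; set A := \sum_sigma _; set B := \sum_sigma _ => AB.
have -> : \sum_sigma h sigma * \prod_(x <- e :: L) full sigma x = A.
  by apply: eq_bigr => sigma _; rewrite big_cons -mulrA.
apply: (le_trans AB); rewrite [count I (e :: L)]/= exprD [leRHS]mulrC mulrA [leLHS]mulrC.
apply: ler_wpM2r => //; rewrite mulrC; case Ie : (I e) => /=; last first.
  rewrite expr0 mul1r le_eqVlt; apply/orP; left; apply/eqP/eq_bigr => sigma _.
  by rewrite big_cons /wired Ie -mulrA.
rewrite expr1 mulr_sumr -subr_ge0 -sumrB.
rewrite (eq_bigr (fun sigma => (c - d) * (monomial (ends e) sigma * (h sigma *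
    \prod_(x <- L) wired sigma x)))); last first.
  move=> sigma _; rewrite big_cons [wired sigma e]/wired Ie /full; ring.
by rewrite -mulr_sumr mulr_ge0 ?subr_ge0 // (ferro_prod _ hh) //; exact: wiredP.
Qed.

End GKS.

(** * The Ising energy and the Peierls estimate *)

Section Energy.
Variables (R : realType) (T : labelled None) (N : nat).
Local Notation config := {ffun vertex_upto T N -> bool}.
Implicit Type sigma : config.

Definition pot sigma : potential T := fun j i => extend sigma (existT _ j i).

Lemma pot_in sigma j (hj : (j < N.+1)%N) i :
  pot sigma i = sigma (existT (fun j : 'I_N.+1 => 'I_(len T j)) (Ordinal hj) i).
Proof.
rewrite /pot /extend; case: {-}_ / idP => // hj'.
by rewrite (bool_irrelevance hj' hj).
Qed.

Lemma pot_out sigma j (i : 'I_(len T j)) : (N < j)%N -> pot sigma i = true.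
Proof.
move=> Nj; rewrite /pot /extend; case: {-}_ / idP => //= hj'.
by move: Nj; rewrite ltnNge -ltnS hj'.
Qed.

Lemma spin_pot sigma j (hj : (j < N.+1)%N) i : spin_at R sigma hj i = spin R (pot sigma i).
Proof. by rewrite /spin_at pot_in. Qed.

Definition sgn (b : bool) : R := if b then -1 else 1.

Lemma spinM a b : spin R a * spin R b = sgn (a (+) b).
Proof. by case: a b => [] []; rewrite /spin /sgn /= ?mulrNN ?mulr1 ?mul1r. Qed.

Lemma hamiltonian_plus sigma :
  hamiltonian R (fun=> true) sigma = - \sum_(e <- edges T N) sgn (cross (pot sigma) e).
Proof.
rewrite /hamiltonian -opprD; congr (- _).
rewrite /edges big_allpairs_dep -[iota 0 N.+1]/(index_iota 0 N.+1) big_mkord.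
under [RHS]eq_bigr do rewrite big_enum big_sumType /=.
rewrite big_split /= -addrA; congr (_ + _).
  apply: eq_bigr => j _; apply: eq_bigr => i _; rewrite !spin_pot spinM; congr sgn.
rewrite big_ord_recr /=; congr (_ + _).
  apply: eq_bigr => j _; apply: eq_bigr => t _.
  by rewrite !spin_pot spinM.
apply: eq_bigr => t _; rewrite spin_pot -[X in _ * X]/(spin R true).
rewrite -(pot_out sigma (top (strip_of T N) t)) //.
by rewrite spinM.
Qed.

Lemma boltzmann_plus beta sigma : boltzmann beta (fun=> true) sigma =
  \prod_(e <- edges T N) expR (beta * sgn (cross (pot sigma) e)).
Proof.
by rewrite /boltzmann hamiltonian_plus mulrNN mulr_sumr expR_sum.
Qed.

(** Above circle N the sequence is empty, so that its monomial is 1, the spin of the plus boundary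
    condition. *)
Definition vertex_seq j (i : 'I_(len T j)) : seq (vertex_upto T N) :=
  match @idP (j < N.+1)%N with
  | ReflectT hj => [:: existT (fun j : 'I_N.+1 => 'I_(len T j)) (Ordinal hj) i]
  | ReflectF _ => [::]
  end.

Lemma monomial_vertex sigma j (i : 'I_(len T j)) :
  monomial R (vertex_seq i) sigma = spin R (pot sigma i).
Proof.
rewrite /monomial /vertex_seq /pot /extend /=; case: {-}_ / idP => hj.
  by rewrite big_seq1.
by rewrite big_nil.
Qed.

Definition ends (e : edge T) : seq (vertex_upto T N) :=
  match e with
  | existT j (inl i) => vertex_seq i ++ vertex_seq (ordS i)
  | existT j (inr t) => vertex_seq (bot (strip_of T j) t) ++ vertex_seq (top (strip_of T j) t)
  end.

Lemma monomial_ends sigma e : monomial R (ends e) sigma = sgn (cross (pot sigma) e).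
Proof. by case: e => j [i|t] /=; rewrite monomial_cat !monomial_vertex spinM. Qed.

Definition flip (phi : potential T) sigma : config :=
  [ffun v => sigma v (+) phi (val (tag v)) (tagged v)].

Lemma flipK phi : involutive (flip phi).
Proof. by move=> sigma; apply/ffunP => v; rewrite !ffunE -addbA addbb addbF. Qed.

Lemma pot_flip phi sigma j (i : 'I_(len T j)) :
    (forall j i, (N < j)%N -> phi j i = false) ->
  pot (flip phi sigma) i = pot sigma i (+) phi j i.
Proof.
move=> phiN; have [Nj|jN] := ltnP N j; first by rewrite !pot_out // phiN.
by rewrite !(@pot_in _ j (jN : (j < N.+1)%N)) ffunE.
Qed.

Lemma cross_flip phi sigma e : (forall j i, (N < j)%N -> phi j i = false) ->
  cross (pot (flip phi sigma)) e = cross (pot sigma) e (+) cross phi e.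
Proof.
move=> phiN; by case: e => j [i|t] /=; rewrite !(pot_flip _ _ phiN) addbACA.
Qed.

End Energy.

Section SeriesBounds.
Variable R : realType.

Lemma le_bigsum (I : eqType) (r : seq I) (F : I -> R) x :
  (forall i, 0 <= F i) -> x \in r -> F x <= \sum_(i <- r) F i.
Proof.
move=> F0; elim: r => // y r IH; rewrite inE big_cons => /predU1P[->|/IH h].
  by rewrite lerDl sumr_ge0.
by apply: le_trans h _; rewrite lerDr.
Qed.

Lemma sum_quarter m n : \sum_(m <= k < n) (1 / 4 : R) ^+ k <= 4 / 3 * (1 / 4) ^+ m.
Proof.
have [nm|mn] := leqP n m; first by rewrite big_geq // mulr_ge0 ?exprn_ge0 //; lra.
have -> : \sum_(m <= k < n) (1 / 4 : R) ^+ k = 4 / 3 * ((1 / 4) ^+ m - (1 / 4) ^+ n).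
  rewrite (eq_big_nat _ _ (F2 := fun k => 4 / 3 * (- (1 / 4) ^+ k.+1 - - (1 / 4 : R) ^+ k))).
    by rewrite -mulr_sumr telescope_sumr 1?ltnW // addrC opprK.
  by move=> k _; rewrite exprS; field.
by apply: ler_wpM2l; [lra|rewrite lerBlDr lerDl exprn_ge0 //; lra].
Qed.

Lemma sum_inv_sq m n : (1 < m)%N -> \sum_(m <= k < n) (k%:R ^+ 2)^-1 <= (m.-1%:R)^-1 :> R.
Proof.
move=> m1; have [nm|mn] := leqP n m; first by rewrite big_geq // invr_ge0.
apply: (@le_trans _ _ (\sum_(m <= k < n) (- (k.+1.-1%:R)^-1 - - (k.-1%:R)^-1))); last first.
  rewrite (telescope_sumr (fun k => - (k.-1%:R)^-1)) 1?ltnW // opprK addrC lerBlDr lerDl.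
  by rewrite invr_ge0.
rewrite !big_nat; apply: ler_sum => k /andP[mk _].
have k1 : (1 < k)%N by exact: leq_trans mk.
case: k k1 {mk} => [|[|k]] // _.
rewrite /= opprK addrC.
have k0 : 0 <= k%:R :> R by [].
have -> : (k.+1%:R)^-1 - (k.+2%:R)^-1 = (k.+1%:R * k.+2%:R)^-1 :> R.
  by rewrite -(natr1 k.+1) -(natr1 k); field; rewrite !gt_eqF //; lra.
rewrite lef_pV2 ?posrE ?mulr_gt0 ?exprn_gt0 // expr2 ler_pM2r //.
by rewrite ler_nat.
Qed.

End SeriesBounds.

(** * The Peierls sum for the wired weight *)

Section Peierls.
Variables (R : realType) (T : labelled None) (beta : R) (M : nat).
Hypothesis q_small : 36 * expR (- (2 * beta)) <= 1 / 4.
Hypothesis M7 : (7 <= M)%N.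
Hypothesis good : forall h, (M <= h)%N -> robust_height T h.
Variable N : nat.
Local Notation config := {ffun vertex_upto T N -> bool}.
Implicit Type sigma : config.

Let q : R := expR (- (2 * beta)).
Let q0 : 0 < q. Proof. exact: expR_gt0. Qed.

Definition internal (e : edge T) : bool := (tag e < M)%N.

(* Infinite coupling on the internal edges, where the weight is the factor
   1 + sigma_v sigma_v' of the wired measure. *)
Definition edge_weight (e : edge T) (b : bool) : R :=
  if internal e then (if b then 0 else 2) else expR (beta * sgn R b).

Definition wired_weight sigma : R := \prod_(e <- edges T N) edge_weight e (cross (pot sigma) e).

Lemma edge_weight_ge0 e b : 0 <= edge_weight e b.
Proof. by rewrite /edge_weight; case: ifP; case: b => //; rewrite expR_ge0. Qed.

Lemma wired_weight_ge0 sigma : 0 <= wired_weight sigma.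
Proof. by rewrite prodr_ge0 // => e _; exact: edge_weight_ge0. Qed.

Lemma wired_internal sigma e : wired_weight sigma != 0 -> e \in edges T N ->
  internal e -> ~~ cross (pot sigma) e.
Proof.
rewrite /wired_weight prodf_seq_neq0 => /allP H /H /= h Ie; move: h.
by rewrite /edge_weight Ie; case: (cross _ _) => //; rewrite eqxx.
Qed.

Lemma contour_cross_edges h s phi : is_contour N h s phi ->
  {subset spine T h :: s <= edges T N}.
Proof.
move=> [_ s2 s3 _ _] e; rewrite -s2 mem_edges leqNgt; apply: contraTN.
by case: e => j [i|t] /= jN; rewrite !s3 //; exact: ltnW.
Qed.

(** Flipping the vertices inside the contour removes its disagreements and changes no other edge. If
    the weight is nonzero, no contour edge is internal, and each contributes exactly q. *)
Lemma flip_weight h s phi sigma : is_contour N h s phi ->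
    {subset spine T h :: s <= cross (pot sigma)} ->
  wired_weight sigma <= q ^+ size (undup (spine T h :: s)) * wired_weight (flip phi sigma).
Proof.
move=> ct sub; set S := undup _.
have [_ s2 s3 _ _] := ct.
have SE e : (e \in S) = cross phi e by rewrite mem_undup s2.
have [->|W0] := eqVneq (wired_weight sigma) 0.
  by rewrite mulr_ge0 ?exprn_ge0 ?(ltW q0) ?wired_weight_ge0.
rewrite le_eqVlt; apply/orP; left; apply/eqP.
have -> : q ^+ size S = \prod_(e <- edges T N) (if e \in S then q else 1).
  rewrite -big_mkcond big_const_seq iter_mulr_1; congr (_ ^+ _).
  rewrite -size_filter; apply/perm_size/uniq_perm.
  - exact: undup_uniq.
  - by rewrite filter_uniq // uniq_edges.
  move=> e; rewrite mem_filter; apply/idP/andP => [eS|[]//]; split=> //.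
  by apply: contour_cross_edges ct _ _; rewrite // -mem_undup.
rewrite /wired_weight -big_split /=; apply: eq_big_seq => e eE.
rewrite (cross_flip _ _ s3) -SE; case: ifP => eS; last by rewrite mul1r addbF.
have ce : cross (pot sigma) e by apply: sub; rewrite -mem_undup.
have := wired_internal W0 eE; rewrite ce /edge_weight.
case: ifP => [_ /(_ isT) //|_ _ /=].
by rewrite /sgn /q -expRD; congr expR; ring.
Qed.

Let contour_at h (s : seq (edge T)) := exists phi, is_contour N h s phi.

Let event h (s : seq (edge T)) sigma : bool :=
  `[< contour_at h s >] && all (cross (pot sigma)) (spine T h :: s).

(** The indicator [phi] is chosen from the walk alone, so a single involution serves all
    configurations of the event and the flipped weights sum to at most the full sum. *)
Lemma contour_weight h s :
  \sum_(sigma | event h s sigma) wired_weight sigma <=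
  q ^+ size (undup (spine T h :: s)) * \sum_sigma wired_weight sigma.
Proof.
have [/asboolP[phi ct]|no] := boolP `[< contour_at h s >]; last first.
  rewrite big_pred0; last by move=> sigma; rewrite /event (negPf no).
  by rewrite mulr_ge0 ?exprn_ge0 ?(ltW q0) ?sumr_ge0 // => sigma _; exact: wired_weight_ge0.
rewrite [X in _ * X](reindex_inj (can_inj (flipK phi))) /= mulr_sumr.
apply: (@le_trans _ _ (\sum_(sigma | event h s sigma)
    q ^+ size (undup (spine T h :: s)) * wired_weight (flip phi sigma))).
  apply: ler_sum => sigma /andP[_ /allP sub]; exact: flip_weight.
rewrite [leRHS](bigID (event h s)) /= lerDl sumr_ge0 // => sigma _.
by rewrite mulr_ge0 ?exprn_ge0 ?(ltW q0) ?wired_weight_ge0.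
Qed.

Lemma peierls : \sum_(sigma | ~~ pot sigma (base T 0)) wired_weight sigma <=
  1 / 4 * \sum_sigma wired_weight sigma.
Proof.
set Z := \sum_sigma _.
have Z0 : 0 <= Z by rewrite sumr_ge0 // => sigma _; exact: wired_weight_ge0.
pose Nm := size (edges T N).
pose term h n s sigma : R := ((size (undup (spine T h :: s)) == n) && event h s sigma)%:R *
  wired_weight sigma.
have term0 h n s sigma : 0 <= term h n s sigma by rewrite mulr_ge0 ?wired_weight_ge0.
apply: (@le_trans _ _ (\sum_sigma \sum_(h <- index_iota M N.+1)
    \sum_(n <- index_iota (radius h).+1 Nm.+1) \sum_(s <- walks (2 * n.-1) (spine T h))
      term h n s sigma)).
  rewrite [leLHS]big_mkcond; apply: ler_sum => sigma _; case: ifP => [root|_]; last first.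
    by do 3!(apply: sumr_ge0 => ? _); exact: term0.
  have [->|W0] := eqVneq (wired_weight sigma) 0.
    by do 3!(apply: sumr_ge0 => ? _); exact: term0.
  have [||h [s [phi [hN ct sub]]]] := @contour_exists T N (pot sigma).
  - by move=> j i; exact: pot_out.
  - exact: negbTE.
  have spN : spine T h \in edges T N by apply: contour_cross_edges ct _ _; rewrite // mem_head.
  (* A configuration of nonzero weight has no disagreement on internal edges, so the contour starts
     at height at least M, where [contour_long] applies. *)
  have Mh : (M <= h)%N.
    rewrite leqNgt; apply/negP => hM.
    have := wired_internal W0 spN; rewrite /internal hM => /(_ isT).
    by move=> /negP; apply; exact: (sub (spine T h) (mem_head _ _)).
  have h0 : (0 < h)%N by apply: leq_trans Mh; exact: leq_trans M7.
  have long := contour_long h0 (good Mh) ct.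
  set n := size (undup (spine T h :: s)) in long *.
  have nNm : (n <= Nm)%N.
    apply: uniq_leq_size; first exact: undup_uniq.
    by move=> e; rewrite mem_undup; exact: (contour_cross_edges ct).
  have ev : event h s sigma.
    by apply/andP; split; [apply/asboolP; exists phi|apply/allP].
  have sw : s \in walks (2 * n.-1) (spine T h).
    by have [s1 _ _ _ s5] := ct; exact: mem_walks.
  apply: (@le_trans _ _ (term h n s sigma)); first by rewrite /term eqxx ev mul1r.
  pose F1 h n := \sum_(s <- walks (2 * n.-1) (spine T h)) term h n s sigma.
  pose F2 h := \sum_(n <- index_iota (radius h).+1 Nm.+1) F1 h n.
  have F1_ge0 h' n' : 0 <= F1 h' n' by rewrite sumr_ge0.
  have F2_ge0 h' : 0 <= F2 h' by rewrite sumr_ge0.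
  have nr : n \in index_iota (radius h).+1 Nm.+1 by rewrite mem_index_iota long ltnS.
  have hr : h \in index_iota M N.+1 by rewrite mem_index_iota Mh ltnS.
  apply: le_trans (le_bigsum F2_ge0 hr).
  apply: le_trans (le_bigsum (F1_ge0 h) nr).
  exact: (le_bigsum (fun s => term0 h n s sigma) sw).
rewrite exchange_big /=.
apply: (@le_trans _ _ (\sum_(M <= h < N.+1) (4 / 3 * (h%:R ^+ 2)^-1) * Z)).
  rewrite !big_nat; apply: ler_sum => h /andP[Mh _]; rewrite exchange_big /=.
  apply: (@le_trans _ _ (\sum_((radius h).+1 <= n < Nm.+1) ((1 / 4) ^+ n * Z))).
    rewrite !big_nat; apply: ler_sum => n /andP[gn _]; rewrite exchange_big /=.
    apply: (@le_trans _ _ (\sum_(s <- walks (2 * n.-1) (spine T h)) q ^+ n * Z)).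
      apply: ler_sum => s _; rewrite /term; have [<-|_] := eqVneq _ n; last first.
        rewrite big1 => [|sigma _]; last by rewrite mul0r.
        by rewrite mulr_ge0 ?exprn_ge0 ?(ltW q0).
      apply: le_trans (contour_weight h s); rewrite [leRHS]big_mkcond.
      by apply: ler_sum => sigma _; case: ifP => _; rewrite ?mul1r ?mul0r.
    rewrite big_const_seq count_predT iter_addr_0 -[_ *+ size _]mulr_natl mulrA.
    apply: ler_wpM2r => //.
    apply: (@le_trans _ _ ((36 * q) ^+ n)); last first.
      by apply: lerXn2r; rewrite ?nnegrE ?mulr_ge0 ?(ltW q0).
    (* The number of walks is at most 6^(2 (n - 1)) <= 36^n. *)
    rewrite exprMn; apply: ler_wpM2r; first by rewrite exprn_ge0 ?(ltW q0).
    rewrite -natrX ler_nat; apply: leq_trans (size_walks _ _) _.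
    by rewrite expnM leq_exp2l // leq_pred.
  rewrite -mulr_suml; apply: ler_wpM2r => //.
  (* Since h < 2^(g+1) with g = [radius h], the leading term (1/4)^(g+1) is at most h^-2. *)
  apply: le_trans (sum_quarter R _ _) _; apply: ler_wpM2l; first lra.
  have h0 : (0 < h)%N by apply: leq_trans Mh; exact: leq_trans M7.
  rewrite div1r exprVn lef_pV2 ?posrE ?exprn_gt0 ?ltr0n //.
  have := trunc_log_ltn h (isT : (1 < 2)%N); rewrite -/(radius h) => hlt.
  rewrite (_ : 4 = 2 ^+ 2 :> R); last by ring.
  rewrite exprAC; apply: lerXn2r; rewrite ?nnegrE ?exprn_ge0 //.
  by rewrite -natrX ler_nat ltnW.
rewrite -mulr_suml -mulr_sumr; apply: ler_wpM2r => //.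
(* From M >= 7 the tail is at most 1/6, and 4/3 times 1/6 is below 1/4. *)
have := sum_inv_sq R N.+1 (leq_trans (isT : 1 < 7)%N M7).
have : (M.-1%:R)^-1 <= 6^-1 :> R.
  have m6 : 6 <= M.-1%:R :> R by rewrite ler_nat; case: (M) M7.
  by rewrite lef_pV2 ?posrE //; lra.
lra.
Qed.

End Peierls.

Lemma half_le_of_quarter (R : realType) (x y w : R) :
  y <= 1 / 4 * w -> x + 2 * y = w -> w / 2 <= x.
Proof. by move=> *; lra. Qed.

Lemma pow_cancel (R : realType) (x y w : R) k : y != 0 ->
  (x / y) ^+ k / 2 * (y ^+ k * w) = x ^+ k * (w / 2).
Proof. by move=> y0; rewrite expr_div_n; field; rewrite expf_neq0. Qed.

(** * Magnetization of the root, uniformly in N *)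

Section Magnetization.
Variables (R : realType) (T : labelled None) (beta : R) (M : nat).
Hypothesis beta0 : 0 < beta.
Hypothesis q_small : 36 * expR (- (2 * beta)) <= 1 / 4.
Hypothesis M7 : (7 <= M)%N.
Hypothesis good : forall h, (M <= h)%N -> robust_height T h.

(** c and d are cosh beta and sinh beta: exp(beta s) = c + d s for a sign s, the form required by
    the correlation inequalities. *)
Let c : R := (expR beta + expR (- beta)) / 2.
Let d : R := (expR beta - expR (- beta)) / 2.

Let d0 : 0 < d.
Proof. by rewrite divr_gt0 // subr_gt0 ltr_expR gtrN. Qed.

Let dc : d <= c.
Proof. by rewrite /d /c; have := expR_ge0 (- beta); lra. Qed.

Let c0 : 0 < c. Proof. exact: lt_le_trans dc. Qed.

Lemma partition_gt0 N (bc : boundary T N -> bool) : 0 < \sum_sigma boltzmann beta bc sigma.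
Proof.
rewrite (bigD1 [ffun => true]) //=; apply: ltr_wpDr; last exact: expR_gt0.
by apply: sumr_ge0 => sigma _; exact: expR_ge0.
Qed.

Let magnetization N : R := \sum_sigma finite_gibbs beta (fun _ : boundary T N => true) sigma *
  spin R (pot sigma (base T 0)).

Lemma magnetization_lower N : (d / c) ^+ size (edges T M) / 2 <= magnetization N.
Proof.
set k := count (@internal T M) (edges T N).
have fullE (sigma : {ffun vertex_upto T N -> bool}) :
    \prod_(e <- edges T N) (c + d * monomial R (ends N e) sigma) =
    boltzmann beta (fun=> true) sigma.
  rewrite boltzmann_plus; apply: eq_bigr => e _; rewrite monomial_ends /sgn.
  by case: ifP => _; rewrite ?mulr1 ?mulrN1 /c /d; lra.
have wiredE (sigma : {ffun vertex_upto T N -> bool}) :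
    \prod_(e <- edges T N) (if internal M e then 1 + monomial R (ends N e) sigma
      else c + d * monomial R (ends N e) sigma) = wired_weight beta M sigma.
  apply: eq_bigr => e _; rewrite monomial_ends /edge_weight /sgn; case: ifP => _.
    by case: ifP => _; rewrite ?subrr.
  by case: ifP => _; rewrite ?mulr1 ?mulrN1 /c /d; lra.
set Z := \sum_sigma boltzmann beta (fun _ : boundary T N => true) sigma.
set W := \sum_(sigma : {ffun vertex_upto T N -> bool}) wired_weight beta M sigma.
have Z0 : 0 < Z by exact: partition_gt0.
have ZW : Z <= c ^+ k * W.
  have H := wired_upper (@ends T N) (@internal T M) (ltW d0) dc (edges T N)
    (@ferro1 R (vertex_upto T N)).
  apply: (etrans _ H); congr (_ <= _ * _); apply: eq_bigr => sigma _; rewrite mul1r.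
    by rewrite fullE.
  by rewrite wiredE.
set A := \sum_sigma boltzmann beta (fun _ : boundary T N => true) sigma *
  spin R (pot sigma (base T 0)).
have AW : d ^+ k * \sum_(sigma : {ffun vertex_upto T N -> bool})
    wired_weight beta M sigma * spin R (pot sigma (base T 0)) <= A.
  have H := wired_lower (@ends T N) (@internal T M) (ltW d0) dc (vertex_seq N (base T 0))
    (edges T N) (@ferro1 R (vertex_upto T N)).
  apply: (etrans _ H); congr (_ * _ <= _); apply: eq_bigr => sigma _; rewrite mul1r.
    by rewrite wiredE monomial_vertex mulrC.
  by rewrite fullE monomial_vertex mulrC.
(* The signed sum is W minus twice the weight of a minus root, which [peierls] bounds by W / 4. *)
have WW : W / 2 <= \sum_(sigma : {ffun vertex_upto T N -> bool})
    wired_weight beta M sigma * spin R (pot sigma (base T 0)).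
  have P := peierls q_small M7 good N; rewrite -/W in P.
  have E : \sum_(sigma : {ffun vertex_upto T N -> bool})
      wired_weight beta M sigma * spin R (pot sigma (base T 0)) +
     2 * \sum_(sigma : {ffun vertex_upto T N -> bool} | ~~ pot sigma (base T 0))
       wired_weight beta M sigma = W.
    rewrite [X in _ + 2 * X]big_mkcond mulr_sumr -big_split; apply: eq_bigr => sigma _ /=.
    by case: (pot _ _) => /=; rewrite /spin; ring.
  exact: half_le_of_quarter P E.
have W0 : 0 <= W by apply: sumr_ge0 => sigma _; exact: wired_weight_ge0.
have dk : 0 <= d ^+ k by rewrite exprn_ge0 // ltW.
have ck : 0 < c ^+ k by rewrite exprn_gt0.
have -> : magnetization N = A / Z.
  by rewrite /magnetization /finite_gibbs mulr_suml; apply: eq_bigr => sigma _; rewrite mulrAC.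
rewrite ler_pdivlMr //.
(* All internal edges lie in [edges T M], so the exponent is bounded independently of N. *)
have kM : (k <= size (edges T M))%N.
  rewrite /k -size_filter; apply: uniq_leq_size; first by rewrite filter_uniq // uniq_edges.
  by move=> e; rewrite mem_filter !mem_edges => /andP[/ltnW].
have r01 : 0 <= d / c <= 1 by rewrite divr_ge0 ?(ltW d0) ?(ltW c0) //= ler_pdivrMr // mul1r.
have rk : (d / c) ^+ size (edges T M) <= (d / c) ^+ k.
  by case/andP: r01 => r0 r1; apply: ler_wiXn2l.
apply: (@le_trans _ _ ((d / c) ^+ k / 2 * (c ^+ k * W))).
  apply: ler_pM; rewrite ?(ltW Z0) ?divr_ge0 ?exprn_ge0 //; first by case/andP: r01.
  by rewrite ler_wpM2r // invr_ge0.
have -> : (d / c) ^+ k / 2 * (c ^+ k * W) = d ^+ k * (W / 2).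
  by apply: pow_cancel; rewrite gt_eqF.
by apply: le_trans AW; apply: ler_wpM2l.
Qed.

Lemma magnetization_pos : exists2 delta : R, 0 < delta & forall N, delta <= magnetization N.
Proof.
exists ((d / c) ^+ size (edges T M) / 2); last exact: magnetization_lower.
by rewrite divr_gt0 // exprn_gt0 // divr_gt0.
Qed.

End Magnetization.

(** * Weak limits of laws on a countable product of bits *)

Local Close Scope ring_scope.
Local Open Scope classical_set_scope.
Local Open Scope ring_scope.

Section PointwiseTopology.
Variables (I : countType) (V : topologicalType).

Lemma ptws_nbhs (x : {ptws I -> V}) (A : I -> set V) m :
  (forall i, nbhs (x i) (A i)) ->
  nbhs x [set g : {ptws I -> V} | forall i, (pickle i < m)%N -> A i (g i)].
Proof.
move=> Ax; elim: m => [|m IH].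
  by apply: filterS filterT => g _ i.
case E : (@pickle_inv I m) => [i|]; last first.
  apply: filterS IH => g H i; rewrite ltnS leq_eqVlt => /orP[/eqP im|/H //].
  by move: E; rewrite -im pickleK_inv.
have im : pickle i = m by have := @pickle_invK I m; rewrite /ocancel /oapp E.
have : nbhs x ((fun g : {ptws I -> V} => g i) @^-1` A i).
  exact: (@proj_continuous I (fun=> V) i x _ (Ax i)).
move=> h; apply: filterS (filterI IH h) => g [H1 H2] j.
rewrite ltnS leq_eqVlt => /orP[/eqP jm|/H1 //].
suff -> : j = i by [].
by apply: (pcan_inj pickleK); rewrite jm im.
Qed.

Lemma ptws_cvg (J : Type) (F : set_system J) (FF : Filter F)
    (y : J -> {ptws I -> V}) (x : {ptws I -> V}) :
  (forall i, y j i @[j --> F] --> x i) -> y @ F --> x.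
Proof.
move=> H; apply/cvg_sup => i A /= [B [[C oC <-] /= Cx] BA].
apply: filterS BA _; apply: (H i).
exact: open_nbhs_nbhs.
Qed.

(** Tychonoff's theorem in the form needed for diagonal extraction: some term of index at least m is
    close to x on the first m coordinates. *)
Lemma ptws_cluster (y : nat -> {ptws I -> V}) (K : I -> set V) :
  (forall i, compact (K i)) -> (forall n i, K i (y n i)) ->
  exists x : {ptws I -> V}, (forall i, K i (x i)) /\
    forall (A : I -> set V) m, (forall i, nbhs (x i) (A i)) ->
      exists2 n, (m <= n)%N & forall i, (pickle i < m)%N -> A i (y n i).
Proof.
move=> cK yK; have := @tychonoff I (fun=> V) K cK.
have PF : ProperFilter (y @ \oo) by exact: fmap_proper_filter.
move=> /(_ _ PF)[|x [Kx cl]]; first by exists 0%N => // n _ i; exact: yK.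
exists x; split=> // A m Ax.
have := cl [set g | exists2 n, (m <= n)%N & g = y n] _ _ (ptws_nbhs m Ax).
case=> [|g [[n mn ->] H]]; first by exists m => // n /= mn; exists n.
by exists n.
Qed.

End PointwiseTopology.

Section UniformContinuity.
Variables (R : realType) (I : countType).

(** By compactness: pairs violating the bound but agreeing on ever longer prefixes would, along [k],
    have both components converge to the same point. *)
Lemma unif_continuous (f : {ptws I -> bool} -> R) : continuous f -> forall eps, 0 < eps ->
  exists m, forall x y : I -> bool, (forall i, (pickle i < m)%N -> x i = y i) ->
    `|f x - f y| <= eps.
Proof.
move=> cf eps e0; apply: contrapT => no.
have ex m : exists xy : (I -> bool) * (I -> bool),
    (forall i, (pickle i < m)%N -> xy.1 i = xy.2 i) /\ eps < `|f xy.1 - f xy.2|.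
  apply: contrapT => H; apply: no; exists m => x y xy; rewrite leNgt; apply/negP => lt.
  by apply: H; exists (x, y).
have [xy xyP] := choice ex.
have [z [_ zP]] := @ptws_cluster I bool (fun n => (xy n).1) (fun=> setT)
  (fun=> bool_compact) (fun _ _ => Logic.I).
have nz i : nbhs (z i) [set b | b = z i] by exact: discrete_set1.
have [k kP] := choice (fun m => let: ex_intro2 n h1 h2 := zP _ m nz in ex_intro _ n (conj h1 h2)).
have c1 : (fun m => (xy (k m)).1 : {ptws I -> bool}) @ \oo --> z.
  apply: ptws_cvg => i; apply: cvg_near_cst; exists (pickle i).+1 => // m /= im.
  by have [_ ->] := kP m.
have c2 : (fun m => (xy (k m)).2 : {ptws I -> bool}) @ \oo --> z.
  apply: ptws_cvg => i; apply: cvg_near_cst; exists (pickle i).+1 => // m /= im.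
  have [mk e] := kP m; have [e2 _] := xyP (k m).
  by rewrite -e2 ?e // (leq_trans im).
have : (fun m => f (xy (k m)).1 - f (xy (k m)).2) @ \oo --> f z - f z.
  by apply: cvgB; [apply: (cvg_comp _ _ c1)|apply: (cvg_comp _ _ c2)]; exact: cf.
rewrite subrr => /cvgr0_norm_lt /(_ eps e0)[m _ /(_ m (leqnn m)) /=].
by have [_ /ltW] := xyP (k m); rewrite leNgt => /negP.
Qed.

End UniformContinuity.

Section Prefixes.
Variable I : countType.

Definition bits (w : I -> bool) n : bool := if pickle_inv n is Some i then w i else false.
Definition prefix m w : seq bool := mkseq (bits w) m.
Definition unbits (p : seq bool) : I -> bool := fun i => nth false p (pickle i).

Lemma size_prefix m w : size (prefix m w) = m. Proof. exact: size_mkseq. Qed.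

Lemma prefixS m w : prefix m.+1 w = rcons (prefix m w) (bits w m).
Proof. exact: mkseqS. Qed.

Lemma unbits_prefix m w i : (pickle i < m)%N -> unbits (prefix m w) i = w i.
Proof. by move=> im; rewrite /unbits nth_mkseq // /bits pickleK_inv. Qed.

End Prefixes.

(* The prefix probabilities of a random sequence of bits, where the bits that
   are not in the range of [pickle] vanish. *)
Definition prefix_law (R : realType) (I : countType) (Q : seq bool -> R) :=
  [/\ Q [::] = 1, forall p, 0 <= Q p,
      forall p, Q p = Q (rcons p false) + Q (rcons p true)
    & forall p, @pickle_inv I (size p) = None -> Q (rcons p true) = 0].

Section Subsequence.
Variables (R : realType) (I : countType) (C : nat -> finType).
Variables (w : forall N, C N -> R) (x : forall N, C N -> I -> bool).
Hypotheses (w0 : forall N s, 0 <= w (N := N) s) (w1 : forall N, \sum_s w (N := N) s = 1).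

Definition prefix_prob N p : R := \sum_(s : C N | prefix (size p) (x s) == p) w s.

Lemma prefix_prob_law N : prefix_law I (prefix_prob N).
Proof.
split.
- by rewrite -[RHS](w1 N); apply: eq_bigl => s; apply/eqP/size0nil/size_prefix.
- by move=> p; apply: sumr_ge0.
- move=> p; rewrite /prefix_prob !size_rcons (bigID (fun s => bits (x s) (size p))) /= addrC.
  by congr (_ + _); apply: eq_bigl => s; rewrite prefixS eqseq_rcons; case: (bits _ _).
- move=> p pN; rewrite /prefix_prob size_rcons big_pred0 // => s.
  by rewrite prefixS eqseq_rcons /bits pN andbF.
Qed.

Lemma prefix_law_le1 (Q : seq bool -> R) p : prefix_law I Q -> Q p <= 1.
Proof.
move=> [q1 q2 q3 q4]; elim/last_ind: p => [|p b IH]; first by rewrite q1.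
apply: le_trans IH; rewrite [leRHS]q3.
by case: b; [rewrite lerDr|rewrite lerDl].
Qed.

(** The prefix probabilities are points of the compact cube of functions from [seq bool] to [0, 1];
    the identities of [prefix_law] pass to a limit. *)
Lemma prefix_subsequence : exists (u : nat -> nat) (Q : seq bool -> R),
  [/\ {homo u : k l / (k < l)%N}, prefix_law I Q &
      forall p, prefix_prob (u k) p @[k --> \oo] --> Q p].
Proof.
have [||Q [Q01 QP]] := @ptws_cluster (seq bool) R prefix_prob (fun=> `[0, 1]%classic).
- by move=> _; exact: segment_compact.
- move=> N p /=; rewrite in_itv /= prefix_law_le1 ?andbT; last exact: prefix_prob_law.
  by have [_ -> _ _] := prefix_prob_law N.
have ex m : exists n, (m <= n)%N /\ forall p, (pickle p < m)%N ->
    `|Q p - prefix_prob n p| < m.+1%:R^-1.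
  have [|n mn H] := QP (fun p => ball (Q p) m.+1%:R^-1) m.
    by move=> p; apply: nbhsx_ballx; rewrite invr_gt0.
  by exists n; split=> // p /H; rewrite /ball /= /ball_.
have [k kP] := choice ex.
(* The argument of k exceeds the previous index, which forces u to increase strictly, and is at
   least m, which keeps the approximation. *)
pose u := fix u m := if m is m'.+1 then k (maxn m (u m').+1) else k 0%N.
have uS m : (u m < u m.+1)%N.
  by have [h _] := kP (maxn m.+1 (u m).+1); apply: leq_trans h; exact: leq_maxr.
have uk m : exists2 l, (m <= l)%N & u m = k l.
  by case: m => [|m]; [exists 0%N|exists (maxn m.+1 (u m).+1); rewrite ?leq_maxl].
have cv p : prefix_prob (u m) p @[m --> \oo] --> Q p.
  apply/cvgrPdist_lt => eps e0.
  have /(_ _ _ e0)[m0 _ hm0] := (cvgrPdist_lt (fun m => m.+1%:R^-1 : R) 0).1 (@cvg_harmonic R).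
  exists (maxn m0 (pickle p).+1) => // m /=; rewrite geq_max => /andP[m0m pm].
  have [l ml ->] := uk m; have [_ H] := kP l.
  apply: lt_trans (H p (leq_trans pm ml)) _.
  have := hm0 l (leq_trans m0m ml); rewrite /= sub0r normrN ger0_norm //.
exists u, Q; split=> //; first exact: homo_ltn ltn_trans uS.
have lim_eq p (h : nat -> R) : (forall m, h m = prefix_prob (u m) p) -> forall l,
    h @ \oo --> l -> l = Q p.
  move=> e l hl; apply: (cvg_unique _ hl) => //.
  have -> : h = (fun m => prefix_prob (u m) p) by apply: funext.
  exact: cv.
split.
- by apply/esym/(lim_eq _ (fun=> 1)); [move=> m; have [->] := prefix_prob_law (u m)|exact: cvg_cst].
- by move=> p; have := Q01 p; rewrite /= in_itv /= => /andP[].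
- move=> p; apply/esym/(lim_eq _ (fun m =>
    prefix_prob (u m) (rcons p false) + prefix_prob (u m) (rcons p true))).
    by move=> m; have [_ _ <-] := prefix_prob_law (u m).
  exact: cvgD.
- move=> p pN; apply/esym/(lim_eq _ (fun=> 0)); last exact: cvg_cst.
  by move=> m; have [_ _ _ ->] := prefix_prob_law (u m).
Qed.

End Subsequence.

Section UnitLaw.
Variable R : realType.

Definition unit_law := mrestr (@lebesgue_measure R) (@measurable_itv R `[0, 1[).

HB.instance Definition _ :=
  Measure.copy unit_law (mrestr (@lebesgue_measure R) (@measurable_itv R `[0, 1[)).

Let unit_law1 : unit_law setT = 1%E.
Proof.
rewrite /unit_law /mrestr setTI.
by rewrite [LHS]lebesgue_measure_itv /= lte_fin ltr01 sube0.
Qed.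

HB.instance Definition _ := Measure_isProbability.Build _ _ _ unit_law unit_law1.

End UnitLaw.

(** * A measure with given prefix probabilities *)

Section Quantile.
Variables (R : realType) (I : countType) (Q : seq bool -> R).
Hypothesis QP : prefix_law I Q.

Definition cyl_sets : set (set (I -> bool)) :=
  [set B | exists v b, B = [set omega : I -> bool | omega v = b]].
Definition cyl_space := g_sigma_algebraType cyl_sets.

Definition lower p : R :=
  \sum_(k < size p) if nth false p k then Q (rcons (take k p) false) else 0.

Lemma lower_rcons p b : lower (rcons p b) = lower p + (if b then Q (rcons p false) else 0).
Proof.
rewrite /lower size_rcons big_ord_recr /= nth_rcons ltnn eqxx -cats1 take_size_cat //.
congr (_ + _); apply: eq_bigr => k _.
by rewrite nth_cat ltn_ord takel_cat // ltnW.
Qed.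

(* Bits of the inverse of the distribution function of Q for the lexicographic order. *)
Fixpoint digits (y : R) m : seq bool :=
  if m is n.+1
  then rcons (digits y n) (lower (digits y n) + Q (rcons (digits y n) false) <= y)
  else [::].

Lemma size_digits y m : size (digits y m) = m.
Proof. by elim: m => //= m IH; rewrite size_rcons IH. Qed.

(** The intervals [lower p, lower p + Q p) for p of a given length tile [0, 1) in lexicographic
    order, and [digits] selects the one that contains y. *)
Lemma digits_itv y p : 0 <= y < 1 ->
  (digits y (size p) = p) <-> (lower p <= y < lower p + Q p).
Proof.
have [q1 q2 q3 _] := QP; move=> y01.
elim/last_ind: p => [|p b IH]; first by rewrite /lower big_ord0 add0r q1 y01.
have Q0 := q2 (rcons p false); have Q1 := q2 (rcons p true); have Q3 := q3 p.
rewrite size_rcons /= lower_rcons; split.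
  move=> /rcons_inj[e eb]; rewrite e in eb; move/IH: e => /andP[h1 h2].
  by case: b eb => [h3|/negbT]; rewrite -?ltNge; [|move=> h3]; apply/andP; split; lra.
case/andP=> h1 h2.
have /IH -> : lower p <= y < lower p + Q p.
  by apply/andP; case: b h1 h2 => h1 h2; split; lra.
congr rcons; case: b h1 h2 => h1 h2; first by lra.
by apply/negbTE; rewrite -ltNge; lra.
Qed.

Lemma lower_bounds p : 0 <= lower p /\ lower p + Q p <= 1.
Proof.
have [q1 q2 q3 _] := QP; elim/last_ind: p => [|p b [h1 h2]].
  by rewrite /lower big_ord0 q1 add0r.
have Q0 := q2 (rcons p false); have Q1 := q2 (rcons p true); have Q3 := q3 p.
by rewrite lower_rcons; case: b; split; lra.
Qed.

Definition quantile (y : measurableTypeR R) : cyl_space :=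
  fun i : I => nth false (digits y (pickle i).+1) (pickle i).

Lemma prefix_quantile y m : 0 <= y < 1 -> prefix m (quantile y) = digits y m.
Proof.
move=> y01; elim: m => [//|m IH]; rewrite prefixS IH /=; congr rcons.
rewrite /bits; case E : (@pickle_inv I m) => [i|].
  have im : pickle i = m by have := @pickle_invK I m; rewrite /ocancel /oapp E.
  by rewrite /quantile im /= nth_rcons size_digits ltnn eqxx.
have [_ _ q3 q4] := QP; apply/esym/negbTE; rewrite -ltNge.
have := q4 (digits y m); rewrite size_digits => /(_ E) q40.
have [] := digits_itv (digits y m) y01; rewrite size_digits => /(_ erefl)/andP[_ + _].
by rewrite (q3 (digits y m)) q40 addr0.
Qed.

Lemma measurable_digits p :
  measurable ([set y | digits y (size p) = p] : set (measurableTypeR R)).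
Proof.
elim/last_ind: p => [|p b IH].
  by rewrite (_ : [set y | _] = setT) //; apply/seteqP.
rewrite (_ : [set y | _] = [set y | digits y (size p) = p] `&`
    [set y | (lower p + Q (rcons p false) <= y) = b]); last first.
  apply/seteqP; split=> y /=; rewrite size_rcons /=.
    by move=> /rcons_inj[e]; rewrite e.
  by move=> [-> ->].
apply: measurableI => //; case: b.
  rewrite (_ : [set y | _] = `[lower p + Q (rcons p false), +oo[%classic).
    exact: measurable_itv.
  by apply/seteqP; split=> y /=; rewrite in_itv /= andbT.
rewrite (_ : [set y | _] = `]-oo, lower p + Q (rcons p false)[%classic).
  exact: measurable_itv.
by apply/seteqP; split=> y; rewrite /= in_itv /= ltNge; [move=> ->|move=> /negbTE].
Qed.

Lemma measurable_quantile :
  @measurable_fun _ _ (measurableTypeR R) cyl_space setT quantile.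
Proof.
apply: (@measurability _ _ _ _ setT quantile cyl_sets) => // _ [_ [i [b ->]] <-]; rewrite setTI.
set n := pickle i.
rewrite (_ : _ @^-1` _ = \bigcup_(p in [set p : n.+1.-tuple bool | nth false p n = b])
    [set y | digits y n.+1 = p]).
  apply: fin_bigcup_measurable => [|p _]; first exact: finite_finset.
  by have := measurable_digits p; rewrite size_tuple.
apply/seteqP; split=> y.
  by move=> e; exists (Tuple (introT eqP (size_digits y n.+1))).
move=> [p pb e]; have e' : digits y n.+1 = p := e.
by change (nth false (digits y n.+1) n = b); rewrite e'.
Qed.

Lemma quantile_cyl p :
  @unit_law R (quantile @^-1` [set omega | prefix (size p) omega = p]) = (Q p)%:E.
Proof.
have [l0 l1] := lower_bounds p.
have [_ /(_ p) Qp _ _] := QP.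
rewrite /unit_law /mrestr.
have -> : quantile @^-1` [set omega | prefix (size p) omega = p] `&` `[0, 1[ =
    `[lower p, lower p + Q p[%classic.
  apply/seteqP; split=> y /=; rewrite !in_itv /=.
    by move=> [e y01]; apply/digits_itv; rewrite // -prefix_quantile.
  move=> /andP[h1 h2]; have y01 : 0 <= y < 1 by apply/andP; split; lra.
  by split=> //; rewrite prefix_quantile //; apply/digits_itv; rewrite // h1.
rewrite lebesgue_measure_itv /= lte_fin.
case: ltP => h; first by rewrite -EFinB addrC addKr.
by congr EFin; lra.
Qed.

(** The measure is the image of Lebesgue measure on [0, 1) under [quantile]; a cylinder pulls back
    to an interval of length Q p. *)
Lemma prefix_law_measure : exists nu : probability cyl_space R,
  forall p, nu [set omega | prefix (size p) omega = p] = (Q p)%:E.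
Proof.
pose X : {mfun measurableTypeR R >-> cyl_space} := mfun_Sub (mem_set measurable_quantile).
by exists (distribution (@unit_law R) X) => p; exact: quantile_cyl.
Qed.

End Quantile.

Section StepIntegral.
Context d (T : measurableType d) (R : realType) (nu : probability T R).

Lemma bounded_integrable (f : T -> R) (b : R) : measurable_fun setT f ->
  (forall x, `|f x| <= b) -> nu.-integrable setT (EFin \o f).
Proof.
move=> mf fb; apply: measurable_bounded_integrable => //.
  by rewrite (le_lt_trans (probability_le1 nu measurableT)) // ltry.
exists b; split; first exact: num_real.
by move=> y by_ x _; apply: (le_trans (fb x)); exact: ltW.
Qed.

Lemma Rintegral_step (J : Type) (r : seq J) (c : J -> R) (A : J -> set T) :
    (forall j, measurable (A j)) ->
  nu.-integrable setT (EFin \o (fun x => \sum_(j <- r) c j * \1_(A j) x)) /\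
  \int[nu]_x (\sum_(j <- r) c j * \1_(A j) x) = \sum_(j <- r) c j * fine (nu (A j)).
Proof.
move=> mA.
have mf s : measurable_fun setT (fun x => \sum_(j <- s) c j * \1_(A j) x).
  elim: s => [|j s IH].
    by under eq_fun do rewrite big_nil; exact: measurable_cst.
  under eq_fun do rewrite big_cons; apply: measurable_funD => //.
  by apply: measurable_funM; [exact: measurable_cst|exact: measurable_indic].
have i1 j : nu.-integrable setT (EFin \o (\1_(A j) : T -> R)).
  apply: (@bounded_integrable _ 1); first exact: measurable_indic.
  by move=> x; rewrite indicE; case: (_ \in _); rewrite ?normr1 ?normr0.
have int s : nu.-integrable setT (EFin \o (fun x => \sum_(j <- s) c j * \1_(A j) x)).
  apply: (@bounded_integrable _ (\sum_(j <- s) `|c j|)) => // x.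
  apply: le_trans (ler_norm_sum _ _ _) _; apply: ler_sum => j _.
  by rewrite normrM indicE; case: (_ \in _); rewrite ?normr1 ?normr0 ?mulr1 ?mulr0.
split=> //; elim: r => [|j s IH].
  rewrite big_nil; under eq_Rintegral do rewrite big_nil.
  by rewrite Rintegral_cst // mul0r.
rewrite big_cons -IH; under eq_Rintegral do rewrite big_cons.
rewrite RintegralD //; last first.
  have := int [:: j]; congr (integrable _ _ _); apply/funext => x /=.
  by rewrite big_seq1.
congr (_ + _); rewrite RintegralZl //; congr (_ * _).
by rewrite /Rintegral integral_indic // setIT.
Qed.

End StepIntegral.

Section WeakLimit.
Variables (R : realType) (I : countType) (C : nat -> finType).
Variables (w : forall N, C N -> R) (x : forall N, C N -> I -> bool).
Hypotheses (w0 : forall N s, 0 <= w (N := N) s) (w1 : forall N, \sum_s w (N := N) s = 1).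

Definition cyl (p : seq bool) : set (cyl_space I) := [set omega | prefix (size p) omega = p].

Lemma measurable_bits n b : measurable ([set omega | bits omega n = b] : set (cyl_space I)).
Proof.
rewrite /bits; case: (pickle_inv n) => [i|]; first by apply: sub_gen_smallest; exists i, b.
have [<-|nb] := eqVneq false b.
  by rewrite (_ : [set _ | _] = setT) //; apply/seteqP.
rewrite (_ : [set _ | _] = set0); first exact: measurable0.
by apply/seteqP; split=> // omega /= e; rewrite e eqxx in nb.
Qed.

Lemma measurable_cyl p : measurable (cyl p).
Proof.
rewrite /cyl; elim/last_ind: p => [|p b IH].
  by rewrite (_ : [set _ | _] = setT) //; apply/seteqP.
rewrite (_ : [set _ | _] = [set omega : cyl_space I | prefix (size p) omega = p] `&`
    [set omega | bits omega (size p) = b]).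
  by apply: measurableI => //; exact: measurable_bits.
apply/seteqP; split=> omega /=; rewrite size_rcons prefixS.
  by move/rcons_inj => [-> ->].
by move=> [-> ->].
Qed.

Lemma step_prefix m (F : seq bool -> R) (omega : cyl_space I) :
  \sum_(p : m.-tuple bool) F p * \1_(cyl p) omega = F (prefix m omega).
Proof.
pose p0 : m.-tuple bool := Tuple (introT eqP (size_prefix m omega)).
rewrite (bigD1 p0) //= big1 ?addr0 => [|p pp0].
  by rewrite indicE mem_set ?mulr1 // /cyl /= size_prefix.
rewrite indicE memNset ?mulr0 // /cyl /= size_tuple => e.
by move: pp0; rewrite -val_eqE /= e eqxx.
Qed.

Lemma weak_limit : exists (u : nat -> nat) (nu : probability (cyl_space I) R),
  {homo u : k l / (k < l)%N} /\
  forall f : {ptws I -> bool} -> R, continuous f ->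
    \sum_(s : C (u k)) w s * f (x s) @[k --> \oo] --> \int[nu]_omega f omega.
Proof.
have [u [Q [uS QP PQ]]] := prefix_subsequence x w0 w1.
have [nu nuQ] := prefix_law_measure QP.
exists u, nu; split=> // f cf.
(* f is approximated uniformly by its value on the prefix continued by [false]; such step functions
   converge by finitely many prefix probabilities. *)
pose F p := f (unbits p).
have approx eps : 0 < eps -> exists m, forall omega : cyl_space I,
    `|f omega - F (prefix m omega)| <= eps.
  move=> /(unif_continuous cf)[m mP]; exists m => omega; apply: mP => i im.
  by rewrite unbits_prefix.
have sumP N m : \sum_(s : C N) w s * F (prefix m (x s)) =
    \sum_(p : m.-tuple bool) F p * prefix_prob w x N p.
  rewrite (partition_big (fun s => Tuple (introT eqP (size_prefix m (x s)))) predT) //=.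
  apply: eq_bigr => p _; rewrite /prefix_prob mulr_sumr size_tuple.
  rewrite (eq_bigl (fun s => prefix m (x s) == p)); last by move=> s; rewrite -val_eqE.
  by apply: eq_bigr => s /eqP ->; rewrite mulrC.
have step m : nu.-integrable setT (EFin \o (fun omega => F (prefix m omega))) /\
    \int[nu]_omega F (prefix m omega) = \sum_(p : m.-tuple bool) F p * Q p.
  have [] := @Rintegral_step _ _ R nu (m.-tuple bool) (index_enum _) F (fun p => cyl p)
    (fun p => measurable_cyl p).
  rewrite (_ : (fun omega => \sum_(p : m.-tuple bool) F p * \1_(cyl p) omega) =
    fun omega => F (prefix m omega)); last by apply: funext => omega; exact: step_prefix.
  move=> i1 i2; split=> //; rewrite i2; apply: eq_bigr => p _.
  by rewrite /cyl nuQ.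
have mf : measurable_fun setT (f : cyl_space I -> R).
  have ap n : exists m, forall omega : cyl_space I,
      `|f omega - F (prefix m omega)| <= n.+1%:R^-1 by apply: approx; rewrite invr_gt0.
  have [k kP] := choice ap.
  apply: (@measurable_fun_cvg _ (cyl_space I) R setT (fun n omega => F (prefix (k n) omega))).
    by move=> n; have [/measurable_int/measurable_EFinP] := step (k n).
  move=> omega _; apply/cvgrPdist_le => eps e0.
  have /(_ _ _ e0)[n0 _ hn0] := (cvgrPdist_le (fun m => m.+1%:R^-1 : R) 0).1 (@cvg_harmonic R).
  exists n0 => // n /hn0 /=; rewrite sub0r normrN ger0_norm // => h.
  exact: le_trans (kP n omega) h.
have fi : nu.-integrable setT (EFin \o (f : cyl_space I -> R)).
  have [m mP] := approx 1 ltr01.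
  apply: (@bounded_integrable _ _ _ nu _ (\sum_(p : m.-tuple bool) `|F p| + 1)) => // omega.
  rewrite -[f omega](subrK (F (prefix m omega))) addrC.
  apply: le_trans (ler_normD _ _) _; apply: lerD (mP omega).
  rewrite -(@step_prefix m F omega); apply: le_trans (ler_norm_sum _ _ _) _.
  apply: ler_sum => p _; rewrite normrM ler_piMr // indicE.
  by case: (_ \in _); rewrite ?normr1 ?normr0.
apply/cvgrPdist_le => eps e0.
have e3 : 0 < eps / 3 by rewrite divr_gt0.
have [m mP] := approx _ e3.
have [si sE] := step m.
have B1 : `|\int[nu]_omega f omega - \sum_(p : m.-tuple bool) F p * Q p| <= eps / 3.
  rewrite -sE -RintegralB //; apply: le_trans (le_normr_Rintegral _ _) _ => //.
    by have := integrableB measurableT fi si.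
  have -> : eps / 3 = \int[nu]_omega (eps / 3).
    have nu1 : fine (nu setT) = 1 by rewrite probability_setT.
    apply/esym/(etrans (Rintegral_cst nu measurableT _)).
    by rewrite -[RHS]mulr1; congr (_ * _); exact: nu1.
  apply: le_Rintegral => //.
  - have := integrable_abse (integrableB measurableT fi si).
    by congr (integrable _ _ _).
  - apply: (@bounded_integrable _ _ _ nu (fun=> eps / 3) (eps / 3)) => // _.
    by rewrite ger0_norm // ltW.
have B2 k : `|\sum_(s : C (u k)) w s * f (x s) -
    \sum_(p : m.-tuple bool) F p * prefix_prob w x (u k) p| <= eps / 3.
  rewrite -sumP -sumrB; apply: le_trans (ler_norm_sum _ _ _) _.
  apply: (@le_trans _ _ (\sum_(s : C (u k)) w s * (eps / 3))).
    apply: ler_sum => s _; rewrite -mulrBr normrM ger0_norm //.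
    by apply: ler_wpM2l => //; exact: mP.
  by rewrite -mulr_suml w1 mul1r.
have cvS : \sum_(p : m.-tuple bool) F p * prefix_prob w x (u k) p @[k --> \oo] -->
    \sum_(p : m.-tuple bool) F p * Q p.
  apply: cvg_big => [|p _]; first exact: add_continuous.
  by apply: cvgM; [exact: cvg_cst|exact: PQ].
have /cvgrPdist_le/(_ _ e3) := cvS; apply: filterS => k B3.
have -> : \int[nu]_omega f omega - \sum_(s : C (u k)) w s * f (x s) =
  (\int[nu]_omega f omega - \sum_(p : m.-tuple bool) F p * Q p) +
  (\sum_(p : m.-tuple bool) F p * Q p - \sum_(p : m.-tuple bool) F p * prefix_prob w x (u k) p) -
  (\sum_(s : C (u k)) w s * f (x s) -
    \sum_(p : m.-tuple bool) F p * prefix_prob w x (u k) p) by ring.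
apply: le_trans (ler_normB _ _) _; rewrite [leRHS](_ : eps = eps / 3 + eps / 3 + eps / 3).
  by apply: lerD (B2 k); apply: le_trans (ler_normD _ _) _; exact: lerD.
by field.
Qed.

End WeakLimit.

(** * Coexistence *)

Section Coexistence.
Variables (R : realType) (T : labelled None) (beta : R).

Definition root_vertex : vertex T := existT (fun j => 'I_(len T j)) 0%N (base T 0).

Definition root_spin (omega : {ptws vertex T -> bool}) : R := spin R (omega root_vertex).

Lemma continuous_root_spin : continuous root_spin.
Proof.
move=> omega; apply: cvg_near_cst.
have h : nbhs (omega root_vertex) [set b | b = omega root_vertex] by exact: discrete_set1.
have hn : \forall w \near omega, w root_vertex = omega root_vertex.
  exact: (@proj_continuous {j : nat & 'I_(len T j)} (fun=> bool) root_vertex omega _ h).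
by apply: filterS hn => omega' /= e; congr (spin R _).
Qed.

Lemma gibbs_exists (bc : forall N, boundary T N -> bool) :
  exists (u : nat -> nat) (nu : probability (spins T) R),
    {homo u : k l / (k < l)%N} /\
    forall f : {ptws vertex T -> bool} -> R, continuous f ->
      (fun k => \sum_(sigma : {ffun vertex_upto T (u k) -> bool})
         finite_gibbs beta (bc (u k)) sigma * f (extend sigma)) @ \oo -->
      (\int[nu]_omega f omega).
Proof.
apply: (@weak_limit R {j : nat & 'I_(len T j)} (fun N => {ffun vertex_upto T N -> bool})
  (fun N => finite_gibbs beta (bc N)) (fun N sigma => extend sigma)).
- move=> N s; rewrite divr_ge0 ?expR_ge0 // sumr_ge0 // => ? _; exact: expR_ge0.
- move=> N; rewrite -mulr_suml divff // gt_eqF //; exact: partition_gt0.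
Qed.

Definition all_true : potential T := fun _ _ => true.

(** [pot_flip] covers flips that vanish above N. A global flip also reverses the boundary condition,
    so it is followed on [spin_at]. *)
Lemma spin_at_flip N sigma j (hj : (j < N.+1)%N) i :
  spin_at R (flip all_true sigma) hj i = - spin_at R sigma hj i.
Proof. by rewrite /spin_at ffunE /= addbT /spin; case: (sigma _); rewrite ?opprK. Qed.

Lemma hamiltonian_flip N (sigma : {ffun vertex_upto T N -> bool}) :
  hamiltonian R (fun=> false) (flip all_true sigma) = hamiltonian R (fun=> true) sigma.
Proof.
rewrite /hamiltonian; congr (- (_ + _) - _).
- by apply: eq_bigr => j _; apply: eq_bigr => i _; rewrite !spin_at_flip mulrNN.
- by apply: eq_bigr => j _; apply: eq_bigr => i _; rewrite !spin_at_flip mulrNN.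
- by apply: eq_bigr => i _; rewrite !spin_at_flip mulrNN.
Qed.

Lemma magnetization_minus N :
  \sum_(sigma : {ffun vertex_upto T N -> bool})
     finite_gibbs beta (fun=> false) sigma * root_spin (extend sigma) =
  - \sum_(sigma : {ffun vertex_upto T N -> bool})
     finite_gibbs beta (fun=> true) sigma * root_spin (extend sigma).
Proof.
have bE (sigma : {ffun vertex_upto T N -> bool}) :
    boltzmann beta (fun=> false) (flip all_true sigma) = boltzmann beta (fun=> true) sigma.
  by rewrite /boltzmann hamiltonian_flip.
rewrite (reindex_inj (can_inj (flipK all_true))) -sumrN; apply: eq_bigr => sigma _.
have -> : root_spin (extend (flip all_true sigma)) = - root_spin (extend sigma).
  have := spin_at_flip sigma (ltn0Sn N) (base T 0).
  by rewrite !spin_pot.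
rewrite mulrN /finite_gibbs bE; congr (- (_ / _ * _)).
rewrite (reindex_inj (can_inj (flipK all_true))).
by apply: eq_bigr => tau _; exact: bE.
Qed.

(** The root spin is continuous, so its integral is at least delta for the plus limit and at most
    -delta for the minus limit. Measures agreeing on all measurable sets would give equal
    integrals. *)
Lemma two_gibbs_of_magnetization (delta : R) : 0 < delta ->
    (forall N, delta <= \sum_(sigma : {ffun vertex_upto T N -> bool})
       finite_gibbs beta (fun=> true) sigma * root_spin (extend sigma)) ->
  two_gibbs T beta.
Proof.
move=> d0 dP.
have [u [nu1 [u1 c1]]] := gibbs_exists (fun _ _ => true).
have [v [nu2 [v1 c2]]] := gibbs_exists (fun _ _ => false).
exists nu1, nu2; split; [by exists u, (fun _ _ => true)|by exists v, (fun _ _ => false)|].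
apply: contrapT => no.
have eqI : \int[nu1]_omega root_spin omega = \int[nu2]_omega root_spin omega.
  rewrite /Rintegral; congr fine; apply: eq_measure_integral => A mA _.
  by apply: contrapT => nA; apply: no; exists A.
have h1 : delta <= \int[nu1]_omega root_spin omega.
  by apply: (cvgr_to_ge (c1 _ continuous_root_spin)); apply: nearW => k; exact: dP.
have h2 : \int[nu2]_omega root_spin omega <= - delta.
  apply: (cvgr_to_le (c2 _ continuous_root_spin)); apply: nearW => k.
  by rewrite magnetization_minus lerN2; exact: dP.
rewrite eqI in h1; move: (le_trans h1 h2); lra.
Qed.

End Coexistence.

Lemma expR_opp2_le (R : realType) (beta : R) : 12 < expR beta ->
  36 * expR (- (2 * beta)) <= 1 / 4.
Proof.
move=> b12; have -> : 2 * beta = beta + beta by ring.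
rewrite expRN expRD ler_pdivrMr ?mulr_gt0 ?expR_gt0 //.
by nra.
Qed.

Local Close Scope classical_set_scope.

Theorem theorem2 (R : realType) (P : probability LT_infinite R)
    (hP : is_critical_limit P) :
  exists2 beta0 : R, 0 < beta0 &
    forall beta : R, beta0 < beta ->
      {ae P, forall T : LT_infinite, two_gibbs (repr (T : LT None)) beta}.
Proof.
(* 12 is the square root of 36 times 4, so exp(2 beta) > 144 yields 36 exp(-2 beta) < 1/4. *)
exists (ln 12); first by rewrite ln_gt0 // ltr1n.
move=> beta hb.
have b12 : 12 < expR beta by rewrite -[ltLHS]lnK ?posrE // ltr_expR.
have b0 : 0 < beta by apply: lt_trans hb; rewrite ln_gt0 // ltr1n.
have q_small : 36 * expR (- (2 * beta)) <= 1 / 4.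
  exact: expR_opp2_le.
apply: filterS (ae_eventually_not_bad hP) => T [M HM].
have M7 : (7 <= maxn M 7)%N by exact: leq_maxr.
have good h : (maxn M 7 <= h)%N -> robust_height (repr (T : LT None)) h.
  rewrite geq_max => /andP[Mh h7]; apply: robust_height_of_good; last exact: HM.
  exact: leq_trans h7.
have [delta d0 dP] := magnetization_pos b0 q_small M7 good.
exact: two_gibbs_of_magnetization d0 dP.
Qed.
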